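(* Let $N\ge 1$, let $\alpha>-1$ and let $\psi$ be an Orlicz function satisfying the $\Delta^2$-condition. Then the weighted Bergman-Orlicz space $A_\alpha^\psi(\mathbb{B}_N)$ coincides with the growth space $H^\infty_{w^\psi}(\mathbb{B}_N)$, with an equivalent norm. Moreover $AM_\alpha^\psi(\mathbb{B}_N)=H^0_{w^\psi}(\mathbb{B}_N)$.
   Context: $\mathbb{B}_N$ is the open Euclidean unit ball of $\mathbb{C}^N$, $H(\mathbb{B}_N)$ is the space of holomorphic functions on it, and for $\alpha>-1$, $dv_\alpha=c_\alpha(1-|z|^2)^\alpha dv$ is the normalized (probability) weighted Lebesgue measure on $\mathbb{B}_N$. An Orlicz function is a strictly convex function $\psi:[0,\infty)\to[0,\infty)$ with $\psi(0)=0$, continuous at $0$, and with $\psi(x)/x\to+\infty$ as $x\to+\infty$; $\psi^{-1}$ is its inverse. $\psi$ satisfies the $\Delta^2$-condition if there is $C>0$ with $\psi(x)^2\le\psi(Cx)$ for all $x$ large enough. $A_\alpha^\psi(\mathbb{B}_N)$ (resp. $AM_\alpha^\psi(\mathbb{B}_N)$) is the space of $f\in H(\mathbb{B}_N)$ such that $\int_{\mathbb{B}_N}\psi(|f|/C)\,dv_\alpha<\infty$ for some $C>0$ (resp. for every $C>0$), with the Luxemburg norm $\|f\|_{A_\alpha^\psi}=\inf\{C>0:\int_{\mathbb{B}_N}\psi(|f|/C)\,dv_\alpha\le1\}$. $w^\psi(z)=\left[\psi^{-1}\left(\frac{1}{1-|z|}\right)\right]^{-1}$ for $z\in\mathbb{B}_N$.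 For a weight (continuous positive function) $w$ on $\mathbb{B}_N$, $H_w^\infty(\mathbb{B}_N)=\{f\in H(\mathbb{B}_N):\|f\|_w=\sup_z|f(z)|w(z)<\infty\}$ and $H_w^0(\mathbb{B}_N)=\{f\in H(\mathbb{B}_N):\lim_{|z|\to1}|f(z)|w(z)=0\}$. *)

(* Defs.v *)
From HB Require Import structures.
From mathcomp Require Import all_boot all_order all_algebra.
From mathcomp Require Import all_classical all_reals all_analysis.
From mathcomp Require Import complex.

Set Implicit Arguments.
Unset Strict Implicit.
Unset Printing Implicit Defensive.

Import Order.TTheory GRing.Theory Num.Theory numFieldNormedType.Exports.
Import ComplexField.Normc.

Local Open Scope classical_set_scope.
Local Open Scope ring_scope.
Local Open Scope complex_scope.

(* The library's sigma-finite instance on m1 \x m2 only fires for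
   subprobabilities, whence this lemma and the instances below. *)
Lemma sigma_finite_product d1 d2 (T1 : measurableType d1)
    (T2 : measurableType d2) (R : realType)
    (m1 : {sigma_finite_measure set T1 -> \bar R})
    (m2 : {sigma_finite_measure set T2 -> \bar R}) :
  sigma_finite setT (m1 \x m2)%E.
Proof.
have /sigma_finiteP[F [TF ndF Foo]] := sigma_finiteT m1.
have /sigma_finiteP[G [TG ndG Goo]] := sigma_finiteT m2.
exists (fun n => F n `*` G n).
  rewrite -setXTT TF TG predeqE => -[x y]; split.
    move=> [/= [n _ Fnx] [k _ Gky]]; exists (maxn n k) => //; split.
    - by move: x Fnx; exact/subsetPset/ndF/leq_maxl.
    - by move: y Gky; exact/subsetPset/ndG/leq_maxr.
  by move=> [n _ []/= ? ?]; split; exists n.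
move=> k; have [? ?] := Foo k; have [? ?] := Goo k.
split; first exact: measurableX.
by rewrite product_measure1E// lte_mul_pinfty// ge0_fin_numE.
Qed.

(* [power_measure mu n] is the n-fold product measure mu \x ... \x mu. *)
Section power_measure.
Context d (T : measurableType d) (R : realType).
Variable mu : {sigma_finite_measure set T -> \bar R}.

Definition tuple_cons n (x : T * n.-tuple T) : n.+1.-tuple T :=
  [tuple of x.1 :: x.2].

Lemma measurable_tuple_cons n : measurable_fun setT (@tuple_cons n).
Proof. exact: measurable_cons. Qed.

Section step.
Variables (n : nat) (nu : {sigma_finite_measure set (n.-tuple T) -> \bar R}).

Definition power_step : set (n.+1.-tuple T) -> \bar R :=
  pushforward (mu \x nu)%E (@tuple_cons n).

Let preimage_cons A : measurable A -> measurable (@tuple_cons n @^-1` A).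
Proof.
by move=> mA; rewrite -[X in measurable X]setTI; exact: measurable_tuple_cons.
Qed.

Let power_step0 : power_step set0 = 0%E.
Proof. by rewrite /power_step /pushforward preimage_set0 measure0. Qed.

Let power_step_ge0 A : (0 <= power_step A)%E.
Proof. exact: (measure_ge0 (mu \x nu)%E). Qed.

Let power_step_sigma_additive : semi_sigma_additive power_step.
Proof.
move=> F mF tF mUF; rewrite /power_step /pushforward preimage_bigcup.
apply: measure_semi_sigma_additive.
- by move=> k; exact: preimage_cons.
- apply/trivIsetP => i j _ _ ij; rewrite -preimage_setI.
  by move/trivIsetP : tF => /(_ i j I I ij) ->; rewrite preimage_set0.
- by rewrite -preimage_bigcup; exact: preimage_cons.
Qed.

HB.instance Definition _ := isMeasure.Build _ _ _ power_step
  power_step0 power_step_ge0 power_step_sigma_additive.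

Let power_step_sigma_finite : sigma_finite setT power_step.
Proof.
have [H UH Hoo] := sigma_finite_product mu nu.
pose uncons (t : n.+1.-tuple T) := (thead t, [tuple of behead t]).
have consK : cancel (@tuple_cons n) uncons.
  by case=> x t; rewrite /uncons theadE; congr pair; exact/val_inj.
exists (fun k => uncons @^-1` H k).
  by rewrite -preimage_bigcup -UH preimage_setT.
move=> k; have [mH Hk] := Hoo k; split.
  rewrite -[X in measurable X]setTI.
  have : measurable_fun setT uncons; last by apply.
  by apply/measurable_fun_pair; [exact: measurable_tnth|exact: measurable_behead].
rewrite /power_step /pushforward -comp_preimage.
by rewrite (_ : _ \o _ = id) ?preimage_id//; exact/funext.
Qed.

HB.instance Definition _ := Measure_isSigmaFinite.Build _ _ _ power_step
  power_step_sigma_finite.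
End step.

Fixpoint power_measure n : {sigma_finite_measure set (n.-tuple T) -> \bar R} :=
  if n is n'.+1 then power_step (power_measure n') else \d_([tuple]).
End power_measure.



Section orlicz_functions.
Variable R : realType.

(* An Orlicz function has domain [0, +oo[; it is represented by a function on
   the whole of R whose values at negative numbers are never used. *)
Record orlicz_function (psi : R -> R) : Prop := OrliczFunction {
  orlicz_ge0 : forall x, 0 <= x -> 0 <= psi x;
  orlicz0 : psi 0 = 0;
  orlicz_strictly_convex : forall x y t, 0 <= x -> 0 <= y -> x != y ->
    0 < t < 1 -> psi (t * x + (1 - t) * y) < t * psi x + (1 - t) * psi y;
  orlicz_continuous0 : psi x @[x --> 0^'+] --> psi 0;
  orlicz_superlinear : psi x / x @[x --> +oo] --> +oo }.

Definition Delta2_condition (psi : R -> R) : Prop :=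
  exists2 C : R, 0 < C & \forall x \near +oo, psi x ^+ 2 <= psi (C * x).

Definition orlicz_inv (psi : R -> R) : R -> R :=
  'pinv_(fun=> 0) [set x | 0 <= x] psi.

End orlicz_functions.

(* R[i] seen as a numFieldType, from which it gets its topology *)
Definition complex_field (R : realType) : numFieldType := R[i].

Section complex_space.
Variables (R : realType) (N : nat).
Local Notation C := (complex_field R).
Local Notation CN := 'rV[C]_N.
Implicit Types (f : CN -> C) (w : CN -> R) (psi : R -> R) (alpha : R).

(* The library norm on row vectors is the sup norm: it defines the topology of
   C^N and hence differentiability, but the unit ball is Euclidean. *)
Definition euclid_norm (z : CN) : R := Num.sqrt (\sum_i normc (z 0 i) ^+ 2).

Definition unit_ball : set CN := [set z | euclid_norm z < 1].

(* [differentiable] over the field C, i.e. the differential is C-linear.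
   Elements of H(B_N) are represented by functions on C^N whose values outside
   the ball are arbitrary and never used. *)
Definition holomorphic : set (CN -> C) :=
  [set f | forall z, unit_ball z -> differentiable f z].

Definition lebesgue_plane :
    set (measurableTypeR R * measurableTypeR R) -> \bar R :=
  (@lebesgue_measure R \x @lebesgue_measure R)%E.

HB.instance Definition _ := Measure.on lebesgue_plane.

HB.instance Definition _ := Measure_isSigmaFinite.Build _ _ _ lebesgue_plane
  (sigma_finite_product (@lebesgue_measure R) (@lebesgue_measure R)).

(* C^N is identified with (R x R)^N, which carries Lebesgue measure. *)
Definition to_CN (t : N.-tuple (measurableTypeR R * measurableTypeR R)) : CN :=
  \row_i ((tnth t i).1 +i* (tnth t i).2).

(* \int_{B_N} g(z) (1 - |z|^2)^alpha dv(z), for g >= 0 *)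
Definition weighted_integral alpha (g : CN -> R) : \bar R :=
  (\int[power_measure lebesgue_plane N]_(t in to_CN @^-1` unit_ball)
    (g (to_CN t) * (1 - euclid_norm (to_CN t) ^+ 2) `^ alpha)%:E)%E.

(* the c_alpha that makes dv_alpha a probability measure *)
Definition normalizing_constant alpha : R :=
  (fine (weighted_integral alpha (fun=> 1)))^-1.

(* \int_{B_N} g dv_alpha *)
Definition integral_v alpha (g : CN -> R) : \bar R :=
  ((normalizing_constant alpha)%:E * weighted_integral alpha g)%E.

Definition orlicz_integral alpha psi f (c : R) : \bar R :=
  integral_v alpha (fun z => psi (normc (f z) / c)).

Definition bergman_orlicz alpha psi : set (CN -> C) :=
  [set f | holomorphic f /\
    exists2 c : R, 0 < c & (orlicz_integral alpha psi f c < +oo)%E].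

Definition bergman_morse_orlicz alpha psi : set (CN -> C) :=
  [set f | holomorphic f /\
    forall c : R, 0 < c -> (orlicz_integral alpha psi f c < +oo)%E].

Definition luxemburg_norm alpha psi f : \bar R :=
  ereal_inf [set c%:E | c in
    [set c : R | 0 < c /\ (orlicz_integral alpha psi f c <= 1)%E]].

Definition orlicz_weight psi : CN -> R :=
  fun z => (orlicz_inv psi (1 / (1 - euclid_norm z)))^-1.

Definition weighted_sup_norm w f : \bar R :=
  ereal_sup [set (normc (f z) * w z)%:E | z in unit_ball].

Definition growth_space w : set (CN -> C) :=
  [set f | holomorphic f /\ (weighted_sup_norm w f < +oo)%E].

(* |f(z)| w(z) -> 0 as |z| -> 1 inside the ball *)
Definition little_growth_space w : set (CN -> C) :=
  [set f | holomorphic f /\ forall e : R, 0 < e ->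
    \forall r \near 1^'-, forall z, euclid_norm z = r -> normc (f z) * w z < e].

End complex_space.

Arguments bergman_orlicz {R} N alpha psi.
Arguments bergman_morse_orlicz {R} N alpha psi.
Arguments orlicz_weight {R} N psi.

(* Main.v *)
Require Import Defs.
From mathcomp Require Import all_boot all_order all_algebra.
From mathcomp Require Import all_classical all_reals all_analysis.
From mathcomp Require Import measurable_realfun complex ring lra.
Import Order.TTheory GRing.Theory Num.Theory numFieldNormedType.Exports.
Import ComplexField.Normc.
Set Implicit Arguments.
Unset Strict Implicit.
Unset Printing Implicit Defensive.
Local Open Scope classical_set_scope.
Local Open Scope ring_scope.

(** Fix a point [z] of the ball and put [y = psi^-1 (1 / (1 - |z|))], so that the
weight at [z] is [1 / y]. The condition [Delta^2] says that dilating the argument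
of [psi] absorbs powers: [K * psi y ^+ k <= psi (B * y)] for all [y] bounded away
from 0 ([Delta2_power_le]) and, read backwards, [psi (y / B)] is at most a
constant plus an arbitrarily small power of [psi y] ([Delta2_root_le]). As
[psi y = 1 / (1 - |z|)], polynomial losses in [1 / (1 - |z|)] outside [psi] and
constants in front of [|f|] are therefore both harmless.

From growth to integrals: if [|f| <= M * y], then [psi (|f| / (B * M))] is at most
[psi (y / B)], hence a constant plus [(1 / (1 - |z|)) `^ e] with [e] as small as
desired, and this is integrable since [alpha - e > -1]
([weighted_integral_root], [integral_of_bound]).

From integrals to growth: [|f a|] is at most a constant times the average of [|f|]
over a product of squares centred at [a], of size comparable to [1 - |a|]
([box_mean]). Convexity carries this inequality through [psi]
([box_mean_orlicz]), and bounding the density from below on the product of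
squares gives
[psi (|f a| / (A * c)) <= K * (1 / (1 - |a|)) ^+ q * \int psi (|f| / c) dv_alpha]
([pointwise_estimate]); [Delta^2] then bounds [|f a|] by a constant times [c * y].
The constant does not depend on [c] near the boundary, so letting [c] tend to 0
gives the statement on the little spaces; in the other direction, a function of
the little growth space is bounded on smaller balls by compactness
([holomorphic_bounded]).

The mean inequality has to come from complex differentiability alone, the
derivative not being assumed continuous. In one variable, symmetrize [f] into
[F z = \sum_(k < 4) f (i^k z)] and consider the form [F(z) dz / z] on the sector
[z = x (1 + i t)], [|t| <= 1]. The form is closed, which is Goursat's bisection
argument ([goursat_rectangle]); its two sides [t = 1] and [t = -1] are exchanged
by the quarter turn, which leaves the form invariant, so their contributions
cancel, and the integral over the segment of abscissa [x] does not depend on [x]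
([segment_form_invariant]). Its limit at [x = 0] is a multiple of [F 0].
Averaging over [x] bounds [|f 0|] by the mean of [|f|] over a square
([square_mean]), and Tonelli's theorem iterates the bound over the variables
([iterated_mean]). *)

(** * Bisection of rectangles *)

Section bisection.
Context {R : realType}.
Implicit Types (a b c d x y : R).

Definition half_itv (i : bool) (s : R * R) : R * R :=
  let m := (s.1 + s.2) / 2 in if i then (m, s.2) else (s.1, m).

Fixpoint nested_halves (i : nat -> bool) (s : R * R) (n : nat) : R * R :=
  if n is n'.+1 then half_itv (i n') (nested_halves i s n') else s.

Lemma nested_halves_width i s n :
  (nested_halves i s n).2 - (nested_halves i s n).1 = (s.2 - s.1) / 2 ^+ n.
Proof.
elim: n => [|n ih] /=; first by rewrite expr0 divr1.
rewrite /half_itv; case: (i n) => /=; rewrite exprSr invfM mulrA -ih; lra.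
Qed.

Lemma nested_halves_le i s n : s.1 <= s.2 -> (nested_halves i s n).1 <= (nested_halves i s n).2.
Proof. by move=> s12; rewrite -subr_ge0 nested_halves_width divr_ge0 ?subr_ge0 ?exprn_ge0. Qed.

Lemma nested_halves_mono i s n k : s.1 <= s.2 ->
  (nested_halves i s n).1 <= (nested_halves i s (k + n)%N).1 /\
  (nested_halves i s (k + n)%N).2 <= (nested_halves i s n).2.
Proof.
move=> s12; elim: k => [//|k [ih1 ih2]] /=.
have := nested_halves_le i (k + n) s12.
rewrite /half_itv; case: (i _) => /= h; split; lra.
Qed.

Lemma nested_halves_common i s : s.1 <= s.2 ->
  exists x, forall n, (nested_halves i s n).1 <= x <= (nested_halves i s n).2.
Proof.
move=> s12; pose A := range (fun n => (nested_halves i s n).1).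
have ubA m : ubound A (nested_halves i s m).2.
  move=> _ [n _ <-].
  have [h1 _] := nested_halves_mono i n m s12; have [_ h2] := nested_halves_mono i m n s12.
  by rewrite (le_trans h1)// (le_trans (nested_halves_le _ _ s12))// addnC.
exists (sup A) => n; apply/andP; split.
  by apply: ub_le_sup; [exists (nested_halves i s 0).2; exact: ubA|exists n].
by apply: ge_sup; [exists (nested_halves i s 0).1; exists 0%N|exact: ubA].
Qed.

(** A property of small rectangles that passes from the four quarters to the
whole holds globally: otherwise choose a bad quarter repeatedly; the chosen
rectangles shrink to a point, where the local hypothesis contradicts badness. *)
Lemma rectangle_bisection (S : R * R -> R * R -> Prop) (s t : R * R) :
  s.1 <= s.2 -> t.1 <= t.2 ->
  (forall s' t', s'.1 <= s'.2 -> t'.1 <= t'.2 ->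
    (forall i j, S (half_itv i s') (half_itv j t')) -> S s' t') ->
  (forall x y, s.1 <= x <= s.2 -> t.1 <= y <= t.2 ->
    exists2 e, 0 < e & forall s' t', s'.1 <= x <= s'.2 -> t'.1 <= y <= t'.2 ->
      s.1 <= s'.1 -> s'.2 <= s.2 -> t.1 <= t'.1 -> t'.2 <= t.2 ->
      s'.2 - s'.1 < e -> t'.2 - t'.1 < e -> S s' t') ->
  S s t.
Proof.
move=> s12 t12 Squarter Slocal; apply: contrapT => nS.
have /choice[g gP] : forall q : (R * R) * (R * R), exists ij : bool * bool,
    q.1.1 <= q.1.2 -> q.2.1 <= q.2.2 -> ~ S q.1 q.2 ->
    ~ S (half_itv ij.1 q.1) (half_itv ij.2 q.2).
  move=> [s' t'] /=; apply: contrapT => /forallNP h; apply: (h (true, true)).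
  move=> s'12 t'12 nS'; exfalso; apply: nS'; apply: Squarter => // i j.
  by apply: contrapT => nSij; apply: (h (i, j)).
pose fix q n := if n is n'.+1 then
  (half_itv (g (q n')).1 (q n').1, half_itv (g (q n')).2 (q n').2) else (s, t).
pose i n := (g (q n)).1; pose j n := (g (q n)).2.
have q1 n : (q n).1 = nested_halves i s n by elim: n => //= n <-.
have q2 n : (q n).2 = nested_halves j t n by elim: n => //= n <-.
have nSq n : ~ S (nested_halves i s n) (nested_halves j t n).
  rewrite -q1 -q2; elim: n => [//|n ih] /=; apply: gP => //.
    by rewrite q1 nested_halves_le.
  by rewrite q2 nested_halves_le.
have [x xP] := nested_halves_common i s12; have [y yP] := nested_halves_common j t12.
have [e e0 He] := Slocal x y (xP 0%N) (yP 0%N).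
have [n [ns nt]] : exists n : nat, (s.2 - s.1) / 2 ^+ n < e /\ (t.2 - t.1) / 2 ^+ n < e.
  have [n hn] : exists n : nat, (s.2 - s.1 + (t.2 - t.1)) / e < n%:R.
    by exists (Num.bound ((s.2 - s.1 + (t.2 - t.1)) / e));
      rewrite archi_boundP// divr_ge0 ?(ltW e0)// addr_ge0 ?subr_ge0.
  exists n; rewrite !ltr_pdivrMr ?exprn_gt0//.
  have : n%:R < 2 ^+ n :> R by rewrite -natrX ltr_nat ltn_expl.
  move=> n2; move: hn; rewrite ltr_pdivrMr// => hn.
  have : n%:R * e < 2 ^+ n * e by rewrite ltr_pM2r.
  split; lra.
apply: (nSq n); apply: He => //.
- by have := nested_halves_mono i 0 n s12; rewrite addn0 => -[].
- by have := nested_halves_mono i 0 n s12; rewrite addn0 => -[].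
- by have := nested_halves_mono j 0 n t12; rewrite addn0 => -[].
- by have := nested_halves_mono j 0 n t12; rewrite addn0 => -[].
- by rewrite nested_halves_width.
- by rewrite nested_halves_width.
Qed.

End bisection.

(** * Circulation of a closed form around a rectangle *)

Section interval_integral.
Context {R : realType}.
Implicit Types (a b c d x y : R) (f g : R -> R).
Local Notation I a b f := (\int[@lebesgue_measure R]_(x in `[a, b]) f x).

Lemma continuous_itv_integrable a b f : {within `[a, b], continuous f} ->
  (@lebesgue_measure R).-integrable `[a, b] (EFin \o f).
Proof.
by move=> cf; apply: continuous_compact_integrable => //; exact: segment_compact.
Qed.

Lemma continuous_subitv a b a' b' f : a <= a' -> b' <= b ->
  {within `[a, b], continuous f} -> {within `[a', b'], continuous f}.
Proof.
move=> aa' bb'; apply: continuous_subspaceW => x /=.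
rewrite !in_itv/= => /andP[? ?]; apply/andP; split; lra.
Qed.

Lemma itv_integral_split a m b f : a <= m -> m <= b ->
  {within `[a, b], continuous f} -> I a b f = I a m f + I m b f.
Proof.
move=> am mb cf; have fi := continuous_itv_integrable cf.
have := @Rintegral_itvB R f (BLeft a) (BRight b) m fi.
rewrite !bnd_simp => /(_ am mb) /eqP.
rewrite subr_eq addrC => /eqP ->; congr (_ + _).
rewrite Rintegral_itv_obnd_cbnd//.
apply: integrableS (continuous_itv_integrable (continuous_subitv am (lexx b) cf)) => //.
by apply: subset_itvr; rewrite bnd_simp.
Qed.

Lemma itv_integralD a b f g : {within `[a, b], continuous f} ->
  {within `[a, b], continuous g} -> I a b (fun x => f x + g x) = I a b f + I a b g.
Proof. by move=> cf cg; rewrite RintegralD//; exact: continuous_itv_integrable. Qed.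

Lemma itv_integralB a b f g : {within `[a, b], continuous f} ->
  {within `[a, b], continuous g} -> I a b (fun x => f x - g x) = I a b f - I a b g.
Proof. by move=> cf cg; rewrite RintegralB//; exact: continuous_itv_integrable. Qed.

Lemma itv_integral_cst a b c : a <= b -> I a b (fun=> c) = c * (b - a).
Proof.
move=> ab; rewrite Rintegral_cst//= lebesgue_measure_itv/= lte_fin.
by case: ltP => // ba; rewrite /= (le_anti (introT andP (conj ab ba))) subrr.
Qed.

Lemma within_continuous_cst (A : set R) c : {within A, continuous (fun=> c : R)}.
Proof. by move=> x; exact: cvg_cst. Qed.

Lemma le_itv_integral a b f g : {within `[a, b], continuous f} ->
  {within `[a, b], continuous g} -> (forall x, a <= x <= b -> f x <= g x) ->
  I a b f <= I a b g.
Proof.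
move=> cf cg fg; apply: le_Rintegral => //; try exact: continuous_itv_integrable.
Qed.

Lemma itv_integral_bound a b f M : a <= b -> {within `[a, b], continuous f} ->
  (forall x, a <= x <= b -> `|f x| <= M) -> `|I a b f| <= M * (b - a).
Proof.
move=> ab cf fM; rewrite -(itv_integral_cst M ab) ler_norml; apply/andP; split.
  have -> : - I a b (fun=> M) = I a b (fun=> - M).
    by rewrite !itv_integral_cst// mulNr.
  apply: le_itv_integral => //; first exact: within_continuous_cst.
  by move=> x /fM; rewrite ler_norml => /andP[].
apply: le_itv_integral => //; first exact: within_continuous_cst.
by move=> x /fM; rewrite ler_norml => /andP[].
Qed.

Lemma within_continuousD (A : set R) f g : {within A, continuous f} ->
  {within A, continuous g} -> {within A, continuous (fun x => f x + g x)}.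
Proof. by move=> cf cg x; apply: cvgD; [exact: cf|exact: cg]. Qed.

Lemma within_continuousB (A : set R) f g : {within A, continuous f} ->
  {within A, continuous g} -> {within A, continuous (fun x => f x - g x)}.
Proof. by move=> cf cg x; apply: cvgB; [exact: cf|exact: cg]. Qed.

(** Integral of the form [P dx + Q dy] along the boundary of [s x t], run
counterclockwise. *)
Definition circulation (P Q : R -> R -> R) (s t : R * R) : R :=
  I s.1 s.2 (P^~ t.1) + I t.1 t.2 (Q s.2) - I s.1 s.2 (P^~ t.2) - I t.1 t.2 (Q s.1).

Lemma circulation_halves P Q s t : s.1 <= s.2 -> t.1 <= t.2 ->
  (forall y, t.1 <= y <= t.2 -> {within `[s.1, s.2], continuous (P^~ y)}) ->
  (forall x, s.1 <= x <= s.2 -> {within `[t.1, t.2], continuous (Q x)}) ->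
  circulation P Q s t =
  circulation P Q (half_itv false s) (half_itv false t) + circulation P Q (half_itv false s)
    (half_itv true t)
  + circulation P Q (half_itv true s) (half_itv false t) + circulation P Q (half_itv true s)
    (half_itv true t).
Proof.
case: s t => a b [c d] /= ab cd cP cQ; rewrite /circulation /half_itv /=.
set m := (a + b) / 2; set n := (c + d) / 2.
have am : a <= m by rewrite /m; lra. have mb : m <= b by rewrite /m; lra.
have cn : c <= n by rewrite /n; lra. have nd : n <= d by rewrite /n; lra.
have hP y : c <= y <= d -> I a b (P^~ y) = I a m (P^~ y) + I m b (P^~ y).
  by move=> ycd; rewrite (@itv_integral_split a m b)//; exact: cP.
have hQ x : a <= x <= b -> I c d (Q x) = I c n (Q x) + I n d (Q x).
  by move=> xab; rewrite (@itv_integral_split c n d)//; exact: cQ.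
have aa : a <= a <= b by rewrite lexx. have bb : a <= b <= b by rewrite ab lexx.
have mm : a <= m <= b by rewrite am.
have cc : c <= c <= d by rewrite lexx. have dd : c <= d <= d by rewrite cd lexx.
have nn : c <= n <= d by rewrite cn.
rewrite !hP// !hQ//; ring.
Qed.

(** The form [(al x + p y) dx + (be y + p x) dy] is exact, so only the error terms
contribute, each side at most [e] times the sum of the widths times its length. *)
Lemma circulation_local P Q (p : R) (al be : R -> R) s t x0 y0 e :
  s.1 <= x0 <= s.2 -> t.1 <= y0 <= t.2 -> 0 <= e ->
  (forall y, t.1 <= y <= t.2 -> {within `[s.1, s.2], continuous (P^~ y)}) ->
  (forall x, s.1 <= x <= s.2 -> {within `[t.1, t.2], continuous (Q x)}) ->
  {within `[s.1, s.2], continuous al} -> {within `[t.1, t.2], continuous be} ->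
  (forall x y, s.1 <= x <= s.2 -> t.1 <= y <= t.2 ->
    `|P x y - (al x + p * y)| <= e * (`|x - x0| + `|y - y0|) /\
    `|Q x y - (be y + p * x)| <= e * (`|x - x0| + `|y - y0|)) ->
  `|circulation P Q s t| <= e * 2 * (s.2 - s.1 + (t.2 - t.1)) ^+ 2.
Proof.
case: s t => a b [c d] /= /andP[ax xb] /andP[cy yd] e0 cP cQ cal cbe PQ.
have ab : a <= b by lra. have cd : c <= d by lra.
have hP y : c <= y <= d -> `|I a b (P^~ y) - (I a b al + p * y * (b - a))| <=
    e * (b - a + (d - c)) * (b - a).
  move=> ycd; rewrite -itv_integral_cst// -itv_integralD//; last exact: within_continuous_cst.
  rewrite -itv_integralB//; [|exact: cP|apply: within_continuousD => //;
    exact: within_continuous_cst].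
  apply: itv_integral_bound => //.
    by apply: within_continuousB; [exact: cP|apply: within_continuousD => //;
      exact: within_continuous_cst].
  move=> x xab; have [h _] := PQ x y xab ycd; apply: (le_trans h).
  rewrite ler_wpM2l// lerD// ler_norml; apply/andP; split; lra.
have hQ x : a <= x <= b -> `|I c d (Q x) - (I c d be + p * x * (d - c))| <=
    e * (b - a + (d - c)) * (d - c).
  move=> xab; rewrite -itv_integral_cst// -itv_integralD//; last exact: within_continuous_cst.
  rewrite -itv_integralB//; [|exact: cQ|apply: within_continuousD => //;
    exact: within_continuous_cst].
  apply: itv_integral_bound => //.
    by apply: within_continuousB; [exact: cQ|apply: within_continuousD => //;
      exact: within_continuous_cst].
  move=> y ycd; have [_ h] := PQ x y xab ycd; apply: (le_trans h).
  rewrite ler_wpM2l// lerD// ler_norml; apply/andP; split; lra.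
have {}hP1 := hP c; have {hP}hP2 := hP d.
have {}hQ1 := hQ a; have {hQ}hQ2 := hQ b.
move: hP1 hP2 hQ1 hQ2; rewrite !lexx !ab !cd /= => /(_ isT) + /(_ isT) + /(_ isT) + /(_ isT).
rewrite /circulation /=; set A1 := I a b (P^~ c); set A2 := I a b (P^~ d).
set A3 := I c d (Q a); set A4 := I c d (Q b); set A5 := I a b al; set A6 := I c d be.
move: A1 A2 A3 A4 A5 A6 => A1 A2 A3 A4 A5 A6.
rewrite !ler_norml => /andP[? ?] /andP[? ?] /andP[? ?] /andP[? ?].
apply/andP; split; nra.
Qed.

Lemma dist_in_itv a b u v d :
  a <= u <= b -> a <= v <= b -> b - a < d -> `|v - u| < d.
Proof.
move=> /andP[au ub] /andP[av vb]; apply: le_lt_trans.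
by rewrite ler_distlC; apply/andP; split; lra.
Qed.

Lemma midpoint_between (s : R * R) : s.1 <= s.2 ->
  s.1 <= (s.1 + s.2) / 2 /\ (s.1 + s.2) / 2 <= s.2.
Proof. by case: s => a b /= ab; split; lra. Qed.

(** Goursat's argument. The derivatives of [P] and [Q] are only compared at one
point at a time: near each point the form must agree to first order with an exact
one. Splitting off arbitrary functions [al] of [x] and [be] of [y], and not only
affine ones, spares the linearization of factors such as [1 / x]. *)
Lemma goursat_rectangle P Q s t : s.1 <= s.2 -> t.1 <= t.2 ->
  (forall y, t.1 <= y <= t.2 -> {within `[s.1, s.2], continuous (P^~ y)}) ->
  (forall x, s.1 <= x <= s.2 -> {within `[t.1, t.2], continuous (Q x)}) ->
  (forall x0 y0, s.1 <= x0 <= s.2 -> t.1 <= y0 <= t.2 ->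
    exists (p : R) (al be : R -> R), [/\ {within `[s.1, s.2], continuous al},
      {within `[t.1, t.2], continuous be} &
      forall e, 0 < e -> exists2 del, 0 < del & forall x y,
        s.1 <= x <= s.2 -> t.1 <= y <= t.2 ->
        `|x - x0| < del -> `|y - y0| < del ->
        `|P x y - (al x + p * y)| <= e * (`|x - x0| + `|y - y0|) /\
        `|Q x y - (be y + p * x)| <= e * (`|x - x0| + `|y - y0|)]) ->
  circulation P Q s t = 0.
Proof.
move=> s12 t12 cP cQ loc.
suff H e : 0 < e -> `|circulation P Q s t| <= e * 2 * (s.2 - s.1 + (t.2 - t.1)) ^+ 2.
  apply/normr0_eq0/le_anti; rewrite normr_ge0 andbT.
  set L := (_ ^+ 2) in H; have L0 : 0 <= L by exact: sqr_ge0.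
  apply/ler_addgt0Pl => e e0; rewrite addr0.
  have h : 0 < e / (2 * (L + 1)) by rewrite divr_gt0// mulr_gt0// ltr_wpDl.
  apply: (le_trans (H _ h)).
  have L10 : L + 1 != 0 by rewrite gt_eqF// ltr_wpDl.
  have -> : e / (2 * (L + 1)) * 2 * L = e * (L / (L + 1)) by field.
  by rewrite ler_piMr ?(ltW e0)// ler_pdivrMr ?mul1r; [rewrite lerDl|rewrite ltr_wpDl].
move=> e0.
pose S s' t' := s.1 <= s'.1 -> s'.2 <= s.2 -> t.1 <= t'.1 -> t'.2 <= t.2 ->
  `|circulation P Q s' t'| <= e * 2 * (s'.2 - s'.1 + (t'.2 - t'.1)) ^+ 2.
suff : S s t by apply.
have cP' s' t' : s.1 <= s'.1 -> s'.2 <= s.2 -> t.1 <= t'.1 -> t'.2 <= t.2 ->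
    forall y, t'.1 <= y <= t'.2 -> {within `[s'.1, s'.2], continuous (P^~ y)}.
  move=> as' bs' ct' dt' y /andP[h1 h2]; apply: continuous_subitv as' bs' _.
  by apply: cP; rewrite (le_trans ct' h1) (le_trans h2 dt').
have cQ' s' t' : s.1 <= s'.1 -> s'.2 <= s.2 -> t.1 <= t'.1 -> t'.2 <= t.2 ->
    forall x, s'.1 <= x <= s'.2 -> {within `[t'.1, t'.2], continuous (Q x)}.
  move=> as' bs' ct' dt' x /andP[h1 h2]; apply: continuous_subitv ct' dt' _.
  by apply: cQ; rewrite (le_trans as' h1) (le_trans h2 bs').
apply: rectangle_bisection => //.
  move=> s' t' s'12 t'12 Sh as' bs' ct' dt'.
  rewrite circulation_halves//; [|exact: cP'|exact: cQ'].
  have [h1 h2] := midpoint_between s'12; have [h3 h4] := midpoint_between t'12.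
  have k1 := Sh true true; have k2 := Sh true false.
  have k3 := Sh false true; have k4 := Sh false false.
  rewrite /S /half_itv /= in k1 k2 k3 k4 *.
  have {}k1 := k1 (le_trans as' h1) bs' (le_trans ct' h3) dt'.
  have {}k2 := k2 (le_trans as' h1) bs' ct' (le_trans h4 dt').
  have {}k3 := k3 as' (le_trans h2 bs') (le_trans ct' h3) dt'.
  have {}k4 := k4 as' (le_trans h2 bs') ct' (le_trans h4 dt').
  apply: le_trans (ler_normD _ _) _;
    apply: le_trans (lerD (le_trans (ler_normD _ _) (lerD (le_trans (ler_normD _ _)
      (lerD k4 k3)) k2)) k1) _.
  by rewrite le_eqVlt; apply/orP; left; apply/eqP; field.
move=> x y xs yt; have [p [al [be [cal cbe /(_ _ e0)[del del0 h]]]]] := loc x y xs yt.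
exists del => // s' t' xs' yt' h1 h2 h3 h4 h5 h6 _ _ _ _.
apply: (@circulation_local _ _ p al be _ _ x y) => //; first exact: ltW.
- exact: cP'.
- exact: cQ'.
- exact: (@continuous_subitv s.1 s.2).
- exact: (@continuous_subitv t.1 t.2).
move=> z w zs wt; move: (zs) (wt) => /andP[z1 z2] /andP[w1 w2]; apply: h.
- by rewrite (le_trans h1 z1) (le_trans z2 h2).
- by rewrite (le_trans h3 w1) (le_trans w2 h4).
- exact: dist_in_itv xs' zs h5.
- exact: dist_in_itv yt' wt h6.
Qed.

End interval_integral.

(** * Complex derivability in real coordinates *)

Section cauchy_riemann.
Context {R : realType}.
Implicit Types (a b c d x y r : R) (U V A B : R -> R -> R).
Local Notation I a b f := (\int[@lebesgue_measure R]_(x in `[a, b]) f x).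

(** [U + i V] has complex derivative [p + i q] at [x0 + i y0]. *)
Definition complex_derivable U V x0 y0 := exists p q : R,
  forall e, 0 < e -> exists2 del, 0 < del & forall x y,
    `|x - x0| < del -> `|y - y0| < del ->
    `|U x y - (U x0 y0 + p * (x - x0) - q * (y - y0))| <= e * (`|x - x0| + `|y - y0|) /\
    `|V x y - (V x0 y0 + q * (x - x0) + p * (y - y0))| <= e * (`|x - x0| + `|y - y0|).

Lemma complex_derivableD U V A B x y : complex_derivable U V x y ->
  complex_derivable A B x y ->
  complex_derivable (fun x y => U x y + A x y) (fun x y => V x y + B x y) x y.
Proof.
move=> [p [q h]] [p' [q' h']]; exists (p + p'), (q + q') => e e0.
have e20 : 0 < e / 2 by rewrite divr_gt0.
have [d d0 {}h] := h _ e20; have [d' d'0 {}h'] := h' _ e20.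
exists (Num.min d d'); first by rewrite lt_min d0.
move=> x' y'; rewrite !lt_min => /andP[xd xd'] /andP[yd yd'].
have [] := h _ _ xd yd; have [] := h' _ _ xd' yd'.
move: (`|x' - x| + `|y' - y|) => L h1 h2 h3 h4; split.
  have := ler_normD (U x' y' - (U x y + p * (x' - x) - q * (y' - y)))
                    (A x' y' - (A x y + p' * (x' - x) - q' * (y' - y))).
  set w := _ + _; set w' := (X in _ -> `|X| <= _).
  have -> : w' = w by rewrite /w /w'; ring.
  move=> /le_trans; apply; lra.
have := ler_normD (V x' y' - (V x y + q * (x' - x) + p * (y' - y)))
                    (B x' y' - (B x y + q' * (x' - x) + p' * (y' - y))).
set w := _ + _; set w' := (X in _ -> `|X| <= _).
have -> : w' = w by rewrite /w /w'; ring.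
move=> /le_trans; apply; lra.
Qed.

(** [z |-> f (i z)] has derivative [i f' (i z)]. *)
Lemma complex_derivable_rot U V x y : complex_derivable U V (- y) x ->
  complex_derivable (fun x y => U (- y) x) (fun x y => V (- y) x) x y.
Proof.
move=> [p [q h]]; exists (- q), p => e e0; have [d d0 {}h] := h _ e0.
exists d => // x' y' xd yd.
have nyy : `|- y' - - y| = `|y' - y| by rewrite opprK addrC distrC.
have [] := h (- y') x'; rewrite ?nyy//.
rewrite (addrC `|y' - y|) => h1 h2; split.
  apply: le_trans h1; rewrite le_eqVlt; apply/orP; left; apply/eqP; congr `|_|; ring.
apply: le_trans h2; rewrite le_eqVlt; apply/orP; left; apply/eqP; congr `|_|; ring.
Qed.

(** [V - i U] is [- i (U + i V)]. *)
Lemma complex_derivableMi U V x y : complex_derivable U V x y ->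
  complex_derivable V (fun x y => - U x y) x y.
Proof.
move=> [p [q h]]; exists q, (- p) => e e0; have [d d0 {}h] := h _ e0.
exists d => // x' y' xd yd; have [h1 h2] := h _ _ xd yd; split.
  apply: le_trans h2; rewrite le_eqVlt; apply/orP; left; apply/eqP; congr `|_|; ring.
rewrite -normrN; apply: le_trans h1; rewrite le_eqVlt; apply/orP; left; apply/eqP; congr `|_|; ring.
Qed.

Lemma complex_derivable_continuous U V x y : complex_derivable U V x y ->
  forall e, 0 < e -> exists2 del, 0 < del & forall x' y',
    `|x' - x| < del -> `|y' - y| < del ->
    `|U x' y' - U x y| < e /\ `|V x' y' - V x y| < e.
Proof.
move=> [p [q h]] e e0; have [d d0 {}h] := h 1 ltr01.
pose M := 1 + `|p| + `|q|; have M0 : 0 < M by rewrite /M -addrA ltr_pwDl// addr_ge0.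
exists (Num.min d (e / (2 * M))); first by rewrite lt_min d0 divr_gt0// mulr_gt0.
move=> x' y'; rewrite !lt_min !ltr_pdivlMr ?mulr_gt0// => /andP[xd xM] /andP[yd yM].
have [] := h _ _ xd yd; rewrite mul1r.
have hp (w z : R) : `|w * z| <= `|w| * `|z| by rewrite normrM.
have := hp p (x' - x); have := hp q (x' - x); have := hp p (y' - y); have := hp q (y' - y).
move: xM yM; rewrite /M; move: {hp} (normr_ge0 (x' - x)) (normr_ge0 (y' - y)).
have := normr_ge0 p; have := normr_ge0 q.
move: (`|x' - x|) (`|y' - y|) (`|p|) (`|q|) => X Y p' q' p0 q0 X0 Y0 hX hY.
move: (p * (x' - x)) (q * (x' - x)) (p * (y' - y)) (q * (y' - y)) => a b c d'.
rewrite !ler_norml !ltr_norml => /andP[? ?] /andP[? ?] /andP[? ?] /andP[? ?] /andP[? ?] /andP[? ?].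
split; apply/andP; split; nra.
Qed.

Lemma complex_derivable_cvg U V (f g : R -> R) s :
  complex_derivable U V (f s) (g s) ->
  {for s, continuous f} -> {for s, continuous g} ->
  {for s, continuous (fun s => U (f s) (g s))} /\
  {for s, continuous (fun s => V (f s) (g s))}.
Proof.
move=> /complex_derivable_continuous h cf cg.
have H e : 0 < e -> \forall t \near s, `|U (f t) (g t) - U (f s) (g s)| < e /\
    `|V (f t) (g t) - V (f s) (g s)| < e.
  move=> e0; have [d d0 {}h] := h _ e0.
  move/cvgrPdist_lt : cf => /(_ _ d0) cf; move/cvgrPdist_lt : cg => /(_ _ d0) cg.
  near=> t; apply: h; rewrite distrC; by [near: t; exact: cf|near: t; exact: cg].
split; apply/cvgrPdist_lt => e /H; apply: filterS => t; rewrite distrC => -[]//.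
by rewrite [X in _ -> X < _ -> _]distrC.
Unshelve. all: by end_near. Qed.

End cauchy_riemann.

(** * The Cauchy integral over one side of a square *)

Section square_mean.
Context {R : realType}.
Implicit Types (a b c d x y r : R) (U V A B : R -> R -> R).
Local Notation I a b f := (\int[@lebesgue_measure R]_(x in `[a, b]) f x).

Lemma continuous_at_itv a b (f : R -> R) :
  (forall x, a <= x <= b -> {for x, continuous f}) -> {within `[a, b], continuous f}.
Proof. by move=> cf; apply: continuous_in_subspaceT => x; rewrite inE/= in_itv/=; exact: cf. Qed.

Lemma continuous_quad_inv t : {for t, continuous (fun t : R => (1 + t ^+ 2)^-1)}.
Proof.
have h : 1 + t ^+ 2 != 0 by rewrite gt_eqF// ltr_wpDr// sqr_ge0.
apply: cvgV => //; apply: cvgD; first exact: cvg_cst.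
exact: exprn_continuous.
Qed.

Lemma odd_part_quad (a b : R) :
  I (-1) 1 (fun t => (t * b + a) / (1 + t ^+ 2)) =
  I 0 1 (fun t => 2 * a / (1 + t ^+ 2)).
Proof.
have cf (l u : R) : {within `[l, u], continuous (fun t => (t * b + a) / (1 + t ^+ 2))}.
  apply: continuous_at_itv => x _; apply: cvgM; last exact: continuous_quad_inv.
  by apply: cvgD; [apply: cvgM; [exact: cvg_id|exact: cvg_cst]|exact: cvg_cst].
have cfN (l u : R) : {within `[l, u], continuous (fun t => (- t * b + a) / (1 + (- t) ^+ 2))}.
  apply: continuous_at_itv => x _.
  rewrite (_ : (fun t => _) = (fun t => (t * - b + a) / (1 + t ^+ 2))); last first.
    by apply/funext => t; rewrite sqrrN mulrN mulNr.
  apply: cvgM; last exact: continuous_quad_inv.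
  by apply: cvgD; [apply: cvgM; [exact: cvg_id|exact: cvg_cst]|exact: cvg_cst].
rewrite (@itv_integral_split _ _ 0)//; [|lra..].
have -> : I (-1) 0 (fun t => (t * b + a) / (1 + t ^+ 2)) =
  I 0 1 (fun t => (- t * b + a) / (1 + (- t) ^+ 2)).
  rewrite /Rintegral; congr fine.
  have := @integration_by_substitution_oppr R (fun t => (t * b + a) / (1 + t ^+ 2)) 0 1 ler01.
  by rewrite oppr0 => -> //.
rewrite -itv_integralD//; apply: eq_Rintegral => t _.
by rewrite sqrrN -mulrDl; congr (_ / _); ring.
Qed.

(** The odd part in [t] integrates to 0, and [1 / (1 + t^2) >= 1 / 2] on [[-1, 1]]. *)
Lemma quad_integral_ge (a b : R) : 0 <= a ->
  a <= I (-1) 1 (fun t => (t * b + a) / (1 + t ^+ 2)).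
Proof.
move=> a0; rewrite odd_part_quad.
have {1}<- : I 0 1 (fun=> a) = a by rewrite itv_integral_cst// subr0 mulr1.
apply: le_itv_integral; first exact: within_continuous_cst.
  by apply: continuous_at_itv => x _; apply: cvgM; [exact: cvg_cst|exact: continuous_quad_inv].
move=> x /andP[x0 x1]; rewrite ler_pdivlMr; last by rewrite ltr_wpDr// sqr_ge0.
by rewrite mulrC ler_wpM2r// -[2]/(1 + 1) lerD2l expr_le1.
Qed.

(** On [z = x (1 + i t)] one has [dz / z = dx / x + (t + i) dt / (1 + t^2)], so this
is the coefficient of [dt] in the imaginary part of [(A + i B) dz / z]; that of [dx]
is [B / x]. *)
Definition segment_form A B x t := (t * B x (x * t) + A x (x * t)) / (1 + t ^+ 2).

Section symmetric.
Variables (A B : R -> R -> R) (r : R).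
Hypothesis r0 : 0 < r.
Hypothesis AB : forall x y, `|x| <= r -> `|y| <= r -> complex_derivable A B x y.

Lemma in_sector x t : 0 < x <= r -> -1 <= t <= 1 -> `|x| <= r /\ `|x * t| <= r.
Proof.
move=> /andP[x0 xr] t1; rewrite normrM gtr0_norm//; split => //.
by apply: le_trans xr; rewrite ler_piMr ?(ltW x0)// ler_norml.
Qed.

Lemma continuous_sector_x x t : 0 < x <= r -> -1 <= t <= 1 ->
  {for x, continuous (fun x => A x (x * t))} /\ {for x, continuous (fun x => B x (x * t))}.
Proof.
move=> xr t1; have [h1 h2] := in_sector xr t1.
apply: (@complex_derivable_cvg _ A B id (fun x => x * t) x); first exact: AB.
  exact: cvg_id.
by apply: cvgM; [exact: cvg_id|exact: cvg_cst].
Qed.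

Lemma continuous_sector_t x t : 0 < x <= r -> -1 <= t <= 1 ->
  {for t, continuous (fun t => A x (x * t))} /\ {for t, continuous (fun t => B x (x * t))}.
Proof.
move=> xr t1; have [h1 h2] := in_sector xr t1.
apply: (@complex_derivable_cvg _ A B (fun=> x) (fun t => x * t) t); first exact: AB.
  exact: cvg_cst.
by apply: cvgM; [exact: cvg_cst|exact: cvg_id].
Qed.

Lemma continuous_segment_form x t : 0 < x <= r -> -1 <= t <= 1 ->
  {for t, continuous (segment_form A B x)}.
Proof.
move=> xr t1; have [cA cB] := continuous_sector_t xr t1.
apply: cvgM; last exact: continuous_quad_inv.
by apply: cvgD; [apply: cvgM; [exact: cvg_id|exact: cB]|exact: cA].
Qed.

(** With [A] and [B] replaced by their first-order expansions, the coefficients of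
the form become [b' / x + q + p t] and [(t b' + a') / (1 + t^2) + p x], where
[a' + i b'] is the value at [z = 0] of the affine approximation. *)
Lemma segment_form_local (lo x0 t0 : R) : 0 < lo -> lo <= x0 <= r -> -1 <= t0 <= 1 ->
  exists (p : R) (al be : R -> R), [/\ {within `[lo, r], continuous al},
      {within `[-1, 1], continuous be} &
      forall e, 0 < e -> exists2 del, 0 < del & forall x t,
        lo <= x <= r -> -1 <= t <= 1 ->
        `|x - x0| < del -> `|t - t0| < del ->
        `|B x (x * t) / x - (al x + p * t)| <= e * (`|x - x0| + `|t - t0|) /\
        `|segment_form A B x t - (be t + p * x)| <= e * (`|x - x0| + `|t - t0|)].
Proof.
move=> lo0 /andP[lox0 x0r] t01.
have x00 : 0 < x0 by exact: lt_le_trans lox0.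
have x0r' : 0 < x0 <= r by rewrite x00.
have [h1 h2] := in_sector x0r' t01.
have [p [q h]] := AB h1 h2.
set A0 := A x0 (x0 * t0) in h; set B0 := B x0 (x0 * t0) in h.
pose a' := A0 - p * x0 + q * (x0 * t0); pose b' := B0 - q * x0 - p * (x0 * t0).
exists p, (fun x => b' / x + q), (fun t => (t * b' + a') / (1 + t ^+ 2)); split.
- apply: continuous_at_itv => x /andP[lox _]; apply: cvgD; last exact: cvg_cst.
  apply: cvgM; first exact: cvg_cst.
  by apply: cvgV; [rewrite gt_eqF// (lt_le_trans lo0)|exact: cvg_id].
- apply: continuous_at_itv => x _; apply: cvgM; last exact: continuous_quad_inv.
  by apply: cvgD; [apply: cvgM; [exact: cvg_id|exact: cvg_cst]|exact: cvg_cst].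
(* The factor m is at most 1 and at most x, so errors scaled by m survive division by x. *)
move=> e e0; pose m := lo / (1 + lo).
have m0 : 0 < m by rewrite divr_gt0// addr_gt0.
have m1 : m <= 1 by rewrite ler_pdivrMr ?addr_gt0// mul1r lerDr.
have mlo : m <= lo by rewrite ler_pdivrMr ?addr_gt0// ler_peMr ?(ltW lo0)// lerDl ltW.
have r2 : 0 < 2 + r by rewrite addr_gt0.
have e'0 : 0 < e * m / (2 * (2 + r)) by rewrite divr_gt0// mulr_gt0.
have [d d0 {}h] := h _ e'0.
exists (d / (2 + r)); first by rewrite divr_gt0.
move=> x t /andP[lox xr] t1; rewrite !ltr_pdivlMr// => xd td.
have x_gt0 : 0 < x by exact: lt_le_trans lox.
have nx := normr_ge0 (x - x0); have nt := normr_ge0 (t - t0).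
have xt : `|x * t - x0 * t0| <= r * `|t - t0| + `|x - x0|.
  have -> : x * t - x0 * t0 = x * (t - t0) + (x - x0) * t0 by ring.
  apply: (le_trans (ler_normD _ _)); rewrite lerD// normrM.
    by rewrite ler_wpM2r// gtr0_norm.
  by rewrite ler_piMr// ler_norml.
have [] := h x (x * t).
- apply: le_lt_trans xd; rewrite ler_peMr//; lra.
- apply: le_lt_trans xt _; nra.
set E := `|x - x0| + `|t - t0|.
have hE : `|x - x0| + `|x * t - x0 * t0| <= (2 + r) * E by rewrite /E; nra.
have kE : e * m / (2 * (2 + r)) * (`|x - x0| + `|x * t - x0 * t0|) <= e * m / 2 * E.
  have -> : e * m / 2 * E = e * m / (2 * (2 + r)) * ((2 + r) * E).
    by field; rewrite gt_eqF.
  by rewrite ler_wpM2l// ltW.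
have E0 : 0 <= E by rewrite addr_ge0.
move=> /le_trans/(_ kE); set eA := (X in `|X|) => hA.
move=> /le_trans/(_ kE); set eB := (X in `|X|) => hB.
have q0 : 0 < 1 + t ^+ 2 by rewrite ltr_wpDr// sqr_ge0.
split.
  have -> : B x (x * t) / x - (b' / x + q + p * t) = eB / x.
    by rewrite /eB /b'; field; rewrite gt_eqF.
  rewrite normrM normfV (gtr0_norm x_gt0) ler_pdivrMr//.
  apply: (le_trans hB); have -> : e * m / 2 * E = e * E * (m / 2) by ring.
  by rewrite ler_wpM2l ?mulr_ge0 ?(ltW e0)//; lra.
have -> : segment_form A B x t - ((t * b' + a') / (1 + t ^+ 2) + p * x)
    = (t * eB + eA) / (1 + t ^+ 2).
  by rewrite /segment_form /eA /eB /a' /b'; field; rewrite gt_eqF.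
rewrite normrM normfV (gtr0_norm q0) ler_pdivrMr//.
apply: (le_trans (ler_normD _ _)).
have tB : `|t * eB| <= `|eB| by rewrite normrM ler_piMl// ler_norml.
have emE : e * m * E <= e * E * (1 + t ^+ 2).
  rewrite mulrAC ler_wpM2l ?mulr_ge0 ?(ltW e0)//.
  by apply: (le_trans m1); rewrite lerDl sqr_ge0.
lra.
Qed.

Hypothesis Bsym : forall x, B x x = B x (- x).

(** The sides [t = -1] and [t = 1] of the sector carry the same integral because
[B] is invariant under the quarter turn from [x (1 - i)] to [x (1 + i)]. *)
Lemma segment_form_invariant lo : 0 < lo <= r ->
  I (-1) 1 (segment_form A B lo) = I (-1) 1 (segment_form A B r).
Proof.
move=> /andP[lo0 lor].
have : circulation (fun x t => B x (x * t) / x) (segment_form A B) (lo, r) (-1, 1) = 0.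
  have N11 : -1 <= 1 :> R by lra.
  apply: goursat_rectangle => //=.
  - move=> t t1; apply: continuous_at_itv => x /andP[lox xr].
    have x0 : 0 < x by exact: lt_le_trans lox.
    have [_ cB] : _ /\ _ := @continuous_sector_x x t (introT andP (conj x0 xr)) t1.
    by apply: cvgM; [exact: cB|apply: cvgV; [rewrite gt_eqF|exact: cvg_id]].
  - move=> x /andP[lox xr]; apply: continuous_at_itv => t t1.
    by apply: continuous_segment_form => //; rewrite xr (lt_le_trans lo0).
  by move=> x0 y0; exact: segment_form_local.
rewrite /circulation /=.
have -> : I lo r (fun x => B x (x * -1) / x) = I lo r (fun x => B x (x * 1) / x).
  by apply: eq_Rintegral => x _; rewrite mulrN1 mulr1 Bsym.
by move=> ?; lra.
Qed.

(** As [x] tends to 0 the integrand tends uniformly to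
[(t * B 0 0 + A 0 0) / (1 + t^2)]. *)
Lemma segment_form_center : 0 <= A 0 0 -> A 0 0 <= I (-1) 1 (segment_form A B r).
Proof.
move=> A00; apply/ler_addgt0Pr => e e0.
have e4 : 0 < e / 4 by rewrite divr_gt0.
have r0' : `|0 : R| <= r by rewrite normr0 ltW.
have [d d0 h] := complex_derivable_continuous (AB r0' r0') e4.
pose lo := Num.min r (d / 2).
have lo0 : 0 < lo by rewrite lt_min r0 divr_gt0.
have lor : lo <= r by rewrite ge_min lexx.
have lod : lo < d by rewrite /lo gt_min; apply/orP; right; lra.
have lo_r : 0 < lo <= r by rewrite lo0.
rewrite -(@segment_form_invariant lo)//.
pose g (t : R) := (t * B 0 0 + A 0 0) / (1 + t ^+ 2).
apply: (@le_trans _ _ (I (-1) 1 g)); first exact: quad_integral_ge.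
have cg : {within `[-1, 1], continuous g}.
  apply: continuous_at_itv => x _; apply: cvgM; last exact: continuous_quad_inv.
  by apply: cvgD; [apply: cvgM; [exact: cvg_id|exact: cvg_cst]|exact: cvg_cst].
have cs : {within `[-1, 1], continuous (segment_form A B lo)}.
  by apply: continuous_at_itv => t t1; exact: continuous_segment_form.
have he : I (-1) 1 (fun=> e / 2) = e by rewrite itv_integral_cst; lra.
have c2 : {within `[-1 : R, 1], continuous (fun=> e / 2 : R)}.
  exact: within_continuous_cst.
rewrite -[X in _ + X]he -itv_integralD//.
apply: le_itv_integral => //; first exact: within_continuousD.
move=> t t1; have q0 : 0 < 1 + t ^+ 2 by rewrite ltr_wpDr// sqr_ge0.
have [] := h lo (lo * t).
- by rewrite subr0 gtr0_norm.
- rewrite subr0 normrM (gtr0_norm lo0); apply: le_lt_trans lod.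
  by rewrite ler_piMr ?(ltW lo0)// ler_norml.
move=> hA hB; rewrite -lerBlDl /g /segment_form -mulrBl.
rewrite ler_pdivrMr//.
have {}hB : `|t * (B lo (lo * t) - B 0 0)| < e / 4.
  by rewrite normrM; apply: le_lt_trans hB; rewrite ler_piMl// ler_norml.
have : e / 2 <= e / 2 * (1 + t ^+ 2).
  by rewrite ler_peMr ?divr_ge0 ?(ltW e0)// lerDl sqr_ge0.
move: hA hB; rewrite !ltr_norml => /andP[? ?] /andP[? ?] ?; lra.
Qed.

Lemma symmetric_segment_mean :
  A 0 0 <= I (-1) 1 (fun t => `|A r (r * t)| + `|B r (r * t)|).
Proof.
have rr : 0 < r <= r by rewrite r0 lexx.
have cn : {within `[-1, 1], continuous (fun t => `|A r (r * t)| + `|B r (r * t)|)}.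
  apply: continuous_at_itv => t t1; have [cA cB] := continuous_sector_t rr t1.
  by apply: cvgD; apply: cvg_norm.
have [A0|A0] := lerP 0 (A 0 0); last first.
  by rewrite (le_trans (ltW A0))// Rintegral_ge0// => t _; rewrite addr_ge0.
apply: (le_trans (segment_form_center A0)).
apply: le_itv_integral => //.
  by apply: continuous_at_itv => t t1; exact: continuous_segment_form.
move=> t t1; have q0 : 0 < 1 + t ^+ 2 by rewrite ltr_wpDr// sqr_ge0.
rewrite /segment_form ler_pdivrMr//.
have h0 : 0 <= `|A r (r * t)| + `|B r (r * t)| by rewrite addr_ge0.
apply: (@le_trans _ _ (`|A r (r * t)| + `|B r (r * t)|)); last first.
  by rewrite ler_peMr// lerDl sqr_ge0.
rewrite addrC lerD ?ler_norm//; apply: (le_trans (ler_norm _)).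
by rewrite normrM ler_piMl// ler_norml.
Qed.

End symmetric.
End square_mean.

(** * From the side of a square to its area *)

Section tonelli_rectangle.
Local Open Scope ereal_scope.
Context d1 d2 (T1 : measurableType d1) (T2 : measurableType d2) (R : realType).
Variables (m1 : {sigma_finite_measure set T1 -> \bar R})
          (m2 : {sigma_finite_measure set T2 -> \bar R}).
Variables (X : set T1) (Y : set T2) (f : T1 * T2 -> \bar R).
Hypotheses (mX : measurable X) (mY : measurable Y).
Hypothesis mf : measurable_fun (X `*` Y) f.
Hypothesis f0 : forall z, (X `*` Y) z -> 0 <= f z.

Let g := f \_ (X `*` Y).

Let mg : measurable_fun setT g.
Proof. by apply/(measurable_restrictT _ _).1 => //; exact: measurableX. Qed.

Let g0 z : 0 <= g z.
Proof. exact: erestrict_ge0. Qed.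

Let g1 x : \int[m2]_y g (x, y) = ((fun x => \int[m2]_(y in Y) f (x, y)) \_ X) x.
Proof.
rewrite patchE; case: ifPn => xX; last first.
  rewrite integral0_eq// => y _; rewrite /g patchE ifF//.
  by apply/negbTE; apply: contra xX; rewrite !inE => -[].
rewrite [RHS]integral_mkcond; apply: eq_integral => y _.
by rewrite /g !patchE in_setX xX.
Qed.

Let g2 y : \int[m1]_x g (x, y) = ((fun y => \int[m1]_(x in X) f (x, y)) \_ Y) y.
Proof.
rewrite patchE; case: ifPn => yY; last first.
  rewrite integral0_eq// => x _; rewrite /g patchE ifF//.
  by apply/negbTE; apply: contra yY; rewrite !inE => -[].
rewrite [RHS]integral_mkcond; apply: eq_integral => x _.
by rewrite /g !patchE in_setX yY andbT.
Qed.

(** Extending [f] by 0 outside [X `*` Y] reduces to Tonelli on the whole product. *)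
Lemma tonelli_setX1 : \int[m1 \x m2]_(z in X `*` Y) f z =
  \int[m1]_(x in X) \int[m2]_(y in Y) f (x, y).
Proof.
have -> : \int[m1 \x m2]_(z in X `*` Y) f z = \int[m1 \x m2]_z g z.
  exact: integral_mkcond.
rewrite (fubini_tonelli1 g mg g0) [RHS]integral_mkcond.
by apply: eq_integral => x _; rewrite /fubini_F g1.
Qed.

Lemma tonelli_setX2 : \int[m1 \x m2]_(z in X `*` Y) f z =
  \int[m2]_(y in Y) \int[m1]_(x in X) f (x, y).
Proof.
have -> : \int[m1 \x m2]_(z in X `*` Y) f z = \int[m1 \x m2]_z g z.
  exact: integral_mkcond.
rewrite (fubini_tonelli2 g mg g0) [RHS]integral_mkcond.
by apply: eq_integral => y _; rewrite /fubini_G g2.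
Qed.

Lemma measurable_section_integral : 
  measurable_fun X (fun x => \int[m2]_(y in Y) f (x, y)).
Proof.
have := measurable_fun_fubini_tonelli_F (m2 := m2) g mg g0.
rewrite /fubini_F; under eq_fun do rewrite g1.
by move=> /(measurable_restrictT _ mX).2.
Qed.

End tonelli_rectangle.

Section square_mean_area.
Context {R : realType}.
Implicit Types (a b c d x y r : R) (U V A B : R -> R -> R).
Local Notation leb := (@lebesgue_measure R).
Local Notation I a b f := (\int[leb]_(x in `[a, b]) f x).

Definition square (x y r : R) : set (measurableTypeR R * measurableTypeR R) :=
  `[x - r, x + r] `*` `[y - r, y + r].

Lemma measurable_square x y r : measurable (square x y r).
Proof. exact: measurableX. Qed.

Lemma in_square0 r z : square 0 0 r z -> `|z.1| <= r /\ `|z.2| <= r.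
Proof.
rewrite /square !add0r => -[/=]; rewrite !in_itv/= => h1 h2.
by rewrite !ler_norml.
Qed.

Lemma itv_integral_EFin a b (f : R -> R) : {within `[a, b], continuous f} ->
  (I a b f)%:E = (\int[leb]_(x in `[a, b]) (f x)%:E)%E.
Proof.
move=> cf; rewrite /Rintegral fineK//; apply: integrable_fin_num => //.
exact: continuous_itv_integrable.
Qed.

Lemma integral_itv_scale a b k (f : R -> R) : 0 < k -> a <= b ->
  {within `[k * a, k * b], continuous f} ->
  (\int[leb]_(x in `[(k * a)%R, (k * b)%R]) (f x)%:E =
   \int[leb]_(x in `[a, b]) (f (k * x) * k)%:E)%E.
Proof.
move=> k0 ab cf.
have dk x : is_derive x 1 (fun x : R => k * x) k.
  by apply: is_derive_eq; rewrite /GRing.scale/= mulr1.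
have Dk : derive1 (fun x : R => k * x) = cst k.
  by apply/funext => x; rewrite derive1E; exact: derive_val.
rewrite (@integration_by_substitution_increasing _ (fun x => k * x))//.
- by apply: eq_integral => x _; rewrite Dk.
- by move=> x y _ _; rewrite ltr_pM2l.
- by rewrite Dk => x _; exact: cvg_cst.
- by rewrite Dk; apply: is_cvg_cst.
- by rewrite Dk; apply: is_cvg_cst.
- split.
  + by move=> x _; case: (dk x).
  + by apply: cvg_at_right_filter; apply: cvgM; [exact: cvg_cst|exact: cvg_id].
  + by apply: cvg_at_left_filter; apply: cvgM; [exact: cvg_cst|exact: cvg_id].
Qed.

Lemma integral_itv_shift a b k (f : R -> R) : a <= b ->
  {within `[a + k, b + k], continuous f} ->
  (\int[leb]_(x in `[(a + k)%R, (b + k)%R]) (f x)%:E =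
   \int[leb]_(x in `[a, b]) (f (x + k))%:E)%E.
Proof.
move=> ab cf.
have dk x : is_derive x 1 (fun x : R => x + k) 1.
  by apply: is_derive_eq; rewrite addr0.
have Dk : derive1 (fun x : R => x + k) = cst 1.
  by apply/funext => x; rewrite derive1E; exact: derive_val.
rewrite (@integration_by_substitution_increasing _ (fun x => x + k))//.
- by apply: eq_integral => x _; rewrite Dk/= mulr1.
- by move=> x y _ _; rewrite ltrD2r.
- by rewrite Dk => x _; exact: cvg_cst.
- by rewrite Dk; apply: is_cvg_cst.
- by rewrite Dk; apply: is_cvg_cst.
- split.
  + by move=> x _; case: (dk x).
  + by apply: cvg_at_right_filter; apply: cvgD; [exact: cvg_id|exact: cvg_cst].
  + by apply: cvg_at_left_filter; apply: cvgD; [exact: cvg_id|exact: cvg_cst].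
Qed.

(** The substitution [y = s t] turns the integral over the segment of abscissa [s]
of the sector into one over a vertical line. *)
Lemma symmetric_line_mean A B r (s : R) : 0 < s <= r ->
  (forall x y, `|x| <= r -> `|y| <= r -> complex_derivable A B x y) ->
  (forall x, B x x = B x (- x)) ->
  ((A 0 0 * s)%:E <=
   \int[leb]_(y in `[(- r)%R, r]) (`|A s y| + `|B s y|)%:E)%E.
Proof.
move=> /andP[s0 sr] AB Bsym.
have AB' x y : `|x| <= s -> `|y| <= s -> complex_derivable A B x y.
  by move=> xs ys; apply: AB; exact: le_trans sr.
have ch x : `|x| <= r -> {for x, continuous (fun y => `|A s y| + `|B s y|)}.
  move=> xr; have [cA cB] : {for x, continuous (A s)} /\ {for x, continuous (B s)}.
    apply: (@complex_derivable_cvg _ A B (fun=> s) id x).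
    - by apply: AB => //; rewrite gtr0_norm.
    - exact: cvg_cst.
    - exact: cvg_id.
  by apply: cvgD; apply: cvg_norm.
pose f := fun y => `|A s y| + `|B s y|.
have cf : {within `[- s, s], continuous f}.
  apply: continuous_at_itv => x xs; apply: ch; apply: le_trans sr.
  by rewrite ler_norml.
have cfs : {within `[-1, 1], continuous (fun t => f (s * t))}.
  apply: continuous_at_itv => t t1.
  apply: (@continuous_comp _ _ _ (fun t => s * t) f).
    by apply: cvgM; [exact: cvg_cst|exact: cvg_id].
  apply: ch; apply: le_trans sr; rewrite normrM (gtr0_norm s0).
  by rewrite ler_piMr ?(ltW s0)// ler_norml.
apply: (@le_trans _ _ (\int[leb]_(y in `[(- s)%R, s]) (f y)%:E)%E); last first.
  apply: ge0_subset_integral => //.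
  - apply/measurable_EFinP; apply: subspace_continuous_measurable_fun => //.
    by apply: continuous_at_itv => x xr; apply: ch; rewrite ler_norml.
  - by move=> x _; rewrite lee_fin addr_ge0.
  - by move=> x /=; rewrite !in_itv/= => /andP[? ?]; apply/andP; split; lra.
have N11 : -1 <= 1 :> R by lra.
have := @integral_itv_scale (-1) 1 s f s0 N11; rewrite (mulrN1 s) (mulr1 s) => -> //.
rewrite -itv_integral_EFin; last first.
  by move=> x; apply: cvgM; [exact: cfs|exact: cvg_cst].
rewrite RintegralZr//; last exact: continuous_itv_integrable.
by rewrite lee_fin ler_wpM2r ?(ltW s0)//; exact: symmetric_segment_mean Bsym.
Qed.

Lemma symmetric_square_mean A B r : 0 < r ->
  (forall x y, `|x| <= r -> `|y| <= r -> complex_derivable A B x y) ->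
  (forall x, B x x = B x (- x)) ->
  measurable_fun (square 0 0 r) (fun z => `|A z.1 z.2| + `|B z.1 z.2|) ->
  ((A 0 0 * r ^+ 2 / 4)%:E <=
   \int[leb \x leb]_(z in square 0 0 r) (`|A z.1 z.2| + `|B z.1 z.2|)%:E)%E.
Proof.
move=> r0 AB Bsym mAB.
set h := fun z : R * R => (`|A z.1 z.2| + `|B z.1 z.2|)%:E.
have h0 z : (0 <= h z)%E by rewrite lee_fin addr_ge0.
have mh : measurable_fun (square 0 0 r) h by exact/measurable_EFinP.
have [A0|A0] := lerP 0 (A 0 0); last first.
  apply: (@le_trans _ _ 0%E); last by apply: integral_ge0 => z _; exact: h0.
  by rewrite lee_fin -mulrA mulr_le0_ge0 ?(ltW A0)// divr_ge0// sqr_ge0.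
rewrite tonelli_setX1//.
rewrite !(add0r, sub0r).
(* Only the lines of abscissa at least r / 2 are used. *)
apply: (@le_trans _ _ (\int[leb]_(x in `[(r / 2)%R, r])
    \int[leb]_(y in `[(- r)%R, r]) h (x, y))%E); last first.
  apply: ge0_subset_integral => //.
  - apply: measurable_section_integral => //.
    by rewrite /square !(add0r, sub0r) in mh.
  - by move=> x _; apply: integral_ge0 => y _.
  - by move=> x /=; rewrite !in_itv/= => /andP[? ?]; apply/andP; split; lra.
apply: (@le_trans _ _ (\int[leb]_(x in `[(r / 2)%R, r]) (A 0 0 * (r / 2))%:E)%E).
  rewrite integral_cst//= lebesgue_measure_itv/= lte_fin.
  have -> : r / 2 < r by lra.
  rewrite -EFinB -EFinM lee_fin; lra.
apply: ge0_le_integral => //.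
- by move=> x _; rewrite lee_fin mulr_ge0// divr_ge0// ltW.
- apply: (@measurable_funS _ _ _ _ `[- r, r]) => //.
    by move=> x /=; rewrite !in_itv/= => /andP[? ?]; apply/andP; split; lra.
  apply: measurable_section_integral => //.
  by rewrite /square !(add0r, sub0r) in mh.
move=> x /=; rewrite in_itv/= => /andP[rx xr].
apply: le_trans (@symmetric_line_mean A B r x _ AB Bsym); last by apply/andP; split; lra.
by rewrite lee_fin ler_wpM2l.
Qed.

Lemma measurable_square_rotation (g : R -> R -> R) r :
  measurable_fun (square 0 0 r) (fun z => g z.1 z.2) ->
  measurable_fun (square 0 0 r) (fun z => g (- z.2) z.1).
Proof.
move=> mg; pose T := (measurableTypeR R * measurableTypeR R)%type.
pose quarter_turn (z : T) : T := (- z.2, z.1).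
apply: (@measurable_comp _ _ _ _ _ _ (square 0 0 r) (fun z : T => g z.1 z.2) _ quarter_turn) => //.
- exact: measurable_square.
- move=> _ [z /in_square0[]+ + <-]; rewrite /square !(add0r, sub0r) !ler_norml.
  by move=> /andP[? ?] /andP[? ?]; split; rewrite /= in_itv/=; apply/andP; split; lra.
- apply: measurable_funS (measurableT) _ _ => //.
  apply/measurable_fun_pair => //=.
  exact: (measurableT_comp (@oppr_measurable R setT)).
Qed.

(** Tonelli in one order on the left and in the other order on the right leaves a
reflection on the line. Only reflections of functions continuous on a segment are
needed, whence the hypothesis on sections. *)
Lemma square_rotation (g : R -> R -> R) r : 0 < r ->
  (forall x y, 0 <= g x y) ->
  (forall y, `|y| <= r -> {within `[- r, r], continuous (g^~ y)}) ->
  measurable_fun (square 0 0 r) (fun z => g z.1 z.2) ->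
  (\int[leb \x leb]_(z in square 0 0 r) (g (- z.2) z.1)%:E =
   \int[leb \x leb]_(z in square 0 0 r) (g z.1 z.2)%:E)%E.
Proof.
move=> r0 g0 cg mg; have mg' := measurable_square_rotation mg.
have mgE := (measurable_EFinP _ _).2 mg; have mgE' := (measurable_EFinP _ _).2 mg'.
have mI : measurable (`[0 - r, 0 + r] : set (measurableTypeR R)) by exact: measurable_itv.
rewrite (tonelli_setX1 _ _ mI mI mgE'); last by move=> z _; rewrite lee_fin.
rewrite (tonelli_setX2 _ _ mI mI mgE); last by move=> z _; rewrite lee_fin.
rewrite /= !(add0r, sub0r); apply: eq_integral => x; rewrite inE/= in_itv/= => xr.
have := @integration_by_substitution_oppr R (g^~ x) (- r) r.
rewrite opprK => <- //; first lra.
by apply: cg; rewrite ler_norml.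
Qed.

Lemma complex_derivable_slice U V x y : complex_derivable U V x y ->
  {for x, continuous (fun x => `|U x y| + `|V x y|)} /\
  {for y, continuous (fun y => `|U x y| + `|V x y|)}.
Proof.
move=> UV.
have [c1 c2] : {for x, continuous (U^~ y)} /\ {for x, continuous (V^~ y)}.
  by apply: (@complex_derivable_cvg _ U V id (fun=> y) x) => //; exact: cvg_cst.
have [c3 c4] : {for y, continuous (U x)} /\ {for y, continuous (V x)}.
  by apply: (@complex_derivable_cvg _ U V (fun=> x) id y) => //; exact: cvg_cst.
by split; apply: cvgD; apply: cvg_norm.
Qed.

Definition quarter_turn U : R -> R -> R := fun x y => U (- y) x.

(** All that one quarter turn has to preserve, so that it can be iterated. *)
Lemma square_quarter_turn U V r : 0 < r ->
  (forall x y, `|x| <= r -> `|y| <= r -> complex_derivable U V x y) ->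
  measurable_fun (square 0 0 r) (fun z => U z.1 z.2) ->
  measurable_fun (square 0 0 r) (fun z => V z.1 z.2) ->
  [/\ forall x y, `|x| <= r -> `|y| <= r -> complex_derivable (quarter_turn U) (quarter_turn V) x y,
    measurable_fun (square 0 0 r) (fun z => quarter_turn U z.1 z.2),
    measurable_fun (square 0 0 r) (fun z => quarter_turn V z.1 z.2) &
    (\int[leb \x leb]_(z in square 0 0 r)
      (`|quarter_turn U z.1 z.2| + `|quarter_turn V z.1 z.2|)%:E =
     \int[leb \x leb]_(z in square 0 0 r) (`|U z.1 z.2| + `|V z.1 z.2|)%:E)%E].
Proof.
move=> r0 UV mU mV; split.
- by move=> x y xr yr; apply: complex_derivable_rot; apply: UV; rewrite ?normrN.
- exact: measurable_square_rotation.
- exact: measurable_square_rotation.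
apply: (@square_rotation (fun x y => `|U x y| + `|V x y|) r r0) => //.
- move=> y yr; apply: continuous_at_itv => x xr.
  by have [] := @complex_derivable_slice U V x y; first by apply: UV; rewrite // ler_norml.
- by apply: measurable_funD; exact: (measurableT_comp (@normr_measurable R setT)).
Qed.

(** Apply the symmetric case to the sum of the four rotated functions; each of the
four has the same integral over the square. *)
Lemma square_mean0 U V r : 0 < r ->
  (forall x y, `|x| <= r -> `|y| <= r -> complex_derivable U V x y) ->
  measurable_fun (square 0 0 r) (fun z => U z.1 z.2) ->
  measurable_fun (square 0 0 r) (fun z => V z.1 z.2) ->
  ((U 0 0 * r ^+ 2)%:E <=
   4%:E * \int[leb \x leb]_(z in square 0 0 r) (`|U z.1 z.2| + `|V z.1 z.2|)%:E)%E.
Proof.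
move=> r0 UV mU mV.
have [UV1 mU1 mV1 e1] := square_quarter_turn r0 UV mU mV.
have [UV2 mU2 mV2 e2] := square_quarter_turn r0 UV1 mU1 mV1.
have [UV3 mU3 mV3 e3] := square_quarter_turn r0 UV2 mU2 mV2.
pose sym W x y : R := W x y + quarter_turn W x y + quarter_turn
  (quarter_turn W) x y + quarter_turn (quarter_turn (quarter_turn W)) x y.
have symd x y : `|x| <= r -> `|y| <= r -> complex_derivable (sym U) (sym V) x y.
  move=> xr yr; apply: complex_derivableD; last exact: UV3.
  by apply: complex_derivableD; [apply: complex_derivableD; [exact: UV|exact: UV1]|exact: UV2].
have symsym x : sym V x x = sym V x (- x).
  by rewrite /sym /quarter_turn !opprK; ring.
have msym W : measurable_fun (square 0 0 r) (fun z => W z.1 z.2) ->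
    measurable_fun (square 0 0 r) (fun z => quarter_turn W z.1 z.2) ->
    measurable_fun (square 0 0 r) (fun z => quarter_turn (quarter_turn W) z.1 z.2) ->
    measurable_fun (square 0 0 r) (fun z => quarter_turn (quarter_turn (quarter_turn W)) z.1 z.2) ->
    measurable_fun (square 0 0 r) (fun z => sym W z.1 z.2).
  by move=> m1 m2 m3 m4; do !apply: measurable_funD.
have mh A B : measurable_fun (square 0 0 r) (fun z => A z.1 z.2) ->
    measurable_fun (square 0 0 r) (fun z => B z.1 z.2) ->
    measurable_fun (square 0 0 r) (fun z => (`|A z.1 z.2| + `|B z.1 z.2| : R)).
  by move=> mA mB; apply: measurable_funD; exact: (measurableT_comp (@normr_measurable R setT)).
have mh' A B : measurable_fun (square 0 0 r) (fun z => A z.1 z.2) ->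
    measurable_fun (square 0 0 r) (fun z => B z.1 z.2) ->
    measurable_fun (square 0 0 r) (fun z => (`|A z.1 z.2| + `|B z.1 z.2| : R)%:E).
  by move=> mA mB; apply/measurable_EFinP; exact: mh.
have msU := msym _ mU mU1 mU2 mU3; have msV := msym _ mV mV1 mV2 mV3.
have := symmetric_square_mean r0 symd symsym (mh _ _ msU msV).
have -> : sym U 0 0 * r ^+ 2 / 4 = U 0 0 * r ^+ 2.
  by rewrite /sym /quarter_turn !oppr0; lra.
move=> /le_trans; apply.
have mS : measurable (square 0 0 r) by exact: measurable_square.
set J := (X in (_ <= _ * X)%E) in e1 *.
rewrite -[leRHS]/(4%:E * J)%E.
have -> : (4%:E * J = J + J + J + J)%E.
  have J0 : (0 <= J)%E by apply: integral_ge0 => z _; rewrite lee_fin addr_ge0.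
  rewrite (_ : 4 = 1 + 1 + 1 + 1 :> R); last ring.
  by rewrite !EFinD !ge0_muleDl ?lee_fin ?addr_ge0// !mul1e.
have h0 A B (z : R * R) : (0 <= (`|A z.1 z.2| + `|B z.1 z.2| : R)%:E)%E.
  by rewrite lee_fin addr_ge0.
rewrite -[X in (_ <= X + _ + _ + _)%E]/J -[X in (_ <= _ + X + _ + _)%E]e1.
rewrite -[X in (_ <= _ + _ + X + _)%E]e1 -[X in (_ <= _ + _ + X + _)%E]e2.
rewrite -[X in (_ <= _ + _ + _ + X)%E]e1 -[X in (_ <= _ + _ + _ + X)%E]e2 -[X in
  (_ <= _ + _ + _ + X)%E]e3.
rewrite /J -!ge0_integralD//; do ?[by move=> z _; rewrite ?adde_ge0|
  by do ?apply: emeasurable_funD; exact: mh'].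
apply: ge0_le_integral => //; first exact: mh'.
  by do ?apply: emeasurable_funD; exact: mh'.
move=> z _; rewrite -!EFinD lee_fin.
have tri W : `|sym W z.1 z.2| <= `|W z.1 z.2| + `|quarter_turn W z.1 z.2| +
    `|quarter_turn (quarter_turn W) z.1 z.2| + `|quarter_turn (quarter_turn
      (quarter_turn W)) z.1 z.2|.
  by rewrite /sym; do ?(apply: (le_trans (ler_normD _ _)); rewrite lerD2r).
have := tri U; have := tri V; lra.
Qed.

End square_mean_area.

(** * The mean inequality over a square *)

Section square_mean_area.
Context {R : realType}.
Implicit Types (a b c d x y r : R) (U V A B : R -> R -> R).
Local Notation leb := (@lebesgue_measure R).

Lemma complex_derivable_shift U V x0 y0 x y :
  complex_derivable U V (x + x0) (y + y0) ->
  complex_derivable (fun x y => U (x + x0) (y + y0)) (fun x y => V (x + x0) (y + y0)) x y.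
Proof.
move=> [p [q h]]; exists p, q => e e0; have [d d0 {}h] := h _ e0.
exists d => // x' y' xd yd.
have sh (a b c : R) : a + c - (b + c) = a - b by ring.
by have := h (x' + x0) (y' + y0); rewrite !sh; apply.
Qed.

Lemma measurable_rectangle_shift x0 y0 r (g : R -> R -> R) (a b a' b' s t : R) :
  a + s = x0 - r -> b + s = x0 + r -> a' + t = y0 - r -> b' + t = y0 + r ->
  measurable_fun (square x0 y0 r) (fun z => g z.1 z.2) ->
  measurable_fun (`[a, b] `*` `[a', b'] : set (measurableTypeR R * measurableTypeR R))
    (fun z => g (z.1 + s) (z.2 + t)).
Proof.
move=> e1 e2 e3 e4 mg; pose T := (measurableTypeR R * measurableTypeR R)%type.
pose sh (z : T) : T := (z.1 + s, z.2 + t).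
apply: (@measurable_comp _ _ _ _ _ _ (square x0 y0 r) (fun z : T => g z.1 z.2) _ sh) => //.
- exact: measurable_square.
- move=> _ [z [/= + +] <-]; rewrite /square !in_itv/=.
  by move=> /andP[? ?] /andP[? ?]; split; rewrite /= in_itv/=; apply/andP; split; lra.
- apply: measurable_funS (measurableT) _ _ => //.
  by apply/measurable_fun_pair => /=; apply: measurable_funD.
Qed.

Lemma measurable_square_shift x0 y0 r (g : R -> R -> R) :
  measurable_fun (square x0 y0 r) (fun z => g z.1 z.2) ->
  measurable_fun (square 0 0 r) (fun z => g (z.1 + x0) (z.2 + y0)).
Proof. by apply: measurable_rectangle_shift; ring. Qed.

(** Translation one variable at a time, through Tonelli, since the substitution
rule on the line asks for continuous sections. *)
Lemma square_shift x0 y0 r (g : R -> R -> R) : 0 < r ->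
  (forall x y, 0 <= g x y) ->
  (forall x y, `|x - x0| <= r -> `|y - y0| <= r ->
     {for x, continuous (g^~ y)} /\ {for y, continuous (g x)}) ->
  measurable_fun (square x0 y0 r) (fun z => g z.1 z.2) ->
  (\int[leb \x leb]_(z in square 0 0 r) (g (z.1 + x0) (z.2 + y0))%:E =
   \int[leb \x leb]_(z in square x0 y0 r) (g z.1 z.2)%:E)%E.
Proof.
move=> r0 g0 cg mg; pose T := (measurableTypeR R * measurableTypeR R)%type.
have rr : - r <= r by lra.
rewrite tonelli_setX1//; first last.
- by move=> z _; rewrite lee_fin.
- by apply/measurable_EFinP; exact: (measurable_square_shift mg).
transitivity (\int[leb]_(x in `[(- r)%R, r]) \int[leb]_(y in `[(y0
  - r)%R, (y0 + r)%R]) (g (x + x0) y)%:E)%E.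
  rewrite !(add0r, sub0r); apply: eq_integral => x; rewrite inE/= in_itv/= => xr.
  rewrite -(integral_itv_shift _ (f := g (x + x0)))//.
    by rewrite (addrC (- r)) (addrC r).
  apply: continuous_at_itv => y yr.
  have [] := cg (x + x0) y => //; rewrite ler_norml; move: xr yr => /andP[? ?] /andP[? ?];
    apply/andP; split; lra.
have mg2 : measurable_fun (`[(- r)%R, r] `*` `[(y0 - r)%R, (y0 + r)%R] : set T) (fun z : T =>
  g (z.1 + x0) z.2).
  rewrite (_ : (fun z => _) = fun z : T => g (z.1 + x0) (z.2 + 0)); last first.
    by apply/funext => z; rewrite addr0.
  by apply: measurable_rectangle_shift mg; ring.
rewrite -(@tonelli_setX1 _ _ _ _ _ leb leb _ _ (fun z => (g (z.1 + x0) z.2)%:E))//; first last.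
- by move=> z _; rewrite lee_fin.
- exact/measurable_EFinP.
rewrite tonelli_setX2//; first last.
- by move=> z _; rewrite lee_fin.
- exact/measurable_EFinP.
have mX : measurable (`[x0 - r, x0 + r] : set (measurableTypeR R)) by exact: measurable_itv.
have mY : measurable (`[y0 - r, y0 + r] : set (measurableTypeR R)) by exact: measurable_itv.
rewrite (tonelli_setX2 leb leb mX mY ((measurable_EFinP _ _).2 mg)); last first.
  by move=> z _; rewrite lee_fin.
apply: eq_integral => y; rewrite inE/= in_itv/= => yr.
rewrite -(integral_itv_shift _ (f := g^~ y))//.
  by rewrite (addrC (- r)) (addrC r).
apply: continuous_at_itv => x xr.
have [] := cg x y => //; rewrite ler_norml; move: xr yr => /andP[? ?] /andP[? ?]; apply/andP;
  split; lra.
Qed.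

(** Bounds for [U], [- U], [V] and [- V] at the centre come from the same lemma
applied to [f], [- f], [- i f] and [i f]. *)
Lemma square_mean U V x0 y0 r : 0 < r ->
  (forall x y, `|x - x0| <= r -> `|y - y0| <= r -> complex_derivable U V x y) ->
  measurable_fun (square x0 y0 r) (fun z => U z.1 z.2) ->
  measurable_fun (square x0 y0 r) (fun z => V z.1 z.2) ->
  (((`|U x0 y0| + `|V x0 y0|) * r ^+ 2)%:E <=
   8%:E * \int[leb \x leb]_(z in square x0 y0 r) (`|U z.1 z.2| + `|V z.1 z.2|)%:E)%E.
Proof.
move=> r0 UV mU mV.
have shift_in x y : `|x| <= r -> `|y| <= r ->
    `|x + x0 - x0| <= r /\ `|y + y0 - y0| <= r by rewrite !addrK.
pose U' x y := U (x + x0) (y + y0); pose V' x y := V (x + x0) (y + y0).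
have UV' x y : `|x| <= r -> `|y| <= r -> complex_derivable U' V' x y.
  by move=> xr yr; apply: complex_derivable_shift; have [] := shift_in x y xr yr; exact: UV.
have mU' := measurable_square_shift mU; have mV' := measurable_square_shift mV.
have e : (\int[leb \x leb]_(z in square 0 0 r) (`|U' z.1 z.2| + `|V' z.1 z.2|)%:E =
   \int[leb \x leb]_(z in square x0 y0 r) (`|U z.1 z.2| + `|V z.1 z.2|)%:E)%E.
  apply: (@square_shift x0 y0 r (fun x y => `|U x y| + `|V x y|)) => //.
    by move=> x y xr yr; apply: complex_derivable_slice; exact: UV.
  by apply: measurable_funD; exact: (measurableT_comp (@normr_measurable R setT)).
have := square_mean0 r0 UV' mU' mV'; rewrite e => hU.
have UVn' x y : `|x| <= r -> `|y| <= r ->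
    complex_derivable (fun x y => - U' x y) (fun x y => - V' x y) x y.
  by move=> xr yr; do 2!apply: complex_derivableMi; exact: UV'.
have := square_mean0 r0 UVn' (measurableT_comp (@oppr_measurable R setT) mU')
  (measurableT_comp (@oppr_measurable R setT) mV').
under eq_integral do rewrite !normrN; rewrite e => hUn.
have UVi' x y : `|x| <= r -> `|y| <= r ->
    complex_derivable V' (fun x y => - U' x y) x y.
  by move=> xr yr; apply: complex_derivableMi; exact: UV'.
have := square_mean0 r0 UVi' mV' (measurableT_comp (@oppr_measurable R setT) mU').
under eq_integral do rewrite normrN addrC; rewrite e => hV.
have UVin' x y : `|x| <= r -> `|y| <= r ->
    complex_derivable (fun x y => - V' x y) U' x y.
  move=> xr yr; have := complex_derivableMi (UVn' _ _ xr yr).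
  have -> // : (fun x y => - - U' x y) = U'.
  by apply/funext => a; apply/funext => b; rewrite opprK.
have := square_mean0 r0 UVin' (measurableT_comp (@oppr_measurable R setT) mV') mU'.
under eq_integral do rewrite normrN addrC; rewrite e => hVn.
move: hU hUn hV hVn; rewrite /U' /V' !add0r.
set J := (\int[_]_(_ in _) _)%E.
have J0 : (0 <= J)%E by apply: integral_ge0 => z _; rewrite lee_fin addr_ge0.
have -> : (8%:E * J = 4%:E * J + 4%:E * J)%E.
  by rewrite -ge0_muleDl ?lee_fin// -EFinD; congr (_%:E * _)%E; ring.
move=> hU hUn hV hVn; rewrite mulrDl EFinD; apply: leeD.
  by have [_|_] := ger0P (U x0 y0).
by have [_|_] := ger0P (V x0 y0).
Qed.

End square_mean_area.

(** * Slices of holomorphic functions *)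

Section complex_slices.
Context {R : realType}.
Local Notation C := (complex_field R).
Local Notation T := (measurableTypeR R * measurableTypeR R)%type.
Local Open Scope complex_scope.
Local Notation re := complex.Re.
Local Notation im := complex.Im.

Lemma normC_normc (z : C) : `|z| = (normc z)%:C :> R[i].
Proof. by case: z => a b; rewrite normc_def. Qed.

Lemma lt_realC (a b : R) : ((a%:C : C) < (b%:C : C)) = (a < b).
Proof. by rewrite ltcR. Qed.

Lemma normc_ge0 (z : C) : 0 <= normc z.
Proof. by case: z => a b /=; exact: sqrtr_ge0. Qed.

Lemma Re_le_normc (z : C) : `|re z| <= normc z.
Proof. by case: z => a b /=; rewrite -sqrtr_sqr ler_wsqrtr// lerDl sqr_ge0. Qed.

Lemma Im_le_normc (z : C) : `|im z| <= normc z.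
Proof. by case: z => a b /=; rewrite -sqrtr_sqr ler_wsqrtr// lerDr sqr_ge0. Qed.

Lemma normc_le_ReIm (z : C) : normc z <= `|re z| + `|im z|.
Proof.
case: z => a b /=.
rewrite -[leRHS]ger0_norm ?addr_ge0// -sqrtr_sqr ler_wsqrtr//.
by rewrite sqrrD !real_normK ?num_real// lerD2r lerDl mulrn_wge0// mulr_ge0.
Qed.

Variable N : nat.
Local Notation CN := 'rV[C]_N.

(** Points of [C^N] given by lists: a coordinate is then singled out by writing the
list as [p ++ x :: q], without casts between tuple types. *)
Definition vec (s : seq T) : CN := \row_i ((nth (0, 0) s i).1 +i* (nth (0, 0) s i).2).

Lemma to_CN_vec (t : N.-tuple T) : @to_CN R N t = vec t.
Proof. by apply/rowP => i; rewrite !mxE (tnth_nth (0, 0)). Qed.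

Lemma vec_slice p q (x y x0 y0 : R) (i : 'I_N) : i = size p :> nat ->
  vec (p ++ (x, y) :: q) =
  ((x - x0) +i* (y - y0) : C) *: delta_mx 0 i + vec (p ++ (x0, y0) :: q).
Proof.
move=> ip; apply/rowP => j; rewrite !mxE !nth_cat eqxx/=.
case: (eqVneq j i) => [->|ji].
  by rewrite ip ltnn subnn/= mulr1; apply/eqP; rewrite eq_complex/= !subrK !eqxx.
rewrite mulr0 add0r; case: ltnP => // pj.
have : (j - size p)%N != 0%N by rewrite subn_eq0 -ltnNge ltn_neqAle pj -ip andbT eq_sym.
by case: (j - size p)%N.
Qed.

(** The derivative of the slice is the directional derivative along a basis vector. *)
Lemma holomorphic_slice (f : CN -> C) p q (x y : R) :
  (size p < N)%N -> differentiable f (vec (p ++ (x, y) :: q)) ->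
  complex_derivable (fun x y => re (f (vec (p ++ (x, y) :: q))))
                    (fun x y => im (f (vec (p ++ (x, y) :: q)))) x y.
Proof.
move=> pN; set z0 := vec _ => df.
pose i : 'I_N := Ordinal pN.
have /cvg_ex[/= c hc] : derivable f z0 (delta_mx 0 i) by exact: diff_derivable.
have H := (@cvgrPdist_lt C C _ _ _ _ _).1 hc.
exists (re c), (im c) => e e0.
have e0' : 0 < (e%:C : C) by rewrite lt_realC.
have := H (@dnbhs_filter C 0) _ e0'; rewrite /dnbhs /within/= => -[d /= d0 hd].
have dE : d = (normc d)%:C by rewrite -normC_normc gtr0_norm.
have nd0 : 0 < normc d by rewrite -lt_realC -dE.
exists (normc d / 2); first by rewrite divr_gt0.
move=> x' y' xd yd.
pose h : C := (x' - x) +i* (y' - y).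
have hn : normc h <= `|x' - x| + `|y' - y| by exact: normc_le_ReIm.
have hd' : normc h < normc d by lra.
have key : normc (f (h *: delta_mx 0 i + z0) - f z0 - c * h) <= e * normc h.
  have [->|h0] := eqVneq h 0.
    by rewrite scale0r add0r subrr mulr0 subr0 normc0 mulr0.
  have := hd h; rewrite /ball/= sub0r normrN dE normC_normc lt_realC => /(_ hd' h0).
  rewrite normC_normc lt_realC => /ltW.
  have -> : f (h *: delta_mx 0 i + z0) - f z0 - c * h =
     - ((c - h^-1 *: (f (h *: delta_mx 0 i + z0) - f z0)) * h).
    rewrite mulrBl opprB; congr (_ - _).
    by rewrite /GRing.scale/= mulrAC mulVf// mul1r.
  by rewrite normcN normcM => hh; rewrite ler_wpM2r// normc_ge0.
have vE : vec (p ++ (x', y') :: q) = h *: delta_mx 0 i + z0 by exact: vec_slice.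
rewrite vE -/z0.
have e1 : e * normc h <= e * (`|x' - x| + `|y' - y|) by rewrite ler_wpM2l// ltW.
split; apply: le_trans e1; apply: le_trans key.
  apply: le_trans (Re_le_normc _); rewrite le_eqVlt; apply/orP; left; apply/eqP.
  congr `|_|; rewrite /h; move: (f _) (f _) => [a b] [a' b'] /=.
  case: (c) => c1 c2 /=; ring.
apply: le_trans (Im_le_normc _); rewrite le_eqVlt; apply/orP; left; apply/eqP.
congr `|_|; rewrite /h; move: (f _) (f _) => [a b] [a' b'] /=.
case: (c) => c1 c2 /=; ring.
Qed.

End complex_slices.

(** * Measurability of continuous functions of several complex variables *)

Section rounding.
Context {R : realType}.
Local Notation C := (complex_field R).
Local Notation T := (measurableTypeR R * measurableTypeR R)%type.
Local Open Scope complex_scope.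

Lemma measurable_tuple_forall n (S : 'I_n -> set T) :
  (forall i, measurable (S i)) ->
  measurable [set t : n.-tuple T | forall i, S i (tnth t i)].
Proof.
move=> mS.
have -> : [set t : n.-tuple T | forall i, S i (tnth t i)] =
    ~` \bigcup_i ~` ((fun t : n.-tuple T => tnth t i) @^-1` S i).
  rewrite setC_bigcup; apply/seteqP; split => t /=.
    by move=> h i _; rewrite setCK; exact: h.
  by move=> h i; have := h i I; rewrite setCK.
apply: measurableC; apply: countable_bigcupT_measurable => // i.
apply: measurableC; rewrite -[X in measurable X]setTI.
exact: (measurable_tnth i).
Qed.

Definition cell (k : nat) (z : T) : int * int :=
  (Num.floor (k.+1%:R * z.1), Num.floor (k.+1%:R * z.2)).

Definition cell_corner (k : nat) (m : int * int) : T :=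
  (m.1%:~R / k.+1%:R, m.2%:~R / k.+1%:R).

Lemma cell_cornerP k (z : T) :
  `|(cell_corner k (cell k z)).1 - z.1| <= k.+1%:R^-1 /\
  `|(cell_corner k (cell k z)).2 - z.2| <= k.+1%:R^-1.
Proof.
have k0 : 0 < k.+1%:R :> R by rewrite ltr0n.
have H (x : R) : `|(Num.floor (k.+1%:R * x))%:~R / k.+1%:R - x| <= k.+1%:R^-1.
  have /andP[h1 h2] := floor_itv (k.+1%:R * x).
  rewrite distrC ger0_norm; last by rewrite subr_ge0 ler_pdivrMr// (mulrC x).
  rewrite lerBlDr -[X in X + _]mul1r -mulrDl ler_pdivlMr// (mulrC x).
  by rewrite addrC (le_trans (ltW h2))// intrD.
by split; exact: H.
Qed.

Lemma measurable_cell k (m : int * int) : measurable [set z | cell k z = m].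
Proof.
have k0 : 0 < k.+1%:R :> R by rewrite ltr0n.
have H (j : int) : measurable [set x : measurableTypeR R | Num.floor (k.+1%:R * x) = j].
  have -> : [set x : measurableTypeR R | Num.floor (k.+1%:R * x) = j] =
      `[j%:~R / k.+1%:R, (j + 1)%:~R / k.+1%:R[%classic.
    apply/seteqP; split => x /=; rewrite in_itv/= ler_pdivrMr// ltr_pdivlMr// (mulrC x).
      by move=> <-; exact: floor_itv.
    by move=> h; apply: floor_def.
  exact: measurable_itv.
have -> : [set z | cell k z = m] =
    [set x | Num.floor (k.+1%:R * x) = m.1] `*` [set x | Num.floor (k.+1%:R * x) = m.2].
  by apply/seteqP; split => -[x y] /=; rewrite /cell/=; case: m => a b;
    [case=> <- <-|case=> /= -> ->].
exact: measurableX.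
Qed.

Lemma measurable_cells n k (m : n.-tuple (int * int)) :
  measurable [set t : n.-tuple T | map_tuple (cell k) t = m].
Proof.
have -> : [set t : n.-tuple T | map_tuple (cell k) t = m] =
    [set t | forall i, [set z | cell k z = tnth m i] (tnth t i)].
  apply/seteqP; split => t /=; first by move=> <- i; rewrite tnth_map.
  by move=> h; apply: eq_from_tnth => i; rewrite tnth_map h.
apply: (@measurable_tuple_forall _ (fun i => [set z | cell k z = tnth m i])) => i.
exact: measurable_cell.
Qed.

(** A function of the cell index takes countably many values. *)
Lemma measurable_fun_cells n k (g : n.-tuple (int * int) -> R) :
  measurable_fun setT (fun t : n.-tuple T => g (map_tuple (cell k) t)).
Proof.
move=> _ Y mY; rewrite setTI.
have -> : (fun t : n.-tuple T => g (map_tuple (cell k) t)) @^-1` Y =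
   \bigcup_m (if `[< Y (g m) >] then [set t : n.-tuple T | map_tuple (cell k) t = m] else set0).
  apply/seteqP; split => [t Yt|t [m _]].
    by exists (map_tuple (cell k) t) => //; rewrite ifT//; exact/asboolP.
  by case: ifPn => // /asboolP Ym /= tm; rewrite -[map_tuple _ _]/(map_tuple (cell k) t) tm.
apply: countable_bigcupT_measurable => // m.
by case: ifPn => // _; exact: measurable_cells.
Qed.

Lemma nth_cells_dist k (p t : seq T) i :
  let t' := map (cell_corner k \o cell k) t in
  `|(nth (0, 0) (p ++ t') i).1 - (nth (0, 0) (p ++ t) i).1| <= k.+1%:R^-1 /\
  `|(nth (0, 0) (p ++ t') i).2 - (nth (0, 0) (p ++ t) i).2| <= k.+1%:R^-1.
Proof.
move=> t'; rewrite !nth_cat; case: ifPn => _.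
  by rewrite !subrr normr0 invr_ge0 ler0n.
have [it|ti] := ltnP (i - size p) (size t); last first.
  by rewrite !nth_default ?size_map// !subrr normr0 invr_ge0 ler0n.
by rewrite (nth_map (0, 0))//=; exact: cell_cornerP.
Qed.

Lemma cells_cvg N (p t : seq T) :
  @vec R N (p ++ map (cell_corner k \o cell k) t) @[k --> \oo] --> @vec R N (p ++ t).
Proof.
move=> A [P mP sPA].
have H i j : \forall k \near \oo, P i j (@vec R N (p ++ map (cell_corner k \o cell k) t) i j).
  have /nbhs_ballP[e /= e0 heP] := mP i j.
  have eE : e = (normc e)%:C by rewrite -normC_normc gtr0_norm.
  have e20 : 0 < normc e / 2 by rewrite divr_gt0// -lt_realC -eE.
  have := near_infty_natSinv_lt (PosNum e20); apply: filterS => k /= ke.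
  apply: heP; rewrite /ball/= normC_normc eE lt_realC.
  apply: (le_lt_trans (normc_le_ReIm _)).
  have [h1 h2] := nth_cells_dist k p t j.
  rewrite distrC in h1; rewrite distrC in h2; rewrite !mxE /=.
  by apply: le_lt_trans (lerD h1 h2) _; rewrite [ltRHS]splitr ltrD.
have : \forall k \near \oo, forall ij : 'I_1 * 'I_N,
    P ij.1 ij.2 (@vec R N (p ++ map (cell_corner k \o cell k) t) ij.1 ij.2).
  by apply: filter_forall => ij; exact: H.
apply: filterS => k hk; apply: sPA => i j; exact: (hk (i, j)).
Qed.

(** Composing with the cell corners gives functions of a countable index, which are
measurable and converge pointwise by continuity. This bypasses a comparison of the
Borel sets of [C^N] with the product sigma-algebra on tuples. *)
Lemma measurable_fun_vec N n (p : seq T) (D : set (n.-tuple T)) (g : 'rV[C]_N -> R) :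
  measurable D ->
  (forall t : n.-tuple T, D t -> {for vec N (p ++ t), continuous g}) ->
  measurable_fun D (fun t : n.-tuple T => g (vec N (p ++ t))).
Proof.
move=> mD cg.
apply: (@measurable_fun_cvg _ _ _ _ (fun k (t : n.-tuple T) =>
   g (vec N (p ++ map (cell_corner k \o cell k) t)))).
  move=> k; apply: (@measurable_funS _ _ _ _ setT) => //.
  under eq_fun do rewrite map_comp.
  exact: (@measurable_fun_cells n k (fun m => g (vec N (p ++ map (cell_corner k) m)))).
move=> t Dt; apply: (cvg_comp _ g (@cells_cvg N p t)); exact: cg.
Qed.

End rounding.

(** * Power measures and iterated mean inequalities *)

Section power_measure_theory.
Context {R : realType}.
Local Notation T := (measurableTypeR R * measurableTypeR R)%type.
Local Notation plane := (@lebesgue_plane R).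

Section step.
Context n (X : set T) (Y : set (n.-tuple T)) (D : set (n.+1.-tuple T)).
Hypotheses (mX : measurable X) (mY : measurable Y) (mD : measurable D).
Hypothesis DE : @tuple_cons _ T n @^-1` D = X `*` Y.

Lemma power_measureS : 
  (power_measure plane n.+1 D = plane X * power_measure plane n Y)%E.
Proof.
by rewrite [LHS]/= /power_step /pushforward DE product_measure1E.
Qed.

Lemma integral_power_measureS (f : n.+1.-tuple T -> \bar R) :
  measurable_fun D f -> (forall t, (0 <= f t)%E) ->
  (\int[power_measure plane n.+1]_(t in D) f t =
   \int[plane]_(z in X) \int[power_measure plane n]_(t in Y) f (tuple_cons (z, t)))%E.
Proof.
move=> mf f0.
have mc := @measurable_tuple_cons _ T n.
transitivity (\int[(plane \x power_measure plane n)%E]_(z in X `*` Y) (f \o @tuple_cons _ T n) z)%E.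
  rewrite -DE; exact: (@ge0_integral_pushforward _ _ _ _ _ _ mc
    (plane \x power_measure plane n)%E D f mD mf).
rewrite tonelli_setX1//; rewrite -DE.
  apply: (measurable_comp mD) => //; first by move=> _ [z zD <-].
  exact: measurable_funS mc.
by move=> z _; exact: f0.
Qed.

End step.

Lemma integral_power_measure0 (f : 0.-tuple T -> \bar R) (D : set (0.-tuple T)) :
  measurable D -> D [tuple] -> measurable_fun D f ->
  (\int[power_measure plane 0]_(t in D) f t = f [tuple])%E.
Proof.
move=> mD D0 mf; rewrite /= integral_dirac// diracE.
by rewrite mem_set// mul1e.
Qed.

Definition box n (a : n.-tuple T) (r : R) : set (n.-tuple T) :=
  [set t | forall i, square (tnth a i).1 (tnth a i).2 r (tnth t i)].

Lemma measurable_box n (a : n.-tuple T) r : measurable (box a r).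
Proof.
apply: (@measurable_tuple_forall _ _ (fun i => square (tnth a i).1 (tnth a i).2 r)) => i.
exact: measurable_square.
Qed.

Lemma box_cons n (x : T) (a : n.-tuple T) r :
  @tuple_cons _ T n @^-1` box [tuple of x :: a] r = square x.1 x.2 r `*` box a r.
Proof.
apply/seteqP; split => -[z t] /=.
  move=> h; split; first by have := h ord0; rewrite !(tnth_nth (0, 0)).
  by move=> i; have := h (lift ord0 i); rewrite !(tnth_nth (0, 0)).
move=> [hz ht] i; have [j ->|->] := unliftP ord0 i.
  by have := ht j; rewrite !(tnth_nth (0, 0)).
by rewrite !(tnth_nth (0, 0)).
Qed.

Lemma lebesgue_square x y r : 0 < r -> plane (square x y r) = ((2 * r) ^+ 2)%:E.
Proof.
move=> r0; rewrite /lebesgue_plane /square product_measure1E//=.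
rewrite !lebesgue_measure_itv/= !lte_fin.
rewrite !ifT; [|lra..].
by rewrite -!EFinD -EFinM; congr (_%:E); ring.
Qed.

Lemma power_measure_box n (a : n.-tuple T) r : 0 < r ->
  power_measure plane n (box a r) = ((2 * r) ^+ (2 * n))%:E.
Proof.
move=> r0; elim: n a => [a|n ih a].
  rewrite /= diracE mem_set//; last by case.
case/tupleP: a => x a.
rewrite (power_measureS _ _ (box_cons x a r)); [|exact: measurable_square|exact: measurable_box].
by rewrite ih lebesgue_square// -EFinM -exprD mulnS.
Qed.

Section iterated_mean.
Variables (v : seq T -> R) (r K : R) (c : seq T).
Hypotheses (r0 : 0 < r) (K0 : 0 <= K) (v0 : forall s, 0 <= v s).

Definition in_square (x z : T) :=
  (z.1 \in `[x.1 - r, x.1 + r]) && (z.2 \in `[x.2 - r, x.2 + r]).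

Hypothesis v_mean : forall c1 p x q, c = c1 ++ x :: q -> all2 in_square c1 p ->
  ((v (p ++ x :: q))%:E <= K%:E * \int[plane]_(z in square x.1 x.2 r) (v (p ++ z :: q))%:E)%E.

Hypothesis v_measurable : forall n c1 (a : n.-tuple T) p, c = c1 ++ a ->
  all2 in_square c1 p -> measurable_fun (box a r) (fun t : n.-tuple T => v (p ++ t)).

(** [p] collects the variables already integrated and [c1] their centres; the mean
inequality is only asked when the remaining variables sit at their centres [q], the
sole case that the induction meets. *)
Lemma iterated_mean n c1 (a : n.-tuple T) p : c = c1 ++ a -> all2 in_square c1 p ->
  ((v (p ++ a))%:E <= (K ^+ n)%:E *
     \int[power_measure plane n]_(t in box a r) (v (p ++ t))%:E)%E.
Proof.
elim: n c1 a p => [|n ih] c1 a p cE c1p.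
  rewrite tuple0 expr0 mul1e integral_power_measure0//.
  - exact: measurable_box.
  - by case.
  - by apply/measurable_EFinP; apply: v_measurable c1p; rewrite cE tuple0.
move: a cE; case/tupleP => x a cE.
have mv := v_measurable cE c1p.
have mS := measurable_square x.1 x.2 r; have mB := measurable_box a r.
have mv' : measurable_fun (square x.1 x.2 r `*` box a r) (fun z : T * n.-tuple T =>
  v (p ++ z.1 :: z.2)).
  rewrite -box_cons.
  apply: (measurable_comp (measurable_box [tuple of x :: a] r) _ mv).
    by move=> _ [z zD <-].
  exact: measurable_funS (@measurable_tuple_cons _ T n).
rewrite (integral_power_measureS mS mB _ (box_cons x a r)); first last.
- by move=> t; rewrite lee_fin.
- exact/measurable_EFinP.
- exact: measurable_box.
have msec : measurable_fun (square x.1 x.2 r)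
    (fun z => \int[power_measure plane n]_(t in box a r) (v (p ++ z :: t))%:E)%E.
  have mvE := (measurable_EFinP _ _).2 mv'.
  have := @measurable_section_integral _ _ _ _ _ (power_measure plane n) _ _ _ mS mB mvE.
  by apply => z _; rewrite lee_fin.
have ma : box a r a.
  by move=> i; split; rewrite /= in_itv/= lerDl gerBl ltW.
have sec z : square x.1 x.2 r z -> 
    ((v (p ++ z :: a))%:E <= (K ^+ n)%:E * \int[power_measure plane n]_(t in box a r) (v
      (p ++ z :: t))%:E)%E.
  move=> [z1 z2]; have := ih (rcons c1 x) a (rcons p z).
  under eq_integral do rewrite cat_rcons.
  rewrite !cat_rcons; apply => //.
  have sz : size c1 = size p by move: c1p; rewrite all2E => /andP[/eqP].
  move: c1p; rewrite !all2E => /andP[_ allp].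
  by rewrite !size_rcons sz eqxx zip_rcons// all_rcons allp andbT /= /in_square z1 z2.
have := v_mean cE c1p => /le_trans; apply.
rewrite exprS EFinM -muleA lee_wpmul2l ?lee_fin//.
rewrite -(@ge0_integralZl _ _ _ plane _ mS _ msec); first last.
- by rewrite lee_fin exprn_ge0.
- by move=> z _; apply: integral_ge0 => t _; rewrite lee_fin.
apply: ge0_le_integral => //.
- by move=> z _; rewrite lee_fin.
- apply/measurable_EFinP.
  apply: (measurable_comp (measurableX mS mB) _ mv' (g := fun z => (z, a))).
    by move=> _ [z zS <-].
  exact: measurable_funS (pair2_measurable _).
- apply: emeasurable_funM => //.
Qed.

End iterated_mean.
End power_measure_theory.

(** * Orlicz functions *)

Section orlicz_theory.
Context {R : realType}.
Variable psi : R -> R.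
Hypothesis hpsi : orlicz_function psi.

Let psi_ge0 := orlicz_ge0 hpsi.
Let psi0 := orlicz0 hpsi.

Lemma orlicz_convex x y t : 0 <= x -> 0 <= y -> 0 <= t <= 1 ->
  psi (t * x + (1 - t) * y) <= t * psi x + (1 - t) * psi y.
Proof.
move=> x0 y0 /andP[t0 t1].
have [<-|xy] := eqVneq x y; first by rewrite -!mulrDl addrC subrK !mul1r.
rewrite le_eqVlt in t0; rewrite le_eqVlt in t1.
move: t0 t1 => /predU1P[<- _|t0].
  by rewrite !mul0r !add0r subr0 !mul1r.
move=> /predU1P[->|t1]; first by rewrite subrr !mul0r !addr0 !mul1r.
by apply/ltW/(orlicz_strictly_convex hpsi) => //; rewrite t0.
Qed.

(** Strict convexity between 0 and [y], with [psi 0 = 0] and [psi >= 0]. *)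
Lemma orlicz_lt x y : 0 <= x -> x < y -> psi x < psi y.
Proof.
move=> x0 xy; have y0 : 0 < y by exact: le_lt_trans xy.
have [->|xn0] := eqVneq x 0.
  rewrite psi0; have h2 : 0 < (2^-1 : R) < 1 by rewrite invr_gt0 invf_lt1//= ltr1n andbT.
  have := orlicz_strictly_convex hpsi (ltW y0) (lexx 0) (lt0r_neq0 y0) h2.
  rewrite psi0 !mulr0 !addr0 => h.
  have : 0 <= psi (2^-1 * y) by apply: psi_ge0; rewrite mulr_ge0// ltW.
  by move=> /le_lt_trans/(_ h); rewrite pmulr_rgt0.
have x_gt0 : 0 < x by rewrite lt_def xn0.
have t01 : 0 < x / y < 1 by rewrite divr_gt0//= ltr_pdivrMr// mul1r.
have := orlicz_strictly_convex hpsi (ltW y0) (lexx 0) (lt0r_neq0 y0) t01.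
rewrite psi0 !mulr0 !addr0 divfK ?gt_eqF// => /lt_le_trans; apply.
by rewrite ler_piMl ?psi_ge0 ?(ltW y0)//; case/andP: t01 => _ /ltW.
Qed.

Lemma orlicz_le x y : 0 <= x -> x <= y -> psi x <= psi y.
Proof.
by move=> x0; rewrite le_eqVlt => /predU1P[->//|xy]; apply/ltW/orlicz_lt.
Qed.

Lemma orlicz_le_inv x y : 0 <= y -> psi x <= psi y -> x <= y.
Proof. by move=> y0; rewrite !leNgt; apply: contra; exact: orlicz_lt. Qed.

Lemma orlicz_scale t x : 0 <= t <= 1 -> 0 <= x -> psi (t * x) <= t * psi x.
Proof.
move=> t01 x0; have := orlicz_convex x0 (lexx 0) t01.
by rewrite psi0 !mulr0 !addr0.
Qed.

Lemma orlicz_scale_ge k x : 1 <= k -> 0 <= x -> k * psi x <= psi (k * x).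
Proof.
move=> k1 x0; have k0 : 0 < k by exact: lt_le_trans k1.
have := @orlicz_scale k^-1 (k * x).
rewrite mulKf ?gt_eqF// invr_ge0 (ltW k0) invf_le1//= k1 mulr_ge0// ?(ltW k0)//.
by move=> /(_ isT isT); rewrite ler_pdivlMl.
Qed.

(** The slope of the chord over [[x, y]] is at most that over [[x, M + 1]], whose
length is at least 1. *)
Lemma orlicz_lipschitz M x y : 0 <= x <= M -> 0 <= y <= M ->
  `|psi x - psi y| <= psi (M + 1) * `|x - y|.
Proof.
wlog xy : x y / x <= y => [H xM yM|].
  have /orP[xy|yx] := le_total x y; first exact: H.
  by rewrite distrC (distrC x); exact: H.
move=> /andP[x0 xM] /andP[y0 yM]; rewrite distrC (distrC x).
rewrite !ger0_norm ?subr_ge0 ?orlicz_le//.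
pose z := M + 1; have xz : 0 < z - x by rewrite /z; lra.
pose t := (z - y) / (z - x).
have t0 : 0 <= t by rewrite divr_ge0 ?(ltW xz)// /z; lra.
have t1 : t <= 1 by rewrite ler_pdivrMr// mul1r; lra.
have yE : t * x + (1 - t) * z = y by rewrite /t; field; rewrite gt_eqF.
have z0 : 0 <= z by rewrite /z; lra.
have := @orlicz_convex x z t x0 z0; rewrite t0 t1 yE => /(_ isT).
have t1E : 1 - t = (y - x) / (z - x) by rewrite /t; field; rewrite gt_eqF.
have h1 : 1 - t <= y - x.
  rewrite t1E ler_pdivrMr// ler_peMr ?subr_ge0//; rewrite /z; lra.
have px := psi_ge0 x0; have pz := psi_ge0 z0.
rewrite -/z => h.
have h2 : (1 - t) * psi z <= (y - x) * psi z by rewrite ler_wpM2r.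
have h3 : t * psi x <= psi x by rewrite ler_piMl.
lra.
Qed.

(** Composing with the absolute value removes the dependence on the unspecified
values of [psi] at negative numbers. *)
Lemma orlicz_abs_continuous : continuous (fun x : R => psi `|x|).
Proof.
move=> x; apply/cvgrPdist_lt => e e0.
pose M := `|x| + 1; pose L := psi (M + 1) + 1.
have M0 : 0 <= M + 1 by rewrite /M -addrA addr_ge0.
have L0 : 0 < L by rewrite ltr_wpDl// psi_ge0.
have d0 : 0 < Num.min 1 (e / L) by rewrite lt_min ltr01 divr_gt0.
near=> y.
have : `|x - y| < Num.min 1 (e / L).
  by near: y; apply: cvgr_dist_lt => //; exact: cvg_id.
rewrite lt_min ltr_pdivlMr// => /andP[xy1 xyL].
have dn : `| `|x| - `|y| | <= `|x - y| by exact: ler_dist_dist.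
apply: le_lt_trans xyL.
apply: (le_trans (@orlicz_lipschitz M _ _ _ _)).
- by rewrite normr_ge0 /M lerDl ler01.
- rewrite normr_ge0 /M /=; move: dn; rewrite ler_norml => /andP[? ?]; lra.
rewrite mulrC; apply: ler_pM => //; first by rewrite psi_ge0.
by rewrite /L lerDl.
Unshelve. all: by end_near. Qed.

Lemma orlicz_unbounded y : exists2 x, 0 <= x & y <= psi x.
Proof.
have := orlicz_superlinear hpsi; move=> /cvgryPge /(_ (`|y|)) [M [_ hM]].
have h : M < Num.max M 1 + 1 by rewrite ltr_pwDr// le_max lexx.
have := hM _ h; set x := Num.max M 1 + 1.
have x1 : 1 <= x by rewrite /x (le_trans (_ : 1 <= Num.max M 1))// ?lerDl// le_max lexx orbT.
have x0 : 0 < x by exact: lt_le_trans x1.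
rewrite ler_pdivlMr// => hx; exists x; first exact: ltW.
apply: le_trans hx; apply: (le_trans (ler_norm _)).
by rewrite ler_peMr.
Qed.

Lemma orlicz_surj : set_surj [set x | 0 <= x] [set y | 0 <= y] psi.
Proof.
move=> y /= y0; have [M M0 yM] := orlicz_unbounded y.
have c : {within `[0, M], continuous (fun x : R => psi `|x|)}.
  by apply: continuous_subspaceT; exact: orlicz_abs_continuous.
have := @IVT R _ 0 M y M0 c; rewrite normr0 psi0 ger0_norm// min_l ?max_r ?psi_ge0// y0 yM.
move=> /(_ isT)[x]; rewrite in_itv/= => /andP[x0 _]; rewrite ger0_norm// => xy.
by exists x.
Qed.

Lemma orlicz_invK y : 0 <= y -> psi (orlicz_inv psi y) = y.
Proof. by move=> y0; exact: (surjpK (fun=> 0) orlicz_surj (mem_set y0)). Qed.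

Lemma orlicz_inv_ge0 y : 0 <= y -> 0 <= orlicz_inv psi y.
Proof. by move=> y0; apply: (surjpinv_image_sub orlicz_surj); exists y. Qed.

Lemma orlicz_inv_gt0 y : 0 < y -> 0 < orlicz_inv psi y.
Proof.
move=> y0; rewrite lt_def orlicz_inv_ge0 ?(ltW y0)// andbT.
by apply/eqP => h; have := orlicz_invK (ltW y0); rewrite h psi0 => e; rewrite -e ltxx in y0.
Qed.

(** A substitute for a supporting line at [m]: the chord over [[m / 2, m]] lies below
[psi] outside that interval, and lowering it by [psi m - psi (m / 2)] puts it below
[psi] on the interval too. This costs a factor 2 in the argument. *)
Lemma orlicz_chord m : 0 <= m -> exists2 k, 0 <= k &
  forall x, 0 <= x -> psi (m / 2) + k * (x - m) <= psi x.
Proof.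
rewrite le_eqVlt => /predU1P[<-|m0].
  by exists 0 => // x x0; rewrite !mul0r addr0 psi0 psi_ge0.
have m20 : 0 < m / 2 by rewrite divr_gt0.
have m2m : psi (m / 2) <= psi m by apply: orlicz_le; lra.
pose k := (psi m - psi (m / 2)) / (m / 2).
have k0 : 0 <= k by rewrite divr_ge0 ?subr_ge0// ltW.
have kE : k * (m / 2) = psi m - psi (m / 2) by rewrite /k divfK ?gt_eqF.
exists k => // x x0.
have kM : m / 2 * (k * (x - m)) = (psi m - psi (m / 2)) * (x - m) by rewrite -kE; ring.
have [xm|mx] := lerP x m; last first.
  (* Past m, convexity is applied to m as a point between m / 2 and x. *)
  (* Weight of m / 2 in this convex combination. *)
  pose t := (x - m) / (x - m / 2).
  have d0 : 0 < x - m / 2 by lra.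
  have t01 : 0 <= t <= 1.
    by apply/andP; split; [apply: divr_ge0; lra|rewrite ler_pdivrMr//; lra].
  have := orlicz_convex (ltW m20) x0 t01.
  have -> : t * (m / 2) + (1 - t) * x = m by rewrite /t; field; rewrite gt_eqF //; lra.
  have -> : t * psi (m / 2) + (1 - t) * psi x =
      ((x - m) * psi (m / 2) + (m / 2) * psi x) / (x - m / 2).
    by rewrite /t; field; rewrite gt_eqF//; lra.
  rewrite ler_pdivlMr// => h.
  rewrite -(ler_pM2l m20) mulrDr kM; nra.
have [mx|xm2] := lerP (m / 2) x.
  have : psi (m / 2) <= psi x by apply: orlicz_le => //; exact: ltW.
  have : k * (x - m) <= 0 by rewrite mulr_ge0_le0// subr_le0.
  lra.
(* Before m / 2, it is applied to m / 2 as a point between x and m. *)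
pose t := (m / 2) / (m - x).
have d0 : 0 < m - x by lra.
have t01 : 0 <= t <= 1.
  by apply/andP; split; [apply: divr_ge0; lra|rewrite ler_pdivrMr//; lra].
have := orlicz_convex x0 (ltW m0) t01.
have -> : t * x + (1 - t) * m = m / 2 by rewrite /t; field; rewrite gt_eqF.
have -> : t * psi x + (1 - t) * psi m =
   ((m / 2) * psi x + (m / 2 - x) * psi m) / (m - x).
  by rewrite /t; field; rewrite gt_eqF.
rewrite ler_pdivlMr// => h.
rewrite -(ler_pM2l m20) mulrDr kM; nra.
Qed.

Hypothesis hD2 : Delta2_condition psi.

(** Iterating [psi x ^+ 2 <= psi (C * x)] squares the left-hand side each time;
the threshold [x0] is kept because [C] can be taken at least 1. *)
Lemma Delta2_iterate : exists2 x0, 0 < x0 & forall m, exists2 C, 1 <= C &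
  forall x, x0 <= x -> psi x ^+ (2 ^ m) <= psi (C * x).
Proof.
have [C C0 [M [_ hM]]] := hD2.
pose x0 := Num.max M 0 + 1.
have x00 : 0 < x0 by rewrite /x0 ltr_wpDl// le_max lexx orbT.
have hx x : x0 <= x -> psi x ^+ 2 <= psi (C * x).
  move=> x0x; apply: hM; apply: lt_le_trans x0x.
  by rewrite /x0 ltr_pwDr// le_max lexx.
exists x0 => // m; elim: m => [|m [D D1 ih]].
  by exists 1 => // x _; rewrite expn0 expr1 mul1r.
have C1 : 1 <= Num.max C 1 by rewrite le_max lexx orbT.
exists (Num.max C 1 * D); first by rewrite mulr_ege1.
move=> x x0x; rewrite expnSr exprM.
have xx : 0 < x by exact: lt_le_trans x0x.
have Dx : x <= D * x by rewrite ler_peMl// ltW.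
apply: (@le_trans _ _ (psi (D * x) ^+ 2)).
  by rewrite ler_sqr ?nnegrE ?exprn_ge0 ?psi_ge0 ?ih// ltW// (lt_le_trans xx).
apply: (le_trans (hx _ (le_trans x0x Dx))); rewrite -mulrA; apply: orlicz_le.
  by rewrite mulr_ge0 ?(ltW C0)// (le_trans (ltW xx)).
by rewrite ler_wpM2r ?le_max ?lexx// (le_trans (ltW xx)).
Qed.

(** Dilating by [L] reaches the threshold of [Delta^2] from any [y >= y0], and the
constant [K] is absorbed by convexity. *)
Lemma Delta2_power_le (K y0 : R) (k : nat) : 0 < y0 -> 1 <= psi y0 ->
  exists2 B, 1 <= B & forall y, y0 <= y -> K * psi y ^+ k <= psi (B * y).
Proof.
move=> y00 py0; have [x0 x00 /(_ k)[C C1 hC]] := Delta2_iterate.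
pose L := Num.max 1 (x0 / y0); pose K' := Num.max 1 K.
have L1 : 1 <= L by rewrite le_max lexx.
have K1 : 1 <= K' by rewrite le_max lexx.
exists (K' * (C * L)); first by rewrite !mulr_ege1.
move=> y y0y; have yy : 0 < y by exact: lt_le_trans y0y.
have x0L : x0 <= L * y.
  apply: (@le_trans _ _ (L * y0)); last by rewrite ler_wpM2l// (le_trans ler01).
  by rewrite -ler_pdivrMr// le_max lexx orbT.
have yLy : y <= L * y by rewrite ler_peMl// ltW.
have py1 : 1 <= psi y by apply: (le_trans py0); rewrite orlicz_le// ltW.
have L0 : 0 <= L by exact: le_trans ler01 L1.
have C0 : 0 <= C by exact: le_trans ler01 C1.
have Ly0 : 0 <= L * y by rewrite mulr_ge0// ltW.
have CLy : 0 <= C * (L * y) by rewrite mulr_ge0.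
apply: (@le_trans _ _ (K' * psi (C * (L * y)))); last first.
  by rewrite -!mulrA; exact: orlicz_scale_ge.
have pk0 : 0 <= psi y ^+ k by rewrite exprn_ge0 ?psi_ge0// ltW.
apply: (@le_trans _ _ (K' * psi y ^+ k)); first by rewrite ler_wpM2r// le_max lexx orbT.
rewrite ler_wpM2l ?(le_trans ler01)//.
apply: le_trans (hC _ x0L).
apply: (@le_trans _ _ (psi y ^+ (2 ^ k))).
  by apply: ler_weXn2l => //; rewrite ltnW// ltn_expl.
by apply: lerXn2r; rewrite ?nnegrE ?psi_ge0 ?(ltW yy)// orlicz_le// ltW.
Qed.

(** [Delta^2], iterated [m] times, at [y / C], after extracting the root of order
[2 ^ m]. *)
Lemma Delta2_root_le (m : nat) : exists B M, [/\ 1 <= B, 0 <= M &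
  forall y, 0 <= y -> psi (y / B) <= M + psi y `^ ((2 ^ m)%:R)^-1].
Proof.
have [x0 x00 /(_ m)[C C1 hC]] := Delta2_iterate.
have C0 : 0 < C by exact: lt_le_trans C1.
exists C, (psi x0); split => //; first by rewrite psi_ge0// ltW.
move=> y y0; have [xy|yx] := lerP x0 (y / C); last first.
  rewrite (@le_trans _ _ (psi x0))//; last by rewrite lerDl powR_ge0.
  by rewrite orlicz_le ?(ltW yx)// divr_ge0// ltW.
have := hC _ xy; rewrite (mulrC C) divfK ?gt_eqF// => h.
apply: ler_wpDl; first by rewrite psi_ge0// ltW.
have p0 : 0 <= psi (y / C) by rewrite psi_ge0// divr_ge0// ltW.
have -> : psi (y / C) = (psi (y / C) ^+ (2 ^ m)) `^ ((2 ^ m)%:R)^-1.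
  by rewrite -powR_mulrn// -powRrM mulfV ?powRr1// pnatr_eq0 -lt0n expn_gt0.
apply: ge0_ler_powR => //; rewrite ?invr_ge0 ?ler0n ?nnegrE ?exprn_ge0 ?psi_ge0//.
by rewrite divr_ge0// ltW.
Qed.

End orlicz_theory.

(** * The mean inequality over a product of squares *)

Section holomorphic_box_mean.
Context {R : realType}.
Variable N : nat.
Local Notation C := (complex_field R).
Local Notation CN := 'rV[C]_N.
Local Notation T := (measurableTypeR R * measurableTypeR R)%type.
Local Notation plane := (@lebesgue_plane R).
Local Notation re := complex.Re.
Local Notation im := complex.Im.
Local Open Scope complex_scope.

Lemma normc_dist (z w : C) : `|normc z - normc w| <= normc (z - w).
Proof.
have H (x y : C) : normc x - normc y <= normc (x - y).
  by rewrite lerBlDr; have := le_normcD (x - y) y; rewrite subrK.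
rewrite ler_norml H andbT lerNl opprB.
by apply: (le_trans (H _ _)); rewrite -normcN opprB.
Qed.

Lemma continuous_complex_real (f : CN -> C) (h : C -> R) z :
  (forall u w, `|h u - h w| <= normc (u - w)) ->
  {for z, continuous f} -> {for z, continuous (fun z => h (f z))}.
Proof.
move=> hh cf.
apply: (@cvgrPdist_lt R R CN (nbhs z) (nbhs_filter z) _ _).2 => e e0.
have e0' : 0 < (e%:C : C) by rewrite lt_realC.
have := (@cvgrPdist_lt C C CN (nbhs z) (nbhs_filter z) f (f z)).1 cf _ e0'.
move=> H; apply: (@filterS _ (nbhs z) (nbhs_filter z) _ _ _ H) => w /=.
by rewrite normC_normc lt_realC; exact: le_lt_trans.
Qed.

Lemma re_dist (u w : C) : `|re u - re w| <= normc (u - w).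
Proof. by have := Re_le_normc (u - w); case: u w => [a b] [c d]. Qed.

Lemma im_dist (u w : C) : `|im u - im w| <= normc (u - w).
Proof. by have := Im_le_normc (u - w); case: u w => [a b] [c d]. Qed.

Variable f : CN -> C.

Lemma measurable_box_fun n (p : seq T) (h : C -> R) (D : set (n.-tuple T)) :
  measurable D ->
  (forall u w, `|h u - h w| <= normc (u - w)) ->
  (forall t, D t -> differentiable f (vec N (p ++ t))) ->
  measurable_fun D (fun t : n.-tuple T => h (f (vec N (p ++ t)))).
Proof.
move=> mD hh df; apply: (@measurable_fun_vec _ _ _ _ _ (fun z => h (f z))) => //.
move=> t Dt; apply: continuous_complex_real => //.
exact/differentiable_continuous/df.
Qed.

Variables (a : N.-tuple T) (r : R).
Hypothesis r0 : 0 < r.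
Hypothesis df : forall s, all2 (in_square r) a s -> differentiable f (vec N s).

Lemma all2_box c1 p n (q t : n.-tuple T) : tval a = c1 ++ q ->
  all2 (in_square r) c1 p -> box q r t -> all2 (in_square r) a (p ++ t).
Proof.
move=> aE; rewrite !all2E => /andP[/eqP sz allp] qt.
rewrite aE !size_cat sz !size_tuple eqxx/= zip_cat// all_cat allp/=.
apply/(all_nthP ((0, 0), (0, 0))) => i.
rewrite size_zip !size_tuple minnn => ni; rewrite nth_zip ?size_tuple//=.
have [h1 h2] := qt (Ordinal ni); move: h1 h2.
by rewrite !(tnth_nth (0, 0)) /in_square /= => -> ->.
Qed.

Lemma box_slice_measurable (h : C -> R) c1 p x q :
  (forall u w, `|h u - h w| <= normc (u - w)) ->
  tval a = c1 ++ x :: q -> all2 (in_square r) c1 p ->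
  measurable_fun (square x.1 x.2 r) (fun z => h (f (vec N (p ++ z :: q)))).
Proof.
move=> hh aE c1p; pose q' := in_tuple q.
have m1 : measurable_fun (box [tuple of x :: q'] r)
    (fun t : (size q).+1.-tuple T => h (f (vec N (p ++ t)))).
  apply: measurable_box_fun => //; first exact: measurable_box.
  by move=> t bt; apply: df; apply: (all2_box _ c1p bt).
have := measurable_comp (measurable_box [tuple of x :: q'] r) _ m1.
move=> /(_ _ _ (square x.1 x.2 r) (fun z => tuple_cons (z, q'))); apply.
  move=> _ [z zS <-].
  suff : (@tuple_cons _ T _ @^-1` box [tuple of x :: q'] r) (z, q') by [].
  rewrite box_cons; split => // i.
  by split; rewrite /= in_itv/= lerDl gerBl ltW.
apply: (@measurable_funS _ _ _ _ setT) => //.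
exact: (measurableT_comp (@measurable_tuple_cons _ T _) (pair2_measurable _)).
Qed.

Lemma slice_mean c1 p x q :
  tval a = c1 ++ x :: q -> all2 (in_square r) c1 p ->
  ((normc (f (vec N (p ++ x :: q))))%:E <=
   (16 / r ^+ 2)%:E * \int[plane]_(z in square x.1 x.2 r) (normc (f (vec N (p ++ z :: q))))%:E)%E.
Proof.
move=> aE c1p.
have pN : (size p < N)%N.
  have : size a = (size c1 + (size q).+1)%N by rewrite aE size_cat.
  rewrite size_tuple => ->; have -> : size p = size c1.
    by move: c1p; rewrite all2E => /andP[/eqP].
  by rewrite addnS ltnS leq_addr.
have insq z : square x.1 x.2 r z -> all2 (in_square r) a (p ++ z :: q).
  move=> zx; have := @all2_box c1 p _ [tuple of x :: in_tuple q] [tuple of z :: in_tuple q] aE c1p.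
  apply; suff : (@tuple_cons _ T _ @^-1` box [tuple of x :: in_tuple q] r) (z, in_tuple q) by [].
  by rewrite box_cons; split => // i; split; rewrite /= in_itv/= lerDl gerBl ltW.
pose U y z := re (f (vec N (p ++ (y, z) :: q))).
pose V y z := im (f (vec N (p ++ (y, z) :: q))).
have mU : measurable_fun (square x.1 x.2 r) (fun z => U z.1 z.2).
  rewrite (_ : (fun z => _) = fun z : T => re (f (vec N (p ++ z :: q))));
    last by apply/funext => -[].
  by apply: box_slice_measurable aE c1p; exact: re_dist.
have mV : measurable_fun (square x.1 x.2 r) (fun z => V z.1 z.2).
  rewrite (_ : (fun z => _) = fun z : T => im (f (vec N (p ++ z :: q))));
    last by apply/funext => -[].
  by apply: box_slice_measurable aE c1p; exact: im_dist.
have mn : measurable_fun (square x.1 x.2 r) (fun z => normc (f (vec N (p ++ z :: q)))).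
  by apply: box_slice_measurable aE c1p; exact: normc_dist.
have UV y z : `|y - x.1| <= r -> `|z - x.2| <= r -> complex_derivable U V y z.
  move=> yr zr; apply: holomorphic_slice => //; apply: df; apply: insq.
  by split; rewrite /= in_itv/=; [move: yr|move: zr]; rewrite ler_norml => /andP[? ?];
    apply/andP; split; lra.
have := square_mean r0 UV mU mV.
set J := (X in (_ <= _ * X)%E) => h1.
set J' := (X in (_ <= _ * X)%E).
have mS := measurable_square x.1 x.2 r.
have J2 : (J <= 2%:E * J')%E.
  rewrite -ge0_integralZl//; first last.
  - by move=> z _; rewrite lee_fin normc_ge0.
  - exact/measurable_EFinP.
  apply: ge0_le_integral => //.
  - apply/measurable_EFinP; apply: measurable_funD;
    exact: (measurableT_comp (@normr_measurable R setT)).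
  - by apply: emeasurable_funM => //; exact/measurable_EFinP.
  move=> [y z] _; rewrite -EFinM lee_fin /U /V /= mulr2n mulrDl !mul1r.
  by apply: lerD; [exact: Re_le_normc|exact: Im_le_normc].
have r20 : 0 < r ^+ 2 by rewrite exprn_gt0.
have -> : 16 / r ^+ 2 = (r ^+ 2)^-1 * 8 * 2 by rewrite mulrC -mulrA; congr (_ * _); ring.
rewrite EFinM -muleA EFinM -muleA.
apply: (@le_trans _ _ (((r ^+ 2)^-1)%:E * (8%:E * J))%E); last first.
  by rewrite !lee_wpmul2l ?lee_fin ?invr_ge0 ?(ltW r20).
rewrite lee_pdivlMl//.
apply: le_trans h1; rewrite -EFinM lee_fin mulrC ler_wpM2r ?(ltW r20)//.
by rewrite (le_trans (normc_le_ReIm _))// /U /V; case: (x).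
Qed.

Lemma box_mean : ((normc (f (vec N a)))%:E <= ((16 / r ^+ 2) ^+ N)%:E *
  \int[power_measure plane N]_(t in box a r) (normc (f (vec N t)))%:E)%E.
Proof.
have := @iterated_mean R (fun s =>
  normc (f (vec N s))) r (16 / r ^+ 2) a r0 _ _ _ _ N [::] a [::] erefl isT.
apply.
- by rewrite divr_ge0// sqr_ge0.
- by move=> s; exact: normc_ge0.
- exact: slice_mean.
move=> n c1 b p aE c1p; apply: measurable_box_fun => //.
- exact: measurable_box.
- exact: normc_dist.
- by move=> t bt; apply: df; exact: (all2_box aE c1p bt).
Qed.

(** Jensen with the lowered chord of [psi]: integrate
[psi (m / 2) + k * (g - m) <= psi g] over the box, where the mean of [g] is at least
[m]. The linear term is moved to the left so that all integrands are nonnegative. *)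
Lemma box_mean_orlicz (psi : R -> R) (c : R) : orlicz_function psi -> 0 < c ->
  ((psi (normc (f (vec N a)) / (2 * 64 ^+ N * c)) * (2 * r) ^+ (2 * N))%:E <=
   \int[power_measure plane N]_(t in box a r) (psi (normc (f (vec N t)) / c))%:E)%E.
Proof.
move=> hpsi c0; set V := (2 * r) ^+ (2 * N).
have V0 : 0 < V by rewrite exprn_gt0// mulr_gt0.
have N64 : 0 < 64 ^+ N :> R by rewrite exprn_gt0.
pose m := normc (f (vec N a)) / (64 ^+ N * c).
have m0 : 0 <= m by rewrite divr_ge0 ?normc_ge0// mulr_ge0 ?(ltW N64)// ltW.
have -> : normc (f (vec N a)) / (2 * 64 ^+ N * c) = m / 2.
  by rewrite /m; field; rewrite !gt_eqF.
have [k k0 kP] := orlicz_chord hpsi m0.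
pose g (t : N.-tuple T) := normc (f (vec N t)) / c.
have g0 t : 0 <= g t by rewrite divr_ge0 ?normc_ge0// ltW.
have mB := measurable_box a r.
have mn : measurable_fun (box a r) (fun t : N.-tuple T => normc (f (vec N t))).
  apply: (@measurable_box_fun N [::]) => //; first exact: normc_dist.
  by move=> t bt; apply: df; apply: (@all2_box [::] [::] N a t).
have mg : measurable_fun (box a r) g by apply: measurable_funM.
have mpg : measurable_fun (box a r) (fun t => psi (g t)).
  rewrite (_ : (fun t => _) = (fun x => psi `|x|) \o g); last first.
    by apply/funext => t /=; rewrite ger0_norm.
  apply: measurableT_comp => //; apply: continuous_measurable_fun.
  exact: orlicz_abs_continuous.
have pm0 : 0 <= psi (m / 2) by rewrite (orlicz_ge0 hpsi)// divr_ge0.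
have VE : power_measure plane N (box a r) = V%:E by exact: power_measure_box.
(* The constant 64 is 16 / r^2 times the area 4 r^2 of one square. *)
have mV : ((m * V)%:E <= \int[power_measure plane N]_(t in box a r) (g t)%:E)%E.
  under eq_integral do rewrite /g mulrC EFinM.
  rewrite ge0_integralZl//; first last.
  - by rewrite lee_fin invr_ge0 ltW.
  - by move=> t _; rewrite lee_fin normc_ge0.
  - exact/measurable_EFinP.
  have := box_mean; set J := (X in (_ <= _ * X)%E) => h.
  have := lee_wpmul2l (_ : (0 <= (V / (64 ^+ N * c))%:E)%E) h.
  rewrite lee_fin divr_ge0 ?(ltW V0) ?mulr_ge0 ?(ltW N64) ?(ltW c0)// => /(_ isT).
  rewrite -EFinM muleA -EFinM.
  have -> : V / (64 ^+ N * c) * (16 / r ^+ 2) ^+ N = c^-1.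
    have e : (16 / r ^+ 2) ^+ N * V = 64 ^+ N.
      rewrite /V exprM -exprMn; congr (_ ^+ _); field.
      by rewrite gt_eqF.
    rewrite mulrC mulrA e invfM mulrA mulfV ?mul1r// gt_eqF//.
  by have -> : m * V = V / (64 ^+ N * c) * normc (f (vec N a)) by rewrite /m mulrC mulrCA mulrC.
have : ((psi (m / 2) * V)%:E + k%:E * \int[power_measure plane N]_(t in box a r) (g t)%:E <=
   \int[power_measure plane N]_(t in box a r) (psi (g t))%:E + (k * m * V)%:E)%E.
  rewrite -ge0_integralZl//; first last.
  - by move=> t _; rewrite lee_fin.
  - exact/measurable_EFinP.
  have cstE (d : R) : (d * V)%:E = (\int[power_measure plane N]_(t in box a r) (d%:E))%E.
    by rewrite integral_cst// EFinM; congr (_ * _)%E; exact: esym VE.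
  have mpgE : measurable_fun (box a r) (fun t => (psi (g t))%:E) by exact/measurable_EFinP.
  have mkgE : measurable_fun (box a r) (fun t => k%:E * (g t)%:E)%E.
    by apply: emeasurable_funM => //; exact/measurable_EFinP.
  have pg0 t : (0 <= (psi (g t))%:E)%E by rewrite lee_fin (orlicz_ge0 hpsi).
  have kg0 t : (0 <= k%:E * (g t)%:E)%E by rewrite mule_ge0// lee_fin.
  have km0 : (0 <= (k * m)%:E)%E by rewrite lee_fin mulr_ge0.
  rewrite !cstE -ge0_integralD//; do ?[exact: mkgE|by move=> t _; exact: kg0|by move=> t _;
    rewrite lee_fin].
  rewrite -ge0_integralD//; do ?[exact: mpgE|by move=> t _; exact: pg0|by move=> t _;
    rewrite lee_fin mulr_ge0].
  apply: ge0_le_integral => //.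
  - by move=> t _; rewrite adde_ge0.
  - exact: emeasurable_funD.
  - exact: emeasurable_funD.
  by move=> t _; rewrite -EFinM -!EFinD lee_fin; have := kP _ (g0 t); lra.
set J := (\int[_]_(_ in _) (g _)%:E)%E in mV *.
move=> h; rewrite -(@leeD2rE _ (k * m * V)%:E)//; apply: le_trans h.
by rewrite leeD2lE// -mulrA EFinM lee_wpmul2l.
Qed.

End holomorphic_box_mean.

(** * Integrals of truncated powers *)

Section truncated_power.
Context {R : realType}.
Variable beta : R.
Hypothesis beta_gtN1 : -1 < beta.
Hypothesis beta_lt0 : beta < 0.
Local Notation leb := (@lebesgue_measure R).
Local Notation T := (measurableTypeR R * measurableTypeR R)%type.
Local Notation plane := (@lebesgue_plane R).

(** Vanishes for [u <= 0], so that integrals of [pos_powR beta (A - |t|^2)] over the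
whole space are integrals over the ball of radius [sqrt A]. *)
Definition pos_powR (u : R) : R := if 0 < u then u `^ beta else 0.

Lemma pos_powR_ge0 u : 0 <= pos_powR u.
Proof. by rewrite /pos_powR; case: ifP => // _; exact: powR_ge0. Qed.

Lemma measurable_pos_powR : measurable_fun setT pos_powR.
Proof.
apply: measurable_fun_ifT.
- exact: measurable_fun_ltr.
- exact: (@measurable_powR R beta).
- exact: measurable_cst.
Qed.

Lemma powR_le_neg (x y : R) : 0 < x -> x <= y -> y `^ beta <= x `^ beta.
Proof.
move=> x0 xy; have y0 : 0 < y by exact: lt_le_trans xy.
rewrite -[beta]opprK !(powRN _ (- beta)) lef_pV2 ?posrE ?powR_gt0//.
by apply: ge0_ler_powR => //; rewrite ?nnegrE ?oppr_ge0 ltW.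
Qed.

Let b1 : 0 < beta + 1. Proof. by rewrite -ltrBlDr sub0r. Qed.

Lemma is_derive_powR_sub (a x : R) : x < a ->
  is_derive x 1 (fun x => (- (beta + 1))^-1 * (a - x) `^ (beta + 1)) ((a - x) `^ beta).
Proof.
move=> xa; have ax : 0 < a - x by rewrite subr_gt0.
have d1 : is_derive x (1 : R) (fun x => a - x) (-1).
  by apply: is_derive_eq; rewrite add0r mul1r.
have d2 := is_derive1_powR (beta + 1) ax.
have d3 : is_derive x 1 (fun x : R =>
  (a - x) `^ (beta + 1)) ((beta + 1) * (a - x) `^ (beta + 1 - 1) * -1).
  exact: (@is_derive1_comp _ (fun y => y `^ (beta + 1)) (fun x => a - x) x _ _ d2 d1).
have d4 := @is_deriveZ _ _ _ (fun x : R => (a - x) `^ (beta + 1)) (- (beta + 1))^-1 x 1 _ d3.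
have -> : (a - x) `^ beta = (- (beta + 1))^-1 *: ((beta + 1) * (a - x) `^ (beta + 1 - 1) * -1).
  rewrite addrK mulrN1 /GRing.scale/= mulrN invrN mulNr opprK mulrA mulVf ?mul1r//.
  by rewrite gt_eqF.
exact: d4.
Qed.

Lemma continuous_powR_sub (a x : R) : x < a -> {for x, continuous (fun x => (a - x) `^ beta)}.
Proof.
move=> xa; have ax : 0 < a - x by rewrite subr_gt0.
apply: (@continuous_comp R R R (fun x => a - x) (fun y => y `^ beta)).
  by apply: cvgB; [exact: cvg_cst|exact: cvg_id].
apply: differentiable_continuous; apply/derivable1_diffP.
by apply: derivable_powR; rewrite in_itv/= ax.
Qed.

(** The primitive vanishes at [a]; stopping at [b < a] avoids the singularity. *)
Lemma integral_powR_sub (a b : R) : 0 < b -> b < a ->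
  (\int[leb]_(x in `[0%R, b]) ((a - x) `^ beta)%:E <= (a `^ (beta + 1) / (beta + 1))%:E)%E.
Proof.
move=> b0 ba.
pose G x := (- (beta + 1))^-1 * (a - x) `^ (beta + 1).
have dG x : x < a -> is_derive x 1 G ((a - x) `^ beta) by exact: is_derive_powR_sub.
have cG x : x < a -> {for x, continuous G}.
  move=> xa; apply: differentiable_continuous; apply/derivable1_diffP.
  by case: (dG x xa).
rewrite (@continuous_FTC2 _ (fun x => (a - x) `^ beta) G)//.
- rewrite -EFinB lee_fin /G subr0 invrN !mulNr opprK addrC mulrC.
  by rewrite gerBl mulr_ge0 ?invr_ge0 ?(ltW b1)// powR_ge0.
- apply: continuous_at_itv => x /andP[_ xb].
  by apply: continuous_powR_sub; exact: le_lt_trans ba.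
- split.
  + move=> x /=; rewrite in_itv/= => /andP[_ xb].
    by case: (dG x (lt_trans xb ba)).
  + by apply: cvg_at_right_filter; apply: cG; exact: lt_trans ba.
  + by apply: cvg_at_left_filter; exact: cG.
- move=> x /=; rewrite in_itv/= => /andP[_ xb].
  by rewrite derive1E; case: (dG x (lt_trans xb ba)).
Qed.

Lemma integral_pos_powR_sym (a b : R) : 0 < b -> b < a ->
  (\int[leb]_(x in `[(- b)%R, b]) (pos_powR (a - `|x|))%:E <=
   (2 * (a `^ (beta + 1) / (beta + 1)))%:E)%E.
Proof.
move=> b0 ba.
pose g (x : R) := (a - `|x|) `^ beta.
have cg x : - b <= x <= b -> {for x, continuous g}.
  move=> xb; apply: (@continuous_comp R R R (fun x : R => `|x|) (fun x => (a - x) `^ beta)).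
    exact: norm_continuous.
  by apply: continuous_powR_sub; apply: le_lt_trans ba; rewrite ler_norml.
have -> : (\int[leb]_(x in `[(- b)%R, b]) (pos_powR (a - `|x|))%:E =
   \int[leb]_(x in `[(- b)%R, b]) (g x)%:E)%E.
  apply: eq_integral => x; rewrite inE/= in_itv/= -ler_norml => xb.
  by rewrite /pos_powR ifT// subr_gt0; exact: le_lt_trans ba.
have cb : {within `[- b, b], continuous g} by apply: continuous_at_itv => x; exact: cg.
have gN : (\int[leb]_(x in `[(- b)%R, 0%R]) (g x)%:E = \int[leb]_(x in `[0%R, b]) (g x)%:E)%E.
  have := @integration_by_substitution_oppr R g 0 b (ltW b0).
  rewrite oppr0 => ->; last by apply: continuous_subitv cb; lra.
  by apply: eq_integral => x _; rewrite /g /= normrN.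
have gle : (\int[leb]_(x in `[0%R, b]) (g x)%:E <= (a `^ (beta + 1) / (beta + 1))%:E)%E.
  apply: le_trans (integral_powR_sub b0 ba).
  rewrite le_eqVlt; apply/orP; left; apply/eqP; apply: eq_integral => x.
  by rewrite inE/= in_itv/= /g => /andP[x0 _]; rewrite ger0_norm.
have b00 : - b <= 0 by lra.
rewrite -itv_integral_EFin// (@itv_integral_split _ _ 0) ?(ltW b0)//.
rewrite EFinD !itv_integral_EFin; first last.
- by apply: continuous_subitv cb; lra.
- by apply: continuous_subitv cb; lra.
by rewrite gN mulr2n mulrDl !mul1r EFinD; exact: leeD.
Qed.

(** Monotone limit of the integrals over the segments [[- b, b]] with [b < a]. *)
Lemma integral_pos_powR_abs (a : R) : 0 < a ->
  (\int[leb]_x (pos_powR (a - `|x|))%:E <= (2 * (a `^ (beta + 1) / (beta + 1)))%:E)%E.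
Proof.
move=> a0; pose h (x : R) := (pos_powR (a - `|x|))%:E.
have mh : measurable_fun setT h.
  apply/measurable_EFinP; apply: (measurableT_comp measurable_pos_powR).
  by apply: measurable_funB => //; exact: normr_measurable.
pose F n : set R := `[- (a - a / n.+2%:R), a - a / n.+2%:R]%classic.
have Fpos n : 0 < a - a / n.+2%:R.
  rewrite subr_gt0 ltr_pdivrMr ?ltr0n//; have : 1 < n.+2%:R :> R by rewrite ltr1n.
  by move=> n1; rewrite ltr_pMr.
have Flt n : a - a / n.+2%:R < a by rewrite gtrBl divr_gt0// ltr0n.
have ndF : nondecreasing_seq F.
  apply/nondecreasing_seqP => n; apply/subsetPset => x; rewrite /F /= !in_itv/=.
  have : a / n.+3%:R <= a / n.+2%:R.
    by rewrite ler_wpM2l ?(ltW a0)// lef_pV2 ?posrE ?ltr0n// ler_nat.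
  move=> le23 /andP[h1 h2]; apply/andP; split.
    by apply: le_trans h1; rewrite lerN2 lerD2l lerN2.
  by apply: (le_trans h2); rewrite lerD2l lerN2.
have UF : \bigcup_n F n = `]- a, a[%classic.
  apply/seteqP; split => [x [n _]|x] /=; rewrite /F /= !in_itv/=.
    move=> /andP[h1 h2]; rewrite (le_lt_trans h2 (Flt n)) andbT.
    by apply: lt_le_trans h1; rewrite ltrN2.
  move=> xa; have {}xa : `|x| < a by rewrite ltr_norml.
  have ax0 : 0 < a - `|x| by rewrite subr_gt0.
  exists (Num.bound (a / (a - `|x|))) => //=; rewrite in_itv/= -ler_norml.
  rewrite lerBrDl -lerBrDr ler_pdivrMr ?ltr0n// -ler_pdivrMl// mulrC.
  have := archi_boundP (ltW (divr_gt0 a0 ax0)) => /ltW /le_trans; apply.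
  by rewrite ler_nat ltnW.
have -> : (\int[leb]_x h x = \int[leb]_(x in \bigcup_n F n) h x)%E.
  rewrite UF [RHS]integral_mkcond; apply: eq_integral => x _.
  rewrite patchE; case: ifPn => //; rewrite notin_setE/= in_itv/= -ltr_norml => /negP.
  rewrite -leNgt => ax; rewrite /h /pos_powR ifF//.
  by apply/negbTE; rewrite -leNgt subr_le0.
have cv := @ge0_nondecreasing_set_cvg_integral _ (measurableTypeR R) R F h leb ndF.
have mF n : measurable (F n) by exact: measurable_itv.
have {}cv := cv mF (fun n => measurable_funS measurableT (@subsetT _ _) mh).
have {}cv := cv (fun n x _ => pos_powR_ge0 (a - `|x|)).
rewrite -(cvg_lim _ cv)//; apply: lime_le.
  by apply/cvg_ex; eexists; exact: cv.
by apply: nearW => n; exact: integral_pos_powR_sym.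
Qed.

Definition line_const := 2 / (beta + 1).

Lemma line_const_ge0 : 0 <= line_const.
Proof. by rewrite divr_ge0// ltW. Qed.

(** With [a = sqrt A], factor [A - x^2 = (a + |x|) (a - |x|)] and bound the first
factor by [a]. This gives [A `^ (beta + 1 / 2)] up to a constant, which is at most
[A `^ beta] because [A <= 1]; giving up this gain lets the same bound be iterated. *)
Lemma integral_pos_powR_line (A : R) : A <= 1 ->
  (\int[leb]_x (pos_powR (A - x ^+ 2))%:E <= (line_const * pos_powR A)%:E)%E.
Proof.
move=> A1; have [A0|A0] := ltP 0 A; last first.
  rewrite integral0_eq => [|x _].
    by rewrite lee_fin; apply: mulr_ge0; [exact: line_const_ge0|exact: pos_powR_ge0].
  by rewrite /pos_powR ifF//; apply/negbTE; rewrite -leNgt subr_le0 (le_trans A0)// sqr_ge0.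
pose a := Num.sqrt A.
have a0 : 0 < a by rewrite sqrtr_gt0.
have aA : a ^+ 2 = A by rewrite sqr_sqrtr// ltW.
have a1 : a <= 1 by rewrite -sqrtr1 ler_wsqrtr.
have le x : pos_powR (A - x ^+ 2) <= a `^ beta * pos_powR (a - `|x|).
  have E : A - x ^+ 2 = (a + `|x|) * (a - `|x|).
    by rewrite -aA -[x ^+ 2]real_normK ?num_real//; ring.
  have ax0 : 0 < a + `|x| by rewrite ltr_wpDr.
  rewrite /pos_powR E pmulr_rgt0//; case: ifP => [axm|_]; last by rewrite mulr0.
  rewrite powRM ?(ltW axm) ?(ltW ax0)// ler_wpM2r ?powR_ge0//.
  by apply: powR_le_neg; rewrite ?lerDl.
have mt : measurable_fun setT (fun x : R => (pos_powR (a - `|x|))%:E).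
  apply/measurable_EFinP; apply: (measurableT_comp measurable_pos_powR).
  by apply: measurable_funB => //; exact: normr_measurable.
apply: (@le_trans _ _ (\int[leb]_x ((a `^ beta)%:E * (pos_powR (a - `|x|))%:E))%E).
  apply: ge0_le_integral => //.
  - by move=> x _; rewrite lee_fin pos_powR_ge0.
  - apply/measurable_EFinP; apply: (measurableT_comp measurable_pos_powR).
    by apply: measurable_funB => //; exact: measurable_funX.
  - exact: emeasurable_funM.
  - by move=> x _; rewrite -EFinM lee_fin; exact: le.
rewrite ge0_integralZl//; first last.
- by rewrite lee_fin powR_ge0.
- by move=> x _; rewrite lee_fin pos_powR_ge0.
apply: (@le_trans _ _ ((a `^ beta)%:E * (2 * (a `^ (beta + 1) / (beta + 1)))%:E)%E).
  by rewrite lee_wpmul2l ?lee_fin ?powR_ge0// integral_pos_powR_abs.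
rewrite -EFinM lee_fin /line_const /pos_powR A0.
have -> : A `^ beta = a `^ beta * a `^ beta by rewrite -powRM ?(ltW a0)// -expr2 aA.
have ab0 : 0 <= a `^ beta by exact: powR_ge0.
have ab1 : a `^ (beta + 1) <= a `^ beta by apply: ger_powR; rewrite ?a0// lerDl.
have -> : a `^ beta * (2 * (a `^ (beta + 1) / (beta + 1))) =
    2 / (beta + 1) * (a `^ beta * a `^ (beta + 1)) by ring.
by rewrite ler_wpM2l ?line_const_ge0// ler_wpM2l.
Qed.

Definition sqn n (t : n.-tuple T) : R := \sum_(i < n) ((tnth t i).1 ^+ 2 + (tnth t i).2 ^+ 2).

Lemma measurable_sqn n : measurable_fun setT (@sqn n).
Proof.
apply: measurable_sum => i; apply: measurable_funD; apply: measurable_funX.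
  exact: (measurableT_comp measurable_fst (measurable_tnth i)).
exact: (measurableT_comp measurable_snd (measurable_tnth i)).
Qed.

Lemma sqn_ge0 n (t : n.-tuple T) : 0 <= sqn t.
Proof. by apply: sumr_ge0 => i _; rewrite addr_ge0// sqr_ge0. Qed.

Lemma sqn_cons n (z : T) (t : n.-tuple T) :
  sqn (tuple_cons (z, t)) = (z.1 ^+ 2 + z.2 ^+ 2) + sqn t.
Proof.
rewrite /sqn big_ord_recl; congr (_ + _); apply: eq_bigr => i _.
by rewrite !(tnth_nth (0, 0)).
Qed.

Lemma integral_pos_powR_plane (A : R) : A <= 1 ->
  (\int[plane]_z (pos_powR (A - (z.1 ^+ 2 + z.2 ^+ 2)))%:E <= (line_const ^+ 2 * pos_powR A)%:E)%E.
Proof.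
move=> A1.
have m1 : measurable_fun setT (fun z : T => (pos_powR (A - (z.1 ^+ 2 + z.2 ^+ 2)))%:E).
  apply/measurable_EFinP; apply: (measurableT_comp measurable_pos_powR).
  by apply: measurable_funB => //; apply: measurable_funD; apply: measurable_funX.
rewrite /lebesgue_plane (fubini_tonelli1 _ m1); last by move=> z; rewrite lee_fin pos_powR_ge0.
have mx : measurable_fun setT (fun x : R => (line_const%:E * (pos_powR (A - x ^+ 2))%:E)%E).
  apply: emeasurable_funM => //; apply/measurable_EFinP;
    apply: (measurableT_comp measurable_pos_powR).
  by apply: measurable_funB => //; exact: measurable_funX.
apply: (@le_trans _ _ (\int[leb]_x (line_const%:E * (pos_powR (A - x ^+ 2))%:E))%E).
  apply: ge0_le_integral => //.
  - by move=> x _; apply: integral_ge0 => y _; rewrite lee_fin pos_powR_ge0.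
  - by apply: measurable_fun_fubini_tonelli_F => // z; rewrite lee_fin pos_powR_ge0.
  - move=> x _; rewrite /fubini_F/= -EFinM.
    under eq_integral do rewrite opprD addrA.
    apply: integral_pos_powR_line.
    by rewrite lerBlDr (le_trans A1)// lerDl sqr_ge0.
have mx' : measurable_fun setT (fun x : R => (pos_powR (A - x ^+ 2))%:E).
  apply/measurable_EFinP; apply: (measurableT_comp measurable_pos_powR).
  by apply: measurable_funB => //; exact: measurable_funX.
have l0 : (0 <= line_const%:E)%E by rewrite lee_fin line_const_ge0.
rewrite (@ge0_integralZl _ _ _ leb _ measurableT _ mx')//; last first.
  by move=> x _; rewrite lee_fin pos_powR_ge0.
have -> : ((line_const ^+ 2 * pos_powR A)%:E = line_const%:E * (line_const * pos_powR A)%:E)%E.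
  by rewrite -EFinM mulrA -expr2.
by apply: lee_wpmul2l => //; exact: integral_pos_powR_line.
Qed.

(** Integrating one coordinate at a time; [A - |z|^2] stays at most 1. *)
Lemma integral_pos_powR_power n (A : R) : A <= 1 ->
  (\int[power_measure plane n]_t (pos_powR (A - sqn t))%:E <=
   (line_const ^+ (2 * n) * pos_powR A)%:E)%E.
Proof.
have mt k B : measurable_fun setT (fun t : k.-tuple T => (pos_powR (B - sqn t))%:E).
  apply/measurable_EFinP; apply: (measurableT_comp measurable_pos_powR).
  by apply: measurable_funB => //; exact: measurable_sqn.
elim: n A => [|n ih] A A1.
  rewrite integral_power_measure0//.
  by rewrite muln0 expr0 mul1r /sqn big_ord0 subr0.
have e : @tuple_cons _ T n @^-1` setT = setT `*` setT by rewrite preimage_setT setXTT.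
rewrite (integral_power_measureS measurableT measurableT measurableT e)//; last first.
  by move=> t; rewrite lee_fin pos_powR_ge0.
pose g (z : T) := A - (z.1 ^+ 2 + z.2 ^+ 2).
have mg : measurable_fun setT g.
  by apply: measurable_funB => //; apply: measurable_funD; apply: measurable_funX.
have gE (z : T) (t : n.-tuple T) : A - sqn (tuple_cons (z, t)) = g z - sqn t.
  by rewrite sqn_cons opprD addrA.
have l0 : 0 <= line_const ^+ (2 * n) by rewrite exprn_ge0// line_const_ge0.
have mtg : measurable_fun setT (fun z : T => (pos_powR (g z))%:E).
  by apply/measurable_EFinP; exact: (measurableT_comp measurable_pos_powR).
have mtg2 : measurable_fun setT (fun z : T * n.-tuple T => (pos_powR (g z.1 - sqn z.2))%:E).
  apply/measurable_EFinP; apply: (measurableT_comp measurable_pos_powR).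
  apply: measurable_funB; first exact: (measurableT_comp mg).
  exact: (measurableT_comp (@measurable_sqn n)).
apply: (@le_trans _ _ (\int[plane]_z ((line_const ^+ (2 * n))%:E * (pos_powR (g z))%:E))%E).
  apply: ge0_le_integral => //.
  - by move=> z _; apply: integral_ge0 => t _; rewrite lee_fin pos_powR_ge0.
  - under eq_fun do under eq_integral do rewrite gE.
    have := @measurable_fun_fubini_tonelli_F _ _ _ _ _ (power_measure plane n) _ mtg2.
    by apply => z; rewrite lee_fin pos_powR_ge0.
  - by apply: emeasurable_funM.
  - move=> z _; under eq_integral do rewrite gE.
    rewrite -EFinM; apply: ih.
    by rewrite /g lerBlDr (le_trans A1)// lerDl addr_ge0// sqr_ge0.
rewrite ge0_integralZl ?lee_fin//; last by move=> z _; rewrite lee_fin pos_powR_ge0.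
have -> : ((line_const ^+ (2 * n.+1) * pos_powR A)%:E =
    (line_const ^+ (2 * n))%:E * (line_const ^+ 2 * pos_powR A)%:E)%E.
  by rewrite -EFinM mulrA -exprD mulnS addnC.
by apply: lee_wpmul2l; rewrite ?lee_fin//; exact: integral_pos_powR_plane.
Qed.

End truncated_power.

(** * The ball and its weighted integrals *)

Section ball_geometry.
Context {R : realType}.
Variable N : nat.
Local Notation C := (complex_field R).
Local Notation CN := 'rV[C]_N.
Local Notation T := (measurableTypeR R * measurableTypeR R)%type.
Local Notation plane := (@lebesgue_plane R).
Local Notation toC := (@to_CN R N).

Lemma euclid_norm_vec (t : N.-tuple T) : euclid_norm (toC t) = Num.sqrt (sqn t).
Proof.
rewrite /euclid_norm /sqn; congr Num.sqrt; apply: eq_bigr => i _.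
by rewrite mxE /= sqr_sqrtr// addr_ge0// sqr_ge0.
Qed.

Lemma euclid_norm_sqr (t : N.-tuple T) : euclid_norm (toC t) ^+ 2 = sqn t.
Proof. by rewrite euclid_norm_vec sqr_sqrtr// sqn_ge0. Qed.

Lemma euclid_norm_ge0 (z : CN) : 0 <= euclid_norm z.
Proof. exact: sqrtr_ge0. Qed.

Definition of_CN (z : CN) : N.-tuple T := [tuple (complex.Re (z 0 i), complex.Im (z 0 i)) | i < N].

Lemma of_CNK : cancel of_CN toC.
Proof. by move=> z; apply/rowP => i; rewrite !mxE tnth_mktuple/=; case: (z 0 i). Qed.

Lemma ball_preimage : toC @^-1` (@unit_ball R N) = [set t | sqn t < 1].
Proof.
apply/seteqP; split => t; rewrite /unit_ball /= euclid_norm_vec => h.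
  by rewrite -(@ltr_sqrt _ _ 1)// sqrtr1.
by rewrite -sqrtr1 ltr_sqrt.
Qed.

Lemma measurable_ball : measurable (toC @^-1` (@unit_ball R N)).
Proof.
rewrite ball_preimage -[X in measurable X]setTI.
have -> : [set t : N.-tuple T | sqn t < 1] = (@sqn R N) @^-1` `]-oo, 1[%classic.
  by apply/seteqP; split => t /=; rewrite in_itv.
by apply: measurable_sqn => //; exact: measurable_itv.
Qed.

Lemma sqr_growth (a t r : R) : `|t - a| <= r -> 0 <= r ->
  t ^+ 2 <= a ^+ 2 + 2 * r * `|a| + r ^+ 2.
Proof.
move=> ta r0; have : `|t| <= `|a| + r.
  have -> : t = a + (t - a) by ring.
  by apply: (le_trans (ler_normD _ _)); rewrite lerD2l.
move=> h; rewrite -(real_normK (num_real t)) -(real_normK (num_real a)).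
have := normr_ge0 t; have := normr_ge0 a; nra.
Qed.

(** Comparing squares coordinate by coordinate avoids the triangle inequality of the
Euclidean norm. *)
Lemma euclid_norm_box (a t : N.-tuple T) r : 0 <= r -> box a r t ->
  euclid_norm (toC t) <= euclid_norm (toC a) + 2 * N%:R * r.
Proof.
move=> r0 bt; set e := euclid_norm (toC a).
have e0 : 0 <= e by exact: euclid_norm_ge0.
have s0 : 0 <= e + 2 * N%:R * r by rewrite addr_ge0// !mulr_ge0.
rewrite -(@ler_sqr _ _ (e + _)) ?nnegrE ?euclid_norm_ge0// euclid_norm_sqr.
have ae (i : 'I_N) : (tnth a i).1 ^+ 2 + (tnth a i).2 ^+ 2 <= e ^+ 2.
  rewrite /e euclid_norm_sqr /sqn (bigD1 i)//= lerDl.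
  by apply: sumr_ge0 => j _; rewrite addr_ge0// sqr_ge0.
have a1 (i : 'I_N) : `|(tnth a i).1| <= e.
  rewrite -(@ler_sqr _ _ e) ?nnegrE// real_normK ?num_real//.
  by apply: le_trans (ae i); rewrite lerDl sqr_ge0.
have a2 (i : 'I_N) : `|(tnth a i).2| <= e.
  rewrite -(@ler_sqr _ _ e) ?nnegrE// real_normK ?num_real//.
  by apply: le_trans (ae i); rewrite lerDr sqr_ge0.
apply: (@le_trans _ _ (\sum_(i < N) (((tnth a i).1 ^+ 2 + (tnth a i).2 ^+ 2) +
  (4 * r * e + 2 * r ^+ 2)))).
  apply: ler_sum => i _; have [] := bt i; rewrite /= !in_itv/= => h1 h2.
  have {}h1 : `|(tnth t i).1 - (tnth a i).1| <= r by rewrite ler_distl.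
  have {}h2 : `|(tnth t i).2 - (tnth a i).2| <= r by rewrite ler_distl.
  have := sqr_growth h1 r0; have := sqr_growth h2 r0.
  have k1 := ler_wpM2l r0 (a1 i); have k2 := ler_wpM2l r0 (a2 i); lra.
rewrite big_split/= sumr_const card_ord -[X in X + _]/(sqn a) -euclid_norm_sqr -/e.
rewrite -[_ *+ N]mulr_natr.
have [->|N0] := eqVneq N 0%N; first by rewrite !mulr0 mul0r !addr0.
have N1 : 1 <= N%:R :> R by rewrite ler1n lt0n.
have NN : N%:R <= N%:R ^+ 2 :> R by rewrite expr2 ler_peMl.
have := ler_wpM2r (sqr_ge0 r) NN.
have := sqr_ge0 r; have : 0 <= N%:R * r ^+ 2 by rewrite mulr_ge0// sqr_ge0.
rewrite !expr2; nra.
Qed.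

Section integrals.
Variable alpha : R.
Hypothesis halpha : -1 < alpha.

Definition density (t : N.-tuple T) : R := (1 - euclid_norm (toC t) ^+ 2) `^ alpha.

Lemma measurable_density : measurable_fun setT density.
Proof.
rewrite (_ : density = (fun x => x `^ alpha) \o (fun t => 1 - sqn t)); last first.
  by apply/funext => t; rewrite /density euclid_norm_sqr.
apply: (measurableT_comp (@measurable_powR R alpha)).
by apply: measurable_funB => //; exact: measurable_sqn.
Qed.

Lemma density_ge0 t : 0 <= density t.
Proof. exact: powR_ge0. Qed.

Lemma weighted_integralE (g : CN -> R) :
  weighted_integral alpha g =
  (\int[power_measure plane N]_(t in toC @^-1` (@unit_ball R N)) (g (toC t) * density t)%:E)%E.
Proof. by []. Qed.

Lemma exists_small_root : exists m : nat, ((2 ^ m)%:R)^-1 < alpha + 1.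
Proof.
have a1 : 0 < alpha + 1 by rewrite -ltrBlDr sub0r.
exists (Num.bound (alpha + 1)^-1).
rewrite invf_plt ?posrE ?ltr0n ?expn_gt0//.
apply: (@lt_trans _ _ (Num.bound (alpha + 1)^-1)%:R).
  by apply: archi_boundP; rewrite invr_ge0 ltW.
by rewrite ltr_nat ltn_expl.
Qed.

(** [1 - |z|^2 <= 2 (1 - |z|)] turns the root into a negative power of [1 - |z|^2].
The constant [K] is independent of [g], [M] and [L]. *)
Lemma weighted_integral_root (m : nat) (e := ((2 ^ m)%:R)^-1 : R) : e < alpha + 1 ->
  exists2 K, 0 <= K & forall (g : CN -> R) (M L : R), 0 <= M -> 0 <= L ->
    measurable_fun (toC @^-1` (@unit_ball R N)) (fun t => g (toC t)) ->
    (forall z, unit_ball z -> 0 <= g z <= L * (M + (1 / (1 - euclid_norm z)) `^ e)) ->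
    (weighted_integral alpha g <= (L * (M + 2) * K)%:E)%E.
Proof.
(* Lowering the exponent enlarges the powers of 1 - |z|^2 <= 1, so it may be taken negative. *)
move=> ea; pose beta := Num.min (alpha - e) (- 2^-1).
have e0 : 0 < e by rewrite invr_gt0 ltr0n expn_gt0.
have e1 : e <= 1 by rewrite invf_le1 ?ltr0n ?expn_gt0// ler1n expn_gt0.
have bN1 : -1 < beta by rewrite lt_min; apply/andP; split; lra.
have b0 : beta < 0 by rewrite /beta gt_min; apply/orP; right; lra.
have K0 : 0 <= line_const beta ^+ (2 * N) by rewrite exprn_ge0// line_const_ge0.
exists (line_const beta ^+ (2 * N)) => // g M L M0 L0 mg hg.
rewrite weighted_integralE.
have mB := measurable_ball.
have mt : measurable_fun setT (fun t : N.-tuple T => (pos_powR beta (1 - sqn t))%:E).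
  apply/measurable_EFinP; apply: (measurableT_comp (measurable_pos_powR beta)).
  by apply: measurable_funB => //; exact: measurable_sqn.
have LM0 : 0 <= L * (M + 2) by rewrite mulr_ge0// addr_ge0.
have t0 x : (0 <= (pos_powR beta x)%:E)%E by rewrite lee_fin pos_powR_ge0.
apply: (@le_trans _ _ (\int[power_measure plane N]_(t in toC @^-1` (@unit_ball R N)) ((L *
  (M + 2))%:E * (pos_powR beta (1 - sqn t))%:E))%E).
  apply: ge0_le_integral => //.
  - move=> t tB; have /andP[g0 _] := hg _ tB.
    by rewrite lee_fin mulr_ge0// density_ge0.
  - apply/measurable_EFinP; apply: measurable_funM => //.
    by apply: measurable_funS measurable_density.
  - by apply: emeasurable_funM => //; apply: measurable_funS mt.
  move=> t tB; rewrite -EFinM lee_fin.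
  have tB' : euclid_norm (toC t) < 1 by exact: tB.
  have n0 := euclid_norm_ge0 (toC t).
  have /andP[g0 gle] := hg _ tB.
  rewrite /density euclid_norm_sqr -/(_ - _).
  have := tB; rewrite ball_preimage/= => sq1.
  have := sqn_ge0 t; move: sq1; rewrite -euclid_norm_sqr; set n := euclid_norm _ in tB' n0 gle *.
  move=> sq1 sq0; pose u := 1 - n ^+ 2.
  have u0 : 0 < u by rewrite subr_gt0.
  have u1 : u <= 1 by rewrite gerBl.
  rewrite -/u /pos_powR u0.
  apply: (@le_trans _ _ (L * (M + (1 / (1 - n)) `^ e) * u `^ alpha)).
    by rewrite ler_wpM2r// powR_ge0.
  rewrite -!mulrA ler_wpM2l// [leLHS]mulrDl [leRHS]mulrDl.
  have un : u = (1 - n) * (1 + n) by rewrite /u; ring.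
  have n1 : 0 < 1 - n by rewrite subr_gt0.
  apply: lerD.
    rewrite ler_wpM2l//; apply: ger_powR; rewrite ?u0//.
    by rewrite /beta ge_min; apply/orP; left; lra.
  have s2 : 1 / (1 - n) <= 2 * u^-1.
    rewrite un invfM mul1r mulrCA ler_pMr ?invr_gt0//.
    rewrite ler_pdivlMr ?mul1r; lra.
  apply: (@le_trans _ _ ((2 * u^-1) `^ e * u `^ alpha)).
    rewrite ler_wpM2r ?powR_ge0//; apply: ge0_ler_powR; rewrite ?nnegrE ?(ltW e0)//.
      by rewrite divr_ge0// ltW.
    by rewrite mulr_ge0// invr_ge0 ltW.
  have -> : (2 * u^-1) `^ e = 2 `^ e * u^-1 `^ e by rewrite powRM// invr_ge0 ltW.
  rewrite -mulrA; apply: ler_pM.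
  - exact: powR_ge0.
  - by rewrite mulr_ge0// powR_ge0.
  - by rewrite -[leRHS]powRr1//; apply: ler_powR => //; rewrite ler1n.
  rewrite -[u^-1]powR_inv1 ?(ltW u0)// -powRrM mulN1r -powRD; last first.
    by rewrite (gt_eqF u0) implybT.
  by apply: ger_powR; rewrite ?u0// /beta ge_min; apply/orP; left; lra.
have mtB := measurable_funS measurableT (@subsetT _ _) mt.
rewrite (@ge0_integralZl _ _ _ _ _ mB _ (mtB _))//.
rewrite [leRHS]EFinM; apply: lee_wpmul2l; first by rewrite lee_fin.
apply: (@le_trans _ _ (\int[power_measure plane N]_t (pos_powR beta (1 - sqn t))%:E)%E).
  exact: ge0_subset_integral.
apply: le_trans (integral_pos_powR_power bN1 b0 N (lexx 1)) _.
by rewrite lee_fin /pos_powR ltr01 powR1 mulr1.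
Qed.

End integrals.
End ball_geometry.

(** * Integrability against growth *)

Section embeddings.
Context {R : realType}.
Variable N : nat.
Hypothesis N1 : (1 <= N)%N.
Local Notation C := (complex_field R).
Local Notation CN := 'rV[C]_N.
Local Notation T := (measurableTypeR R * measurableTypeR R)%type.
Local Notation plane := (@lebesgue_plane R).
Local Notation toC := (@to_CN R N).
Local Notation ball := (toC @^-1` (@unit_ball R N)).
Variable alpha : R.
Hypothesis halpha : -1 < alpha.

Let N0 : 0 < N%:R :> R. Proof. by rewrite ltr0n. Qed.

Section box_in_ball.
Variables (a : N.-tuple T).
Hypothesis aball : unit_ball (toC a).
Let e := euclid_norm (toC a).
Let r := (1 - e) / (4 * N%:R).

Let e1 : 0 < 1 - e. Proof. by rewrite subr_gt0. Qed.
Let r0 : 0 < r. Proof. by rewrite divr_gt0// mulr_gt0. Qed.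

Lemma box_norm_le t : box a r t -> euclid_norm (toC t) <= (1 + e) / 2.
Proof.
move=> bt; apply: (le_trans (euclid_norm_box (ltW r0) bt)); rewrite -/e.
have -> : 2 * N%:R * r = (1 - e) / 2 by rewrite /r; field; rewrite gt_eqF.
lra.
Qed.

Lemma box_sub_ball : box a r `<=` ball.
Proof. by move=> t /box_norm_le h; apply: (le_lt_trans h); move: e1; lra. Qed.

(** On the box [1 - |z|] is at least [(1 - |a|) / 2]; a natural exponent
[p >= alpha] serves both signs of [alpha], as [1 - |z|^2] lies in [[0, 1]]. *)
Lemma weighted_integral_box (p : nat) (g : CN -> R) : alpha <= p%:R ->
  measurable_fun ball (fun t => g (toC t)) ->
  (forall z, unit_ball z -> 0 <= g z) ->
  ((((1 - e) / 2) ^+ p)%:E * \int[power_measure plane N]_(t in box a r) (g (toC t))%:E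
    <= weighted_integral alpha g)%E.
Proof.
move=> ap mg g0; rewrite weighted_integralE.
have mB := measurable_box a r; have mb := @measurable_ball R N.
have mgB : measurable_fun (box a r) (fun t => (g (toC t))%:E).
  by apply/measurable_EFinP; apply: measurable_funS mg => //; exact: box_sub_ball.
have md : measurable_fun ball (fun t => (g (toC t) * density alpha t)%:E).
  apply/measurable_EFinP; apply: measurable_funM => //.
  by apply: measurable_funS (measurable_density alpha).
have d0 : 0 <= ((1 - e) / 2) ^+ p by rewrite exprn_ge0// divr_ge0// ltW.
rewrite -(@ge0_integralZl _ _ _ _ _ mB _ mgB); first last.
- by rewrite lee_fin.
- by move=> t bt; rewrite lee_fin; apply: g0; exact: box_sub_ball.
apply: (@le_trans _ _ (\int[power_measure plane N]_(t in box a r) (g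
  (toC t) * density alpha t)%:E)%E); last first.
  apply: ge0_subset_integral => //; last exact: box_sub_ball.
  by move=> t tB; rewrite lee_fin mulr_ge0 ?g0// density_ge0.
apply: ge0_le_integral => //.
- by move=> t bt; apply: mule_ge0; rewrite lee_fin//; apply: g0; exact: box_sub_ball.
- exact: emeasurable_funM.
- by apply: measurable_funS md => //; exact: box_sub_ball.
move=> t bt; rewrite -EFinM lee_fin mulrC ler_wpM2l//; first by apply: g0; exact: box_sub_ball.
have h := box_norm_le bt; have n0 := euclid_norm_ge0 (toC t).
rewrite /density; set n := euclid_norm (toC t) in h n0 *.
have u : (1 - e) / 2 <= 1 - n ^+ 2.
  have n1 : n <= 1 by move: e1; lra.
  have : n ^+ 2 <= n by rewrite expr2 ler_piMr.
  lra.
have u0 : 0 < 1 - n ^+ 2 by apply: lt_le_trans u; rewrite divr_gt0.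
have u1 : 1 - n ^+ 2 <= 1 by rewrite gerBl sqr_ge0.
apply: (@le_trans _ _ ((1 - n ^+ 2) `^ p%:R)); last first.
  by apply: ger_powR; rewrite ?u0.
by rewrite powR_mulrn ?(ltW u0)//; apply: lerXn2r => //; rewrite nnegrE ?(ltW u0)// divr_ge0// ltW.
Qed.

Lemma mass_box : power_measure plane N (box a r) = ((2 * r) ^+ (2 * N))%:E.
Proof. exact: power_measure_box. Qed.

End box_in_ball.

Lemma natural_above : exists p : nat, alpha <= p%:R.
Proof. by exists (Num.bound `|alpha|); rewrite (le_trans (ler_norm _))// ltW// archi_boundP. Qed.

(** Finiteness is the convergence of the integral at the boundary; positivity is the
lower bound on a box around the origin. *)
Lemma weighted_mass : exists2 W, 0 < W & weighted_integral (N := N) alpha (fun=> 1%R) = W%:E.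
Proof.
have mc : measurable_fun ball (fun t => (fun=> 1 : R) (toC t)) by exact: measurable_cst.
have [m ma] := exists_small_root halpha.
have [K K0 /(_ (fun=> 1) 1 1 ler01 ler01 mc) HK] := weighted_integral_root N ma.
have fin : (weighted_integral (N := N) alpha (fun=> 1%R) < +oo)%E.
  apply: le_lt_trans (HK _) (ltry _) => z _.
  by rewrite ler01 mul1r lerDl powR_ge0.
have [p ap] := natural_above.
pose a := of_CN (0 : CN).
have a0 : euclid_norm (toC a) = 0.
  rewrite of_CNK /euclid_norm big1 ?sqrtr0// => i _.
  by rewrite mxE -[normc _]/(normc 0) normc0 expr0n.
have ab : unit_ball (toC a) by rewrite /unit_ball/= a0.
have := weighted_integral_box ab ap mc (fun _ _ => ler01).
rewrite integral_cst; last exact: measurable_box.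
rewrite mul1e -[X in (_ * X <= _)%E]/(power_measure plane N _) (mass_box ab) a0 !subr0 -EFinM.
set c := (X in X%:E); have c0 : 0 < c.
  apply: mulr_gt0; apply: exprn_gt0; first by rewrite divr_gt0.
  by apply: mulr_gt0 => //; apply: divr_gt0 => //; exact: mulr_gt0.
move=> cW; exists (fine (weighted_integral (N := N) alpha (fun=> 1%R))).
  by apply: fine_gt0; rewrite fin andbT; apply: lt_le_trans cW; rewrite lte_fin.
by rewrite fineK// ge0_fin_numE//; apply: le_trans cW; rewrite lee_fin ltW.
Qed.

Lemma integral_vE : exists2 W, 0 < W & forall g : CN -> R,
  integral_v alpha g = (W^-1%:E * weighted_integral alpha g)%E.
Proof.
have [W W0 WE] := weighted_mass; exists W => // g.
by rewrite /integral_v /normalizing_constant WE.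
Qed.

Variable psi : R -> R.
Hypothesis hpsi : orlicz_function psi.
Hypothesis hD2 : Delta2_condition psi.

Section holomorphic_function.
Variable f : CN -> C.
Hypothesis hf : holomorphic f.
Variable c : R.
Hypothesis c0 : 0 < c.

Lemma measurable_orlicz : measurable_fun ball (fun t => psi (normc (f (toC t)) / c)).
Proof.
rewrite (_ : (fun t => _) = (fun x => psi `|x|) \o (fun t : N.-tuple T =>
  normc (f (vec N ([::] ++ t))) / c)); last first.
  by apply/funext => t /=; rewrite to_CN_vec ger0_norm//; apply: divr_ge0;
    [exact: normc_ge0|exact: ltW].
apply: measurableT_comp.
  by apply: continuous_measurable_fun; exact: orlicz_abs_continuous.
apply: measurable_funM => //.
apply: measurable_box_fun; first exact: measurable_ball.
  exact: normc_dist.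
by move=> t tB; apply: hf; rewrite /= -to_CN_vec.
Qed.

Lemma psi_ge0 (z : CN) : 0 <= psi (normc (f z) / c).
Proof. by apply: (orlicz_ge0 hpsi); apply: divr_ge0; [exact: normc_ge0|exact: ltW]. Qed.

End holomorphic_function.

(** The box around [z] has size comparable to [1 - |z|], so its volume and the density
on it are bounded below by powers of [1 - |z|]. *)
Lemma pointwise_estimate : exists K q, 0 < K /\ forall f c (z : CN),
  holomorphic f -> 0 < c -> unit_ball z ->
  ((psi (normc (f z) / (2 * 64 ^+ N * c)))%:E <=
   (K * (1 / (1 - euclid_norm z)) ^+ q)%:E * orlicz_integral alpha psi f c)%E.
Proof.
have [W W0 WE] := integral_vE; have [p ap] := natural_above.
exists ((2 * N%:R) ^+ (2 * N) * 2 ^+ p * W), (2 * N + p)%N; split.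
  by rewrite !mulr_gt0// exprn_gt0// mulr_gt0.
move=> f c z hf c0 zb; pose a := of_CN z.
have za : toC a = z by exact: of_CNK.
have ab : unit_ball (toC a) by rewrite za.
rewrite /orlicz_integral WE.
have := weighted_integral_box ab ap (measurable_orlicz hf c0) (fun z _ => psi_ge0 f c0 z).
rewrite za; set e := euclid_norm z; set r := (1 - e) / (4 * N%:R).
have e1 : 0 < 1 - e by rewrite subr_gt0.
have r0 : 0 < r by rewrite divr_gt0// mulr_gt0.
have df s : all2 (in_square r) a s -> differentiable f (vec N s).
  move=> as'; have ss : size s == N by move: as'; rewrite all2E size_tuple => /andP[/eqP <-].
  apply: hf; rewrite -[s]/(tval (Tuple ss)) -to_CN_vec.
  suff : box a ((1 - euclid_norm (toC a)) / (4 * N%:R)) (Tuple ss) by exact: (box_sub_ball ab).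
  rewrite za -/e -/r => i; move: as'; rewrite all2E => /andP[_ /(all_nthP ((0, 0), (0, 0))) h].
  have := h i; rewrite size_zip size_tuple (eqP ss) minnn => /(_ (ltn_ord i)).
  rewrite nth_zip ?size_tuple ?(eqP ss)//= => /andP[h1 h2].
  by rewrite !(tnth_nth (0, 0)); split.
have := box_mean_orlicz r0 df hpsi c0.
rewrite -to_CN_vec za => h1.
under eq_integral do rewrite to_CN_vec.
set J := (\int[_]_(_ in _) _)%E in h1 *; set WI := weighted_integral _ _ => h2.
set P := psi _ in h1 *.
have d0 : 0 < ((1 - e) / 2) ^+ p by rewrite exprn_gt0// divr_gt0.
have v0 : 0 < (2 * r) ^+ (2 * N) by rewrite exprn_gt0// mulr_gt0.
have h3 : ((((1 - e) / 2) ^+ p * (P * (2 * r) ^+ (2 * N)))%:E <= WI)%E.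
  by rewrite EFinM; apply: le_trans h2; rewrite lee_wpmul2l ?lee_fin ?(ltW d0).
rewrite muleA -EFinM.
have -> : (2 * N%:R) ^+ (2 * N) * 2 ^+ p * W * (1 / (1 - e)) ^+ (2 * N + p) / W =
    (((1 - e) / 2) ^+ p * (2 * r) ^+ (2 * N))^-1.
  rewrite mulrAC mulfK ?gt_eqF// exprD.
  have -> : 2 * r = (1 - e) / (2 * N%:R) by rewrite /r; field; rewrite gt_eqF.
  rewrite !expr_div_n !expr1n !invfM !invrK mul1r.
  rewrite mul1r; ring.
rewrite lee_pdivlMl ?mulr_gt0//.
by rewrite -EFinM -mulrA (mulrC _ P).
Qed.

Lemma inv1_gt0 : 0 < orlicz_inv psi 1.
Proof. exact: orlicz_inv_gt0. Qed.

Lemma weight_inv (z : CN) : unit_ball z ->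
  exists y, [/\ orlicz_weight N psi z = y^-1, orlicz_inv psi 1 <= y, 0 < y &
    psi y = 1 / (1 - euclid_norm z)].
Proof.
move=> zb; have e1 : 0 < 1 - euclid_norm z by rewrite subr_gt0.
have s0 : 0 < 1 / (1 - euclid_norm z) by rewrite divr_gt0.
exists (orlicz_inv psi (1 / (1 - euclid_norm z))); split => //.
- apply: (orlicz_le_inv hpsi); first by rewrite orlicz_inv_ge0// ltW.
  rewrite !orlicz_invK ?(ltW s0)// ler_pdivlMr// mul1r gerBl.
  exact: euclid_norm_ge0.
- exact: orlicz_inv_gt0.
- by rewrite orlicz_invK// ltW.
Qed.

(** [B] depends on the bound [I] but neither on [f] nor on [c]: with [I = 1] this is
one half of the equivalence of norms. *)
Lemma growth_of_integral (I : R) : 0 <= I -> exists2 B, 0 < B & forall f c,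
  holomorphic f -> 0 < c -> (orlicz_integral alpha psi f c <= I%:E)%E ->
  forall z : CN, unit_ball z -> normc (f z) * orlicz_weight N psi z <= B * c.
Proof.
move=> I0; have [K [q [K0 hK]]] := pointwise_estimate.
have p1 : 1 <= psi (orlicz_inv psi 1) by rewrite orlicz_invK.
have [B B1 hB] := Delta2_power_le hpsi hD2 (K * I) q inv1_gt0 p1.
have A0 : 0 < 2 * 64 ^+ N :> R by rewrite mulr_gt0// exprn_gt0.
have B0 : 0 < B by exact: lt_le_trans B1.
exists (B * (2 * 64 ^+ N)); first by rewrite mulr_gt0.
move=> f c hf c0 fI z zb; have [y [-> y1 y0 py]] := weight_inv zb.
rewrite ler_pdivrMr//.
have := hK f c z hf c0 zb; rewrite -py => h.
have Kq : 0 <= K * psi y ^+ q.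
  by rewrite mulr_ge0 ?(ltW K0)// exprn_ge0// (orlicz_ge0 hpsi) ?(ltW y0).
have {}h : psi (normc (f z) / (2 * 64 ^+ N * c)) <= psi (B * y).
  apply: le_trans (hB _ y1); rewrite -lee_fin; apply: (le_trans h).
  rewrite mulrAC [leRHS]EFinM; apply: lee_wpmul2l => //.
have := orlicz_le_inv hpsi (mulr_ge0 (ltW B0) (ltW y0)) h.
rewrite ler_pdivrMr ?mulr_gt0// => /le_trans; apply.
by rewrite le_eqVlt; apply/orP; left; apply/eqP; ring.
Qed.

(** Near the boundary the value of the integral is itself absorbed by one more factor
[1 / (1 - |z|)], so the constant in front of [c] does not depend on [c]. *)
Lemma little_growth_of_integral (f : CN -> C) : holomorphic f ->
  (forall c, 0 < c -> (orlicz_integral alpha psi f c < +oo)%E) ->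
  forall e, 0 < e -> exists2 d, 0 < d & forall z : CN, unit_ball z ->
    1 - euclid_norm z < d -> normc (f z) * orlicz_weight N psi z < e.
Proof.
move=> hf fI e e0; have [K [q [K0 hK]]] := pointwise_estimate.
have p1 : 1 <= psi (orlicz_inv psi 1) by rewrite orlicz_invK.
have [B B1 hB] := Delta2_power_le hpsi hD2 1 q.+1 inv1_gt0 p1.
have A0 : 0 < 2 * 64 ^+ N :> R by rewrite mulr_gt0// exprn_gt0.
have B0 : 0 < B by exact: lt_le_trans B1.
(* The bound below is B * (2 * 64 ^+ N) * c, half of e. *)
pose c := e / (2 * (B * (2 * 64 ^+ N))).
have c0 : 0 < c by rewrite divr_gt0// !mulr_gt0.
have := fI c c0; have : (0 <= orlicz_integral alpha psi f c)%E.
  have [W W0 WE] := integral_vE; rewrite /orlicz_integral WE.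
  apply: mule_ge0; first by rewrite lee_fin invr_ge0 ltW.
  rewrite weighted_integralE; apply: integral_ge0 => t _; rewrite lee_fin.
  by apply: mulr_ge0; [exact: psi_ge0|exact: density_ge0].
case: (orlicz_integral alpha psi f c) (hK f c) => [I| |]// hI I0 _; rewrite lee_fin in I0.
have KI1 : 0 < K * I + 1 by rewrite ltr_wpDl// mulr_ge0// ltW.
exists (K * I + 1)^-1; first by rewrite invr_gt0.
move=> z zb zd; have [y [-> y1 y0 py]] := weight_inv zb.
rewrite ltr_pdivrMr//.
have := hI z hf c0 zb; rewrite -py -EFinM lee_fin => h.
have e1 : 0 < 1 - euclid_norm z by rewrite subr_gt0.
have KIp : K * I <= psi y.
  rewrite py ler_pdivlMr//; move: zd; rewrite -[_^-1]mul1r ltr_pdivlMr// => zd.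
  have : 0 <= 1 - euclid_norm z by exact: ltW.
  nra.
have py0 : 0 <= psi y by apply: (orlicz_ge0 hpsi); exact: ltW.
have {}h : psi (normc (f z) / (2 * 64 ^+ N * c)) <= psi (B * y).
  apply: le_trans (hB _ y1); apply: (le_trans h).
  by rewrite mulrAC mul1r exprS ler_wpM2r// exprn_ge0.
have := orlicz_le_inv hpsi (mulr_ge0 (ltW B0) (ltW y0)) h.
rewrite ler_pdivrMr; last exact: mulr_gt0.
move=> /le_lt_trans; apply.
have -> : B * y * (2 * 64 ^+ N * c) = e / 2 * y.
  by rewrite /c; field; rewrite !gt_eqF// exprn_gt0.
by rewrite ltr_pM2r// ltr_pdivrMr// ltr_pMr// ltr1n.
Qed.

(** The additive [M] leaves room for the values of a function far from the boundary. *)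
Lemma integral_of_bound : exists B C1, [/\ 1 <= B, 0 <= C1 &
  forall f c L M, holomorphic f -> 0 < c -> 0 <= L -> 0 <= M ->
   (forall z : CN, unit_ball z -> psi (normc (f z) / c) <=
      L * (M + psi (orlicz_inv psi (1 / (1 - euclid_norm z)) / B))) ->
   (orlicz_integral alpha psi f c <= (L * (M + C1) * C1)%:E)%E].
Proof.
have [m ma] := exists_small_root halpha.
have [K K0 HK] := weighted_integral_root N ma.
have [B [M0 [B1 M00 hB]]] := Delta2_root_le hpsi hD2 m.
have [W W0 WE] := integral_vE.
exists B, (M0 + 2 + K / W); split => //.
  by rewrite !addr_ge0// divr_ge0// ltW.
move=> f c L M hf c0 L0 M0' hfz; rewrite /orlicz_integral WE.
have := HK (fun z => psi (normc (f z) / c)) (M + M0) L (addr_ge0 M0' M00) L0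
  (measurable_orlicz hf c0).
have hz z : unit_ball z -> 0 <= psi (normc (f z) / c) <=
    L * (M + M0 + (1 / (1 - euclid_norm z)) `^ ((2 ^ m)%:R)^-1).
  move=> zb; rewrite psi_ge0//=; apply: (le_trans (hfz z zb)).
  rewrite ler_wpM2l// -addrA lerD2l.
  have e1 : 0 < 1 - euclid_norm z by rewrite subr_gt0.
  have s0 : 0 <= 1 / (1 - euclid_norm z) by rewrite divr_ge0// ltW.
  have := hB _ (orlicz_inv_ge0 hpsi s0); rewrite orlicz_invK//.
move=> /(_ hz) h.
apply: (@le_trans _ _ (W^-1%:E * (L * (M + M0 + 2) * K)%:E)%E).
  by apply: lee_wpmul2l => //; rewrite lee_fin invr_ge0 ltW.
rewrite -EFinM lee_fin.
have -> : W^-1 * (L * (M + M0 + 2) * K) = L * (M + M0 + 2) * (K / W) by ring.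
have KW : 0 <= K / W by rewrite divr_ge0// ltW.
apply: ler_pM => //.
- by rewrite mulr_ge0// !addr_ge0.
- by rewrite ler_wpM2l//; lra.
- lra.
Qed.

(** Convexity, [psi (x / L) <= psi x / L], brings the integral below 1. *)
Lemma integral_of_growth : exists2 D, 0 < D & forall (f : CN -> C) M, holomorphic f -> 0 < M ->
  (forall z, unit_ball z -> normc (f z) * orlicz_weight N psi z <= M) ->
  (orlicz_integral alpha psi f (D * M) <= 1)%E.
Proof.
have [B [C1 [B1 C10 hB]]] := integral_of_bound.
have B0 : 0 < B by exact: lt_le_trans B1.
pose L := C1 * C1 + 1.
have L1 : 1 <= L by rewrite lerDr mulr_ge0.
have L0 : 0 < L by exact: lt_le_trans L1.
exists (B * L); first by rewrite mulr_gt0.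
move=> f M hf M0 fM.
have c0 : 0 < B * L * M by rewrite !mulr_gt0.
have Li0 : 0 <= L^-1 by rewrite invr_ge0 ltW.
have Li1 : L^-1 <= 1 by rewrite invf_le1.
apply: (le_trans (hB f (B * L * M) L^-1 0 hf c0 Li0 (lexx 0) _)).
  move=> z zb; have := fM z zb; have [y [wE y1 y0 py]] := weight_inv zb.
  rewrite wE ler_pdivrMr// => fy; rewrite add0r.
  have -> : orlicz_inv psi (1 / (1 - euclid_norm z)) = y.
    by apply: invr_inj; rewrite -wE.
  have yB : 0 <= y / B by rewrite divr_ge0// ltW.
  apply: (@le_trans _ _ (psi (L^-1 * (y / B)))); last first.
    by apply: orlicz_scale => //; rewrite Li0.
  apply: (orlicz_le hpsi).
    by apply: divr_ge0; [exact: normc_ge0|exact: ltW].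
  rewrite ler_pdivrMr//; apply: (le_trans fy); rewrite le_eqVlt; apply/orP; left.
  by apply/eqP; field; rewrite !gt_eqF.
rewrite lee_fin add0r -mulrA mulrC ler_pdivrMr// mul1r /L lerDl //.
Qed.

End embeddings.

(** * Boundedness on smaller balls *)

Section compactness.
Context {R : realType}.
Variable N : nat.
Local Notation C := (complex_field R).
Local Notation CN := 'rV[C]_N.
Local Open Scope complex_scope.

Lemma compact_complex_square :
  compact [set w : C | `|complex.Re w| <= 1 /\ `|complex.Im w| <= 1].
Proof.
pose h (z : R * R) : C := z.1 +i* z.2.
have ch : continuous h.
  move=> z; apply: (@cvgrPdist_lt C C (R * R)%type (nbhs z) (nbhs_filter z) h (h z)).2 => e e0.
  have eE : e = (normc e)%:C by rewrite -normC_normc gtr0_norm.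
  have e20 : 0 < normc e / 2 by rewrite divr_gt0// -lt_realC -eE.
  exists (ball z.1 (normc e / 2), ball z.2 (normc e / 2)).
    by split; exact: nbhsx_ballx.
  move=> w [/= w1 w2]; rewrite normC_normc eE lt_realC.
  apply: (le_lt_trans (normc_le_ReIm _)); rewrite /h/= [ltRHS]splitr.
  exact: ltrD.
have -> : [set w : C | `|complex.Re w| <= 1 /\ `|complex.Im w| <= 1] =
    h @` (`[-1, 1] `*` `[-1, 1]).
  apply/seteqP; split => [w [w1 w2]|_ [z [z1 z2] <-]].
    exists (complex.Re w, complex.Im w); last by case: (w).
    by split; rewrite /= in_itv/= -ler_norml.
  by move: z1 z2; rewrite /= !in_itv/= -!ler_norml.
apply: continuous_compact; first exact: continuous_subspaceT.
by apply: compact_setX; exact: segment_compact.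
Qed.

Lemma euclid_norm_continuous : continuous (@euclid_norm R N).
Proof.
have add_cont : continuous (fun x : R * R => x.1 + x.2) by move=> x; exact: add_continuous.
have sum_cont : continuous (fun z : CN => \sum_(i < N) normc (z 0 i) ^+ 2).
  apply: (continuous_big add_cont) => i _ z.
  have c : {for z, continuous (fun z : CN => normc (z 0 i))}.
    apply: (@continuous_complex_real _ _ (fun z : CN => z 0 i) (@normc R) z).
      exact: normc_dist.
    exact: coord_continuous.
  apply: (@continuous_comp CN R R (fun z => normc (z 0 i)) (fun x => x ^+ 2)); first exact: c.
  exact: exprn_continuous.
move=> z; apply: (@continuous_comp CN R R (fun z => \sum_(i < N) normc (z 0 i) ^+ 2) Num.sqrt).
  exact: sum_cont.
exact: sqrt_continuous.
Qed.

Lemma coord_le_euclid (z : CN) i : normc (z 0 i) <= euclid_norm z.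
Proof.
rewrite -[leLHS]ger0_norm ?normc_ge0// -sqrtr_sqr /euclid_norm ler_wsqrtr//.
by rewrite (bigD1 i)//= lerDl sumr_ge0// => j _; rewrite sqr_ge0.
Qed.

Lemma compact_closed_ball r : r <= 1 -> compact [set z : CN | euclid_norm z <= r].
Proof.
move=> r1.
have cP : compact [set z : CN | forall i, [set w : C | `|complex.Re w| <= 1 /\ `|complex.Im w| <= 1] (z ord0 i)].
  by apply: (@rV_compact C N (fun=>
    [set w : C | `|complex.Re w| <= 1 /\ `|complex.Im w| <= 1])) => i;
      exact: compact_complex_square.
apply: subclosed_compact cP _.
  apply: (@preimage_closed _ _ (@euclid_norm R N) [set x | x <= r]).
    by move=> z _; exact: euclid_norm_continuous.
  exact: closed_le.
move=> z /= zr i; have := le_trans (le_trans (coord_le_euclid z i) zr) r1.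
by move=> h; split; apply: le_trans h; [exact: Re_le_normc|exact: Im_le_normc].
Qed.

Lemma holomorphic_bounded (f : CN -> C) r : holomorphic f -> r < 1 ->
  exists2 M, 0 <= M & forall z, euclid_norm z <= r -> normc (f z) <= M.
Proof.
move=> hf r1.
have cf z : euclid_norm z <= r -> {for z, continuous (fun z => normc (f z))}.
  move=> zr; apply: continuous_complex_real; first exact: normc_dist.
  by apply/differentiable_continuous/hf; exact: le_lt_trans r1.
have : compact ((fun z => normc (f z)) @` [set z : CN | euclid_norm z <= r]).
  apply: continuous_compact; last exact/compact_closed_ball/ltW.
  by apply: continuous_in_subspaceT => z; rewrite inE; exact: cf.
move=> /compact_bounded [M [_ hM]].
exists (`|M| + 1); first by rewrite addr_ge0.
move=> z zr; apply: le_trans (ler_norm _) _; apply: (hM (`|M| + 1)); last by exists z.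
by rewrite (le_lt_trans (ler_norm _))// ltrDl.
Qed.

End compactness.

Theorem theorem2p7 (R : realType) (N : nat) (alpha : R) (psi : R -> R)
    (hN : (1 <= N)%N) (halpha : -1 < alpha)
    (hpsi : orlicz_function psi) (hDelta2 : Delta2_condition psi) :
  [/\ bergman_orlicz N alpha psi = growth_space (orlicz_weight N psi),
      (exists c C : R, [/\ 0 < c, 0 < C &
        forall f, bergman_orlicz N alpha psi f ->
          (c%:E * weighted_sup_norm (orlicz_weight N psi) f
             <= luxemburg_norm alpha psi f)%E /\
          (luxemburg_norm alpha psi f
             <= C%:E * weighted_sup_norm (orlicz_weight N psi) f)%E]) &
      bergman_morse_orlicz N alpha psi
        = little_growth_space (orlicz_weight N psi)].
Proof.
have [D D0 hD] := integral_of_growth hN halpha hpsi hDelta2.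
have w0 (z : 'rV[complex_field R]_N) : unit_ball z -> 0 < orlicz_weight N psi z.
  by move=> zb; have [y [-> _ y0 _]] := weight_inv hpsi zb; rewrite invr_gt0.
have origin : @unit_ball R N 0.
  rewrite /unit_ball/= /euclid_norm big1 ?sqrtr0// => i _.
  by rewrite mxE -[normc _]/(normc 0) normc0 expr0n.
have sup_ge0 f : (0 <= weighted_sup_norm (orlicz_weight N psi) f)%E.
  apply: le_trans (ereal_sup_ubound _); last by exists 0.
  by rewrite lee_fin mulr_ge0 ?normc_ge0// ltW// w0.
have sup_le f z : unit_ball z ->
    ((normc (f z) * orlicz_weight N psi z)%:E <= weighted_sup_norm (orlicz_weight N psi) f)%E.
  by move=> zb; apply: ereal_sup_ubound; exists z.
have le_sup f M : (forall z, unit_ball z -> normc (f z) * orlicz_weight N psi z <= M) ->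
    (weighted_sup_norm (orlicz_weight N psi) f <= M%:E)%E.
  by move=> h; apply: ge_ereal_sup => _ [z zb <-]; rewrite lee_fin h.
have growth_sub f : growth_space (orlicz_weight N psi) f ->
    exists2 M, 0 <= M & weighted_sup_norm (orlicz_weight N psi) f = M%:E.
  move=> [_]; have := sup_ge0 f; case: weighted_sup_norm => // M; rewrite lee_fin => M0 _.
  by exists M.
have sub1 f : bergman_orlicz N alpha psi f -> growth_space (orlicz_weight N psi) f.
  move=> [hf [c c0 fc]]; split => //.
  pose I := fine `|orlicz_integral alpha psi f c|%E.
  have fI : (orlicz_integral alpha psi f c <= I%:E)%E.
    move: fc; rewrite /I; case: orlicz_integral => [x| |]//= _.
      by rewrite lee_fin ler_norm.
    by rewrite leNye.
  have I0 : 0 <= I by rewrite fine_ge0.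
  have [B B0 hB] := growth_of_integral hN halpha hpsi hDelta2 I0.
  by apply: le_lt_trans (le_sup f (B * c) _) (ltry _) => z; exact: hB fI z.
have sub2 f : growth_space (orlicz_weight N psi) f -> bergman_orlicz N alpha psi f.
  move=> gf; have [M M0 ME] := growth_sub f gf; have [hf _] := gf; split => //.
  have M1 : 0 < M + 1 by rewrite ltr_wpDl.
  exists (D * (M + 1)); first by rewrite mulr_gt0.
  apply: le_lt_trans (hD f (M + 1) hf M1 _) (ltry _) => z zb.
  have := sup_le f z zb; rewrite ME lee_fin => /le_trans; apply.
  by rewrite lerDl.
split.
- by apply/seteqP; split => f; [exact: sub1|exact: sub2].
- have [B B0 hB] := growth_of_integral hN halpha hpsi hDelta2 ler01.
  exists B^-1, D; split; [by rewrite invr_gt0|by []|].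
  move=> f bf; have gf := sub1 f bf; have [hf _] := gf.
  have [M M0 ME] := growth_sub f gf; split.
    apply: le_ereal_inf_tmp => _ [c [c0 fc] <-].
    rewrite lee_pdivrMl//; apply: le_sup => z; exact: hB fc z.
  rewrite ME; apply/lee_addgt0Pr => e e0.
  (* The bound M + e / D is positive even when the sup norm M is 0. *)
  have De : 0 < e / D by rewrite divr_gt0.
  have Me : 0 < M + e / D by rewrite ltr_wpDl.
  have -> : (D%:E * M%:E + e%:E = (D * (M + e / D))%:E)%E.
    by rewrite -EFinM -EFinD; congr (_%:E); field; rewrite gt_eqF.
  apply: ereal_inf_lbound; exists (D * (M + e / D)) => //; split; first exact: mulr_gt0.
  apply: hD => // z zb; have := sup_le f z zb; rewrite ME lee_fin => /le_trans; apply.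
  by rewrite lerDl ltW.
apply/seteqP; split => f [hf hfc]; split => //.
  move=> e e0; have [d d0 hd] := little_growth_of_integral hN halpha hpsi hDelta2 hf hfc e0.
  near=> r => z zr.
  have r1 : r < 1 by near: r; exact: nbhs_left_lt.
  apply: hd; first by rewrite /unit_ball/= zr.
  by rewrite zr ltrBlDl -ltrBlDr; near: r; apply: nbhs_left_gt; rewrite gtrBl.
move=> c c0.
have [B [C1 [B1 C10 hB]]] := integral_of_bound hN halpha hpsi hDelta2.
have B0 : 0 < B by exact: lt_le_trans B1.
have cB : 0 < c / B by rewrite divr_gt0.
(* Near the boundary |f| / c <= y / B. *)
have := hfc _ cB; rewrite near_withinE => -[d /= d0 hd].
have r1 : 1 - d / 2 < 1 by rewrite gtrBl divr_gt0.
have [M M0 hM] := holomorphic_bounded hf r1.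
have pM0 : 0 <= psi (M / c) by apply: (orlicz_ge0 hpsi); rewrite divr_ge0// ltW.
apply: le_lt_trans (hB f c 1 (psi (M / c)) hf c0 ler01 pM0 _) (ltry _) => z zb.
rewrite mul1r.
have s0 : 0 <= 1 / (1 - euclid_norm z) by rewrite divr_ge0// subr_ge0 ltW.
set y := orlicz_inv psi _; have y0 : 0 <= y by exact: (orlicz_inv_ge0 hpsi).
have yB : 0 <= psi (y / B) by apply: (orlicz_ge0 hpsi); rewrite divr_ge0// ltW.
have nf : 0 <= normc (f z) / c by apply: divr_ge0; [exact: normc_ge0|exact: ltW].
have [zr|rz] := leP (euclid_norm z) (1 - d / 2).
  apply: (@le_trans _ _ (psi (M / c))); last by rewrite lerDl.
  by apply: (orlicz_le hpsi) => //; rewrite ler_pM2r ?invr_gt0// hM.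
apply: (@le_trans _ _ (psi (y / B))); last by rewrite lerDr.
have y_gt0 : 0 < y by apply: (orlicz_inv_gt0 hpsi); rewrite divr_gt0// subr_gt0.
apply: (orlicz_le hpsi) => //.
have zd : ball (1 : R) d (euclid_norm z).
  rewrite /ball/= gtr0_norm ?subr_gt0//; lra.
have := hd _ zd zb z erefl; rewrite /orlicz_weight -/y ltr_pdivrMr// => h.
rewrite ler_pdivrMr//; apply: (le_trans (ltW h)); rewrite le_eqVlt; apply/orP; left.
by apply/eqP; field; rewrite gt_eqF.
Unshelve. all: by end_near. Qed.
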